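(* Let $0<\beta\le 1$, $\alpha>0$, $p>0$ and $0<\lambda<\alpha^\beta$. Then for $t>0$ the fractional negative binomial process $\{Q_\beta(t,\lambda)\}_{t\ge0}$ has the one-dimensional distributions $\delta_\beta(n|\alpha,pt,\lambda)=\mathbb{P}[Q_\beta(t,\lambda)=n]$, $n=0,1,2,\ldots$, given by $$\delta_\beta(n|\alpha,pt,\lambda)=\frac{1}{\Gamma(pt)\,n!}\Big(\frac{\lambda}{\alpha^\beta}\Big)^n\,{}_2\psi_1\left[-\frac{\lambda}{\alpha^\beta}\,\middle|\,\begin{matrix}(n+1,1),&(n\beta+pt,\beta)\\ (n\beta+1,\beta)&\end{matrix}\right]$$ $$=\frac{1}{\Gamma(pt)\,n!}\Big(\frac{\lambda}{\alpha^\beta}\Big)^n\,H^{1,2}_{2,2}\left[\frac{\lambda}{\alpha^\beta}\,\middle|\,\begin{matrix}(-n,1),&(1-n\beta-pt,\beta)\\ (0,1),&(-n\beta,\beta)\end{matrix}\right].$$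
   Context: Gamma process: $\{\Gamma(t)\}_{t\ge0}$ is the gamma subordinator with $\Gamma(t)\sim G(\alpha,pt)$, i.e. with density $g(y|\alpha,pt)=\frac{\alpha^{pt}}{\Gamma(pt)}y^{pt-1}e^{-\alpha y}$, $y>0$. Fractional Poisson process (FPP): $\{N_\beta(t,\lambda)\}_{t\ge0}$ has $\mathbb{P}[N_\beta(t,\lambda)=n]=\frac{(\lambda t^{\beta})^n}{n!}\sum_{k=0}^{\infty}\frac{(n+k)!}{k!}\frac{(-\lambda t^{\beta})^k}{\Gamma(\beta(k+n)+1)}$ (for $\beta=1$ it is the Poisson process of rate $\lambda$). Fractional negative binomial process (FNBP): $Q_\beta(t,\lambda)=N_\beta(\Gamma(t),\lambda)$, $t\ge0$, with $\{N_\beta(t,\lambda)\}$ independent of $\{\Gamma(t)\}$. Generalized Wright function: ${}_P\psi_R\left[z\,\middle|\,\begin{matrix}(a_i,\alpha_i)_{1,P}\\(b_j,\beta_j)_{1,R}\end{matrix}\right]=\sum_{k=0}^\infty\frac{\prod_{i=1}^P\Gamma(a_i+\alpha_i k)}{\prod_{j=1}^R\Gamma(b_j+\beta_j k)}\frac{z^k}{k!}$. $H$-function: $H^{m,n}_{P,R}\left[z\,\middle|\,\begin{matrix}(a_i,A_i)_{1,P}\\(b_j,B_j)_{1,R}\end{matrix}\right]=\frac{1}{2\pi i}\int_L\frac{\prod_{j=1}^m\Gamma(b_j+B_js)\prod_{i=1}^n\Gamma(1-a_i-A_is)}{\prod_{i=n+1}^P\Gamma(a_i+A_is)\prod_{j=m+1}^R\Gamma(1-b_j-B_js)}z^{-s}\,ds$,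 where $A_i,B_j>0$, empty products are $1$, and the contour $L$ runs from $c-i\infty$ to $c+i\infty$ and separates the poles of $\Gamma(b_j+B_js)$, $1\le j\le m$, from the poles of $\Gamma(1-a_i-A_is)$, $1\le i\le n$. *)

(* Defs.v *)
From HB Require Import structures.
From mathcomp Require Import all_boot all_order all_algebra.
From mathcomp Require Export complex.
From mathcomp Require Import all_classical all_reals all_analysis.

Set Implicit Arguments.
Unset Strict Implicit.
Unset Printing Implicit Defensive.

Import Order.TTheory GRing.Theory Num.Theory.
Import numFieldNormedType.Exports.

Local Open Scope classical_set_scope.
Local Open Scope ring_scope.
Local Open Scope complex_scope.

Section SpecialFunctions.
Context {R : realType}.
Local Notation mu := (@lebesgue_measure R).

Definition complex_integrable (D : set R) (f : R -> R[i]) : Prop :=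
  mu.-integrable D (fun x => (complex.Re (f x))%:E) /\
  mu.-integrable D (fun x => (complex.Im (f x))%:E).

Definition complex_integral (D : set R) (f : R -> R[i]) : R[i] :=
  (\int[mu]_(x in D) complex.Re (f x)) +i*
  (\int[mu]_(x in D) complex.Im (f x)).

(* x^w = exp (w ln x) with the principal logarithm, meant for x > 0. *)
Definition cpow (x : R) (w : R[i]) : R[i] :=
  (expR (complex.Re w * ln x))%:C *
  (cos (complex.Im w * ln x) +i* sin (complex.Im w * ln x)).

Definition euler_integral (w : R[i]) : R[i] :=
  complex_integral `]0, +oo[ (fun x => cpow x (w - 1) * (expR (- x))%:C).

(* Gamma(w) = Gamma(w + m) / (w (w + 1) ... (w + m - 1)), where m = 0 if
   Re w > 0 and otherwise m is the least natural number with Re (w + m) > 0.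
   At the poles 0, -1, -2, ... the value is 0 because 0^-1 = 0; hence
   (cGamma w)^-1 is the entire function 1 / Gamma everywhere. *)
Definition cGamma (w : R[i]) : R[i] :=
  let m := if 0 < complex.Re w then 0%N
           else (Num.truncn (- complex.Re w)).+1 in
  euler_integral (w + m%:R) / \prod_(j < m) (w + j%:R).

Definition rGamma (x : R) : R := complex.Re (cGamma x%:C).

(* A list [:: (a_1, A_1); (a_2, A_2) ...] of pairs holds the parameters
   (a_i, A_i) of the generalized Wright function and of the H-function. *)
Definition wright_term (num den : seq (R * R)) (z : R) (k : nat) : R :=
  (\prod_(q <- num) rGamma (q.1 + q.2 * k%:R)) /
  (\prod_(q <- den) rGamma (q.1 + q.2 * k%:R)) * (z ^+ k / k`!%:R).

Definition wright (num den : seq (R * R)) (z : R) : R :=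
  limn (series (wright_term num den z)).

(* Mellin-Barnes integrand of H^{m,n}_{P,R}, with P = size a, R = size b. *)
Definition foxH_integrand (m n : nat) (a b : seq (R * R)) (z : R) (s : R[i])
    : R[i] :=
  (\prod_(q <- take m b) cGamma (q.1%:C + q.2%:C * s)) *
  (\prod_(q <- take n a) cGamma (1 - q.1%:C - q.2%:C * s)) /
  ((\prod_(q <- drop n a) cGamma (q.1%:C + q.2%:C * s)) *
   (\prod_(q <- drop m b) cGamma (1 - q.1%:C - q.2%:C * s))) *
  cpow z (- s).

(* The line Re s = c has the poles of the Gamma (b_j + B_j s), j <= m, on its
   left and those of the Gamma (1 - a_i - A_i s), i <= n, on its right. *)
Definition separating (m n : nat) (a b : seq (R * R)) (c : R) : Prop :=
  (forall q, q \in take m b -> forall k : nat, - (q.1 + k%:R) / q.2 < c) /\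
  (forall q, q \in take n a -> forall k : nat, c < (1 - q.1 + k%:R) / q.2).

(* h is the value of H^{m,n}_{P,R} at z > 0.  The contours are the separating
   vertical lines s = c + iy, on which ds = i dy; at least one such line exists
   and the integral converges absolutely to h along every one of them. *)
Definition is_foxH (m n : nat) (a b : seq (R * R)) (z : R) (h : R[i]) : Prop :=
  [/\ (m <= size b)%N /\ (n <= size a)%N,
      (forall q, q \in a ++ b -> 0 < q.2),
      (exists c, separating m n a b c) &
      forall c, separating m n a b c ->
        let f (y : R) := foxH_integrand m n a b z (c +i* y) * (0 +i* 1) in
        complex_integrable setT f /\
        h = (2 * pi%:C * (0 +i* 1))^-1 * complex_integral setT f].

Definition gamma_pdf (a r y : R) : R :=
  if 0 < y then a `^ r / rGamma r * y `^ (r - 1) * expR (- (a * y)) else 0.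

Definition fpp_pmf (beta lambda s : R) (n : nat) : R :=
  (lambda * s `^ beta) ^+ n / n`!%:R *
  limn (series (fun k : nat => (n + k)`!%:R / k`!%:R *
    ((- (lambda * s `^ beta)) ^+ k / rGamma (beta * (k + n)%:R + 1)))).

End SpecialFunctions.

(* Processes are indexed by R; only their values at times >= 0 are used. *)
Section Processes.
Context {R : realType} {d : measure_display} {T : measurableType d}.
Variable P : probability T R.

(* Subordinator (Levy process with nondecreasing right-continuous paths) whose
   marginal at t > 0 is the gamma law G(alpha, p t). *)
Definition gamma_process (alpha p : R) (G : R -> {RV P >-> R}) : Prop :=
  [/\ (forall w, [/\ G 0 w = 0,
         (forall s t, 0 <= s -> s <= t -> G s w <= G t w) &
         (forall s, 0 <= s -> G u w @[u --> s^'+] --> G s w)]),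
      (forall (m : nat) (t : nat -> R) (B : nat -> set R),
         0 <= t 0%N -> (forall i, t i <= t i.+1) ->
         (forall i, measurable (B i)) ->
         P (\bigcap_(i in `I_m) [set w | B i (G (t i.+1) w - G (t i) w)]) =
         (\prod_(i < m) P [set w | B i (G (t i.+1) w - G (t i) w)%R])%E),
      (forall (s t : R) (B : set R), 0 <= s -> 0 <= t -> measurable B ->
         P [set w | B (G (s + t) w - G s w)] = P (G t @^-1` B)) &
      (forall (t : R) (B : set R), 0 < t -> measurable B ->
         P (G t @^-1` B) =
         (\int[lebesgue_measure]_(y in B) (gamma_pdf alpha (p * t) y)%:E)%E)].

(* Counting process with the one-dimensional laws of the fractional Poisson
   process. *)
Definition fractional_poisson_process (beta lambda : R)
    (N : R -> {RV P >-> nat}) : Prop :=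
  (forall w, [/\ N 0 w = 0%N,
     (forall s t, 0 <= s -> s <= t -> (N s w <= N t w)%N) &
     (forall s, 0 <= s -> \forall u \near s^'+, N u w = N s w)]) /\
  (forall (t : R) (n : nat), 0 <= t ->
     P [set w | N t w = n] = (fpp_pmf beta lambda t n)%:E).

Definition process_sigma {d'} {T' : measurableType d'} (X : R -> T -> T')
    : set (set T) :=
  <<s [set A | exists2 t : R, 0 <= t &
                 exists2 B, measurable B & A = X t @^-1` B] >>.

Definition independent_processes {d1 d2} {T1 : measurableType d1}
    {T2 : measurableType d2} (X : R -> T -> T1) (Y : R -> T -> T2) : Prop :=
  forall A B, process_sigma X A -> process_sigma Y B ->
    (P (A `&` B) = P A * P B)%E.

Definition fnbp (N : R -> {RV P >-> nat}) (G : R -> {RV P >-> R})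
    (t : R) (w : T) : nat := N (G t w) w.

End Processes.

(* Main.v *)
Require Import Defs.
From HB Require Import structures.
From mathcomp Require Import all_boot all_order all_algebra.
From mathcomp Require Import complex.
From mathcomp Require Import all_classical all_reals all_analysis.
From mathcomp Require Import measurable_realfun ring lra.

Set Implicit Arguments.
Unset Strict Implicit.
Unset Printing Implicit Defensive.

Import Order.TTheory GRing.Theory Num.Theory.
Import numFieldNormedType.Exports.

Local Open Scope classical_set_scope.
Local Open Scope ring_scope.
Local Open Scope complex_scope.

(** The law of the process and the H-function both reduce to one power series,

      sum_k (-1)^k (n + k)! / k! *
        Gamma (n beta + beta k + r) / Gamma (n beta + beta k + 1) * z^k,

    with r = p t and z = lambda / alpha^beta, which is the Wright function at - z.

    The law.  The process is N evaluated at the independent random time G t.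
    Replace G t by the right end of the cell of width 1 / (k + 1) that contains it.
    For this discrete time independence gives the law as an integral against the
    gamma density; since the paths of N are right-continuous step functions, the
    event is eventually the same as for the true time, and dominated convergence
    yields P [N (G t) = n] as the integral over y > 0 of the gamma density times
    P [N y = n] ([time_change_law]).  The fractional Poisson series is then
    integrated term by term ([gamma_mixture_series]).  The majorant comes from
    1 / Gamma (B + 1) <= exp X * X^(- B) at X = theta y, where theta < alpha and
    lambda < theta^beta: this is the place of lambda < alpha^beta.

    The H-function.  One would close the contour to the left and collect the
    residues of Gamma s at 0, -1, -2, and so on.  Residues are avoided as follows.
    For x > 0 and 0 < c < N + 1 the integral of
    Gamma s Gamma (N + 1 - s) x^(- s) along Re s = c is 2 pi N! / (1 + x)^(N + 1):
    by Euler's Beta integral this is Fourier inversion at the origin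
    ([gamma_pair_inversion]), and the absolute convergence comes from the functional
    equation of Gamma.  A rising factorial times Gamma s is Gamma at a shifted
    point, and rising factorials span the polynomials; hence for 0 < x < 1 and any
    product P of linear factors the integral of P s Gamma s Gamma (n + 1 - s) x^(- s)
    is 2 pi times the expected residue series, whose terms contain P (- k)
    ([mellin_polynomial]).  Finally, for M + 1 > r, the quotient
    Gamma (n beta + r - beta s) / Gamma (n beta + 1 - beta s) is a polynomial in s
    of degree M times a Beta integral of (1 + exp u)^(beta s), by Gamma (b + M) =
    (b)_M Gamma b.  The factor (1 + exp u)^(beta s) only replaces z by the smaller
    number z (1 + exp u)^(- beta), so Fubini's theorem and termwise integration in u
    give the series above ([mellin_barnes_gamma_quotient]).  Here beta <= 1 keeps
    the separating lines to the left of the poles of Gamma (n beta + 1 - beta s)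
    and the terms of the series below those of a negative binomial series.

    Gamma is handled through Euler's integral in the coordinate x = exp u, where
    the Beta integral is Fubini's theorem after a translation ([cGamma_beta]).  The
    quotient also requires Gamma to have no zeros in the right half-plane
    ([cGamma_neq0]): a zero would propagate to w + k for all k, and for large real
    part the integral is dominated by its real peak. *)


(** * Real integrals *)

Section RealIntegrals.
Context {d : measure_display} {T : measurableType d} {R : realType}.
Variable m : {measure set T -> \bar R}.

Lemma RintegrableZl (D : set T) (f : T -> R) (k : R) : measurable D ->
  m.-integrable D (EFin \o f) -> m.-integrable D (EFin \o (fun x => k * f x)).
Proof. by move=> mD /(integrableZl mD k); apply: eq_integrable. Qed.

Lemma RintegrableZr (D : set T) (f : T -> R) (k : R) : measurable D ->
  m.-integrable D (EFin \o f) -> m.-integrable D (EFin \o (fun x => f x * k)).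
Proof. by move=> mD /(integrableZr mD k); apply: eq_integrable. Qed.

Lemma RintegrableD (D : set T) (f g : T -> R) : measurable D ->
  m.-integrable D (EFin \o f) -> m.-integrable D (EFin \o g) ->
  m.-integrable D (EFin \o (fun x => f x + g x)).
Proof. by move=> mD fi /(integrableD mD fi); apply: eq_integrable. Qed.

Lemma RintegrableB (D : set T) (f g : T -> R) : measurable D ->
  m.-integrable D (EFin \o f) -> m.-integrable D (EFin \o g) ->
  m.-integrable D (EFin \o (fun x => f x - g x)).
Proof. by move=> mD fi /(integrableB mD fi); apply: eq_integrable. Qed.

Lemma Rintegrable_measurable (D : set T) (f : T -> R) :
  m.-integrable D (EFin \o f) -> measurable_fun D f.
Proof. by move=> /measurable_int/measurable_EFinP. Qed.

Lemma integrable_le (D : set T) (f g : T -> R) : measurable D ->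
  measurable_fun D f -> m.-integrable D (EFin \o g) ->
  (forall x, D x -> `|f x| <= g x) -> m.-integrable D (EFin \o f).
Proof.
move=> mD mf ig fg; apply: (le_integrable _ _ _ ig) => //.
  exact/measurable_EFinP.
move=> x Dx /=; rewrite lee_fin (le_trans (fg x Dx))//.
exact: ler_norm.
Qed.

Lemma Rintegral_dominated (D : set T) (f_ : nat -> T -> R) (f g : T -> R) :
  measurable D -> (forall n, measurable_fun D (f_ n)) ->
  (forall x, D x -> f_ ^~ x @ \oo --> f x) ->
  m.-integrable D (EFin \o g) ->
  (forall n x, D x -> `|f_ n x| <= g x) ->
  m.-integrable D (EFin \o f) /\
  (\int[m]_(x in D) f_ n x)%R @[n --> \oo] --> (\int[m]_(x in D) f x)%R.
Proof.
move=> mD mf_ ff ig fg.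
have mf : measurable_fun D f by exact: (measurable_fun_cvg _ ff).
have h1 n : measurable_fun D (EFin \o f_ n) by exact/measurable_EFinP.
have h2 : measurable_fun D (EFin \o f) by exact/measurable_EFinP.
have h3 : {ae m, forall x, D x -> (EFin \o f_ n) x @[n --> \oo] --> (EFin \o f) x}.
  by apply: aeW => x Dx; apply: cvg_EFin; [exact: nearW|exact: ff].
have h4 : {ae m, forall x n, D x -> (`|(EFin \o f_ n) x| <= (EFin \o g) x)%E}.
  by apply: aeW => x n Dx /=; rewrite lee_fin; exact: fg.
have [if_ _ cvgf] := dominated_convergence mD h1 h2 h3 ig h4.
split => //; apply/fine_cvg; rewrite fineK//.
exact: integrable_fin_num.
Qed.

(** Absolute partial sums below one integrable majorant give both the pointwise
    convergence and, by dominated convergence, the interchange of sum and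
    integral. *)
Lemma Rintegral_series (D : set T) (f_ : nat -> T -> R) (g : T -> R) :
  measurable D -> (forall k, measurable_fun D (f_ k)) ->
  m.-integrable D (EFin \o g) ->
  (forall K x, D x -> \sum_(0 <= k < K) `|f_ k x| <= g x) ->
  [/\ forall x, D x -> cvgn (series (f_ ^~ x)),
      forall k, m.-integrable D (EFin \o f_ k),
      m.-integrable D (EFin \o (fun x => limn (series (f_ ^~ x)))) &
      series (fun k => \int[m]_(x in D) f_ k x)%R @ \oo -->
        (\int[m]_(x in D) limn (series (f_ ^~ x)))%R].
Proof.
move=> mD mf ig fg.
have cvf x : D x -> cvgn (series (f_ ^~ x)).
  move=> Dx; apply: normed_cvg; apply: nondecreasing_is_cvgn.
    by apply/nondecreasing_seqP => n; rewrite /= /series/= big_nat_recr//= lerDl.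
  by exists (g x) => _ [K _ <-]; exact: fg.
have ifk k : m.-integrable D (EFin \o f_ k).
  apply: (integrable_le mD (mf k) ig) => x Dx.
  apply: le_trans (fg k.+1 x Dx); rewrite big_nat_recr//= lerDr.
  by rewrite sumr_ge0.
have isum K : m.-integrable D (EFin \o (fun x => series (f_ ^~ x) K)) /\
    (\int[m]_(x in D) series (f_ ^~ x) K)%R =
    series (fun k => \int[m]_(x in D) f_ k x)%R K.
  elim: K => [|K [iK IH]].
    have -> : (fun x => series (f_ ^~ x) 0%N) = cst 0.
      by apply/funext => x; rewrite /series/= big_geq.
    split; first exact: integrable0.
    by rewrite /series/= big_geq// /Rintegral integral0.
  have E : (fun x => series (f_ ^~ x) K.+1) =
      (fun x => series (f_ ^~ x) K + f_ K x).
    by apply/funext => x; rewrite /series/= big_nat_recr.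
  rewrite E; split.
    exact: RintegrableD.
  by rewrite RintegralD// IH /series/= big_nat_recr.
have mS K : measurable_fun D (fun x => series (f_ ^~ x) K).
  by have [/measurable_int/measurable_EFinP] := isum K.
have [||il cvl] := Rintegral_dominated mD mS _ ig _ (f := fun x => limn (series (f_ ^~ x))).
- by move=> x Dx; exact: cvf.
- move=> K x Dx; apply: le_trans (fg K x Dx); exact: ler_norm_sum.
split => //.
suff -> : series (fun k => \int[m]_(x in D) f_ k x)%R =
  (fun K => \int[m]_(x in D) series (f_ ^~ x) K)%R by [].
by apply/funext => K; have [_ ->] := isum K.
Qed.

End RealIntegrals.

Section Lebesgue.
Context {R : realType}.
Local Notation mu := (@lebesgue_measure R).

Lemma Lintegrable_le (f g : R -> R) : measurable_fun setT f ->
  mu.-integrable setT (EFin \o g) ->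
  (forall x, `|f x| <= g x) -> mu.-integrable setT (EFin \o f).
Proof.
move=> mf ig fg; apply: (integrable_le measurableT _ ig) => [|x _]; last exact: fg.
exact: mf.
Qed.

Lemma Rintegral_fubini (f : R * R -> R) (a b : R -> R) :
  measurable_fun setT f ->
  mu.-integrable setT (EFin \o a) -> mu.-integrable setT (EFin \o b) ->
  (forall x y, `|f (x, y)| <= a x * b y) ->
  [/\ forall x, mu.-integrable setT (EFin \o (fun y => f (x, y))),
      mu.-integrable setT (EFin \o (fun x => \int[mu]_y f (x, y))%R) &
      (\int[mu]_x \int[mu]_y f (x, y))%R = (\int[mu]_y \int[mu]_x f (x, y))%R].
Proof.
move=> mf ia ib fab.
have mfx x : measurable_fun setT (fun y => f (x, y)).
  by apply: (measurableT_comp mf); exact: measurable_pair1.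
have mfy y : measurable_fun setT (fun x => f (x, y)).
  by apply: (measurableT_comp mf); exact: measurable_pair2.
have ix x : mu.-integrable setT (EFin \o (fun y => f (x, y))).
  apply: (@integrable_le _ _ _ mu setT _ _ measurableT (mfx x)
    (RintegrableZl (a x) measurableT ib)) => y _; exact: fab.
have iy y : mu.-integrable setT (EFin \o (fun x => f (x, y))).
  apply: (@integrable_le _ _ _ mu setT _ _ measurableT (mfy y)
    (RintegrableZr (b y) measurableT ia)) => x _; exact: fab.
have mf' : measurable_fun setT (EFin \o f) by exact/measurable_EFinP.
have iff : (mu \x mu)%E.-integrable setT (EFin \o f).
  apply/(integrable12ltyP mu mu mf').
  apply: (@le_lt_trans _ _ (\int[mu]_x (`|a x|%:E * \int[mu]_y `|b y|%:E))%E).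
    apply: ge0_le_integral => //.
    - by move=> x _; exact: integral_ge0.
    - apply: (measurable_fun_fubini_tonelli_F (m2 := mu) (fun z => `|(EFin \o f) z|)%E) => //.
      exact: measurableT_comp.
    - apply: emeasurable_funM => //; apply/measurable_EFinP.
      by apply: measurableT_comp => //; exact: Rintegrable_measurable ia.
    - move=> x _; rewrite -ge0_integralZl//; last first.
        by apply/measurable_EFinP; apply: measurableT_comp => //; exact: Rintegrable_measurable ib.
      apply: ge0_le_integral => //.
      + by apply/measurable_EFinP; apply: measurableT_comp (mfx x).
      + apply/measurable_EFinP; apply: measurable_funM => //.
        by apply: measurableT_comp => //; exact: Rintegrable_measurable ib.
      + move=> y _ /=; rewrite lee_fin -normrM.
        exact: le_trans (fab x y) (ler_norm _).
  have ina := integrable_norm ia; have inb := integrable_norm ib.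
  have finb : (\int[mu]_y `|b y|%:E)%E \is a fin_num.
    exact: integrable_fin_num inb.
  rewrite -(fineK finb).
  under eq_integral do rewrite -EFinM.
  exact: (integrable_lty measurableT (RintegrableZr (fine _) measurableT ina)).
have EF : (EFin \o (fun x => \int[mu]_y f (x, y))%R) = fubini_F mu (EFin \o f).
  apply/funext => x; rewrite /= /Rintegral /fubini_F fineK//.
  exact: (integrable_fin_num _ (ix x)).
have EG : (EFin \o (fun y => \int[mu]_x f (x, y))%R) = fubini_G mu (EFin \o f).
  apply/funext => y; rewrite /= /Rintegral /fubini_G fineK//.
  exact: (integrable_fin_num _ (iy y)).
split => //; first by rewrite EF; exact: integrable_fubini_F.
rewrite [LHS]/Rintegral [RHS]/Rintegral; congr fine.
transitivity (\int[mu]_x (fubini_F mu (EFin \o f)) x)%E; first by rewrite -EF.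
transitivity (\int[mu]_y (fubini_G mu (EFin \o f)) y)%E; last by rewrite -EG.
by rewrite (integral12_prod_meas1 iff) (integral21_prod_meas1 iff).
Qed.

End Lebesgue.

(** * Changes of variables for Lebesgue measure *)

Section ChangeOfVariables.
Context {R : realType}.
Local Notation mu := (@lebesgue_measure R).

(** Lebesgue measure is determined by the lengths of half-open intervals, so the
    scaled push-forward has to be compared with it on those only. *)
Lemma ge0_integral_affine (a b : R) (f : R -> \bar R) : 0 < a ->
  measurable_fun setT f -> (forall x, 0 <= f x)%E ->
  (\int[mu]_x f x = a%:E * \int[mu]_x f (a * x + b)%R)%E.
Proof.
move=> ha mf f0.
have mphi : measurable_fun setT (fun x : R => a * x + b : measurableTypeR R).
  by apply: measurable_funD => //; exact: measurable_funM.
pose push := [the {measure set _ -> \bar R} of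
  pushforward mu (fun x : R => a * x + b : measurableTypeR R)].
pose nu := mscale (NngNum (ltW ha)) (push mphi).
transitivity (\int[nu]_x f x)%E.
  apply: eq_measure_integral => A mA _.
  apply: (@lebesgue_measure_unique R nu) => // _ [[u v] _ <-].
  rewrite /= /nu /mscale /= /pushforward.
  have -> : (fun x : R => a * x + b) @^-1` `]u, v] =
      `]((u - b) / a), ((v - b) / a)]%classic.
    apply/seteqP; split => x /=; rewrite !in_itv/= ltr_pdivrMr// ler_pdivlMr//;
      by rewrite (mulrC x) ltrBlDr lerBrDr.
  rewrite !lebesgue_measure_itv/= !lte_fin ltr_pM2r ?invr_gt0// ltrD2r.
  case: ifPn => _; last by rewrite mule0.
  rewrite -!EFinB -EFinM; congr EFin; field.
  by rewrite gt_eqF.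
rewrite /nu ge0_integral_mscale//=; congr (_ * _)%E.
by rewrite ge0_integral_pushforward.
Qed.

Lemma ge0_integral_opp (f : R -> \bar R) :
  measurable_fun setT f -> (forall x, 0 <= f x)%E ->
  (\int[mu]_x f (- x)%R = \int[mu]_x f x)%E.
Proof.
move=> mf f0.
have mopp : measurable_fun setT (-%R : _ -> measurableTypeR R) by [].
pose push := [the {measure set _ -> \bar R} of
  pushforward mu (-%R : _ -> measurableTypeR R)].
transitivity (\int[push mopp]_x f x)%E; first by rewrite ge0_integral_pushforward.
by apply: eq_measure_integral => A mA _; exact: lebesgue_measureN.
Qed.

(** A change-of-variables rule known for nonnegative functions extends to all
    functions through positive and negative parts. *)
Lemma Rintegral_from_ge0 (D E : set R) (g h : R -> R) (c : R) : 0 < c ->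
  (\int[mu]_(x in D) (Num.max (g x) 0)%:E =
   c%:E * \int[mu]_(x in E) (Num.max (h x) 0)%:E)%E ->
  (\int[mu]_(x in D) (Num.max (- g x) 0)%:E =
   c%:E * \int[mu]_(x in E) (Num.max (- h x) 0)%:E)%E ->
  (\int[mu]_(x in D) g x = c * \int[mu]_(x in E) h x)%R.
Proof.
move=> c0 gp gn.
have pE (f : R -> R) : (EFin \o f)^\+%E = fun x => (Num.max (f x) 0)%:E.
  by rewrite unlock; apply/funext => x; rewrite EFin_max.
have nE (f : R -> R) : (EFin \o f)^\-%E = fun x => (Num.max (- f x) 0)%:E.
  by rewrite unlock; apply/funext => x; rewrite EFin_max.
rewrite /Rintegral integralE [in RHS]integralE !pE !nE gp gn.
set u := (\int[mu]_(x in E) (Num.max (h x) 0)%:E)%E.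
set v := (\int[mu]_(x in E) (Num.max (- h x) 0)%:E)%E.
have u0 : (0 <= u)%E by apply: integral_ge0 => x _; rewrite lee_fin le_max lexx orbT.
have v0 : (0 <= v)%E by apply: integral_ge0 => x _; rewrite lee_fin le_max lexx orbT.
move: u v u0 v0 => [u| |] [v| |] //= _ _; rewrite ?gt0_muley ?lte_fin//= ?mulr0//.
by rewrite mulrBr.
Qed.

Lemma measurable_max0 (f : R -> R) : measurable_fun setT f ->
  measurable_fun setT (fun x => (Num.max (f x) 0)%:E).
Proof. by move=> mf; apply/measurable_EFinP; exact: measurable_maxr. Qed.

Lemma Rintegral_affine (a b : R) (f : R -> R) : 0 < a ->
  measurable_fun setT f ->
  (\int[mu]_x f x = a * \int[mu]_x f (a * x + b))%R.
Proof.
move=> a0 mf; have max_ge0 (x : R) : (0 <= (Num.max x 0)%:E)%E.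
  by rewrite lee_fin le_max lexx orbT.
have mNf : measurable_fun setT (- f) by exact: measurableT_comp.
apply: Rintegral_from_ge0 => //.
  exact: (ge0_integral_affine b a0 (measurable_max0 mf)).
exact: (ge0_integral_affine b a0 (measurable_max0 mNf)).
Qed.

Lemma integrable_affine (a b : R) (f : R -> R) : 0 < a ->
  mu.-integrable setT (EFin \o f) ->
  mu.-integrable setT (EFin \o (fun x => f (a * x + b))).
Proof.
move=> a0 intf; have mf := Rintegrable_measurable intf.
apply/integrableP; split.
  apply/measurable_EFinP; apply: measurableT_comp => //.
  by apply: measurable_funD => //; exact: measurable_funM.
have /integrableP[_] := intf.
rewrite (ge0_integral_affine (a := a) b)//=; last first.
  by apply/measurable_EFinP; exact: measurableT_comp.
set I := (\int[mu]_x _)%E.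
have : (0 <= I)%E by exact: integral_ge0.
by move: I => [u| |]//= _; rewrite ?ltry// gt0_muley ?lte_fin.
Qed.

Lemma Rintegral_shift (b : R) (f : R -> R) : measurable_fun setT f ->
  (\int[mu]_x f (x + b) = \int[mu]_x f x)%R.
Proof.
move=> mf; rewrite [RHS](Rintegral_affine b ltr01 mf) mul1r.
by apply: eq_Rintegral => x _; rewrite mul1r.
Qed.

Lemma integrable_shift (b : R) (f : R -> R) : mu.-integrable setT (EFin \o f) ->
  mu.-integrable setT (EFin \o (fun x => f (x + b))).
Proof.
move=> intf; apply: eq_integrable (integrable_affine b ltr01 intf) => // x _.
by rewrite /= mul1r.
Qed.

Lemma Rintegral_opp (f : R -> R) : measurable_fun setT f ->
  (\int[mu]_x f (- x) = \int[mu]_x f x)%R.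
Proof.
move=> mf; have max_ge0 (x : R) : (0 <= (Num.max x 0)%:E)%E.
  by rewrite lee_fin le_max lexx orbT.
have mNf : measurable_fun setT (- f) by exact: measurableT_comp.
rewrite -[RHS]mul1r; apply: Rintegral_from_ge0 => //; rewrite mul1e.
  exact: (ge0_integral_opp (measurable_max0 mf)).
exact: (ge0_integral_opp (measurable_max0 mNf)).
Qed.

Lemma integrable_opp (f : R -> R) : mu.-integrable setT (EFin \o f) ->
  mu.-integrable setT (EFin \o (fun x => f (- x))).
Proof.
move=> intf; have mf := Rintegrable_measurable intf.
apply/integrableP; split.
  by apply/measurable_EFinP; apply: (measurableT_comp mf).
have /integrableP[_] := intf.
rewrite -(ge0_integral_opp (f := fun x => `|(EFin \o f) x|)%E)//.
by apply: measurableT_comp => //; exact/measurable_EFinP.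
Qed.

Lemma integrable_expNabs (e : R) : 0 < e ->
  mu.-integrable setT (EFin \o (fun x => expR (- (e * `|x|)))).
Proof.
move=> e0; have ip := integrable_exponential_pdf e0.
apply: (integrable_le measurableT _ (RintegrableZl e^-1 measurableT
  (RintegrableD measurableT ip (integrable_opp ip)))).
  apply: measurableT_comp => //; apply: measurableT_comp => //.
  by apply: measurable_funM => //; exact: measurableT_comp.
move=> x _; rewrite ger0_norm ?expR_ge0// ler_pdivlMl//.
have [x0|x0] := leP 0 x.
  by rewrite (ger0_norm x0) exponential_pdfE// mulNr lerDl exponential_pdf_ge0// ltW.
have xN0 : 0 <= - x by rewrite oppr_ge0 ltW.
by rewrite (ltr0_norm x0) (exponential_pdfE _ xN0) mulNr lerDr exponential_pdf_ge0// ltW.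
Qed.

Lemma integral_oneDsqr :
  (\int[mu]_x ((1 + x ^+ 2)^-1)%:E = pi%:E)%E.
Proof.
rewrite (ge0_symfun_integralT (f := fun x : R => (1 + x ^+ 2)^-1)); first last.
- by move=> x /=; rewrite sqrrN.
- exact: continuous_oneDsqrV.
- by move=> x; rewrite invr_ge0 addr_ge0// sqr_ge0.
by rewrite -set_itvcy integral0y_oneDsqr -EFinM mulrC divfK.
Qed.

Lemma integrable_oneDsqr :
  mu.-integrable setT (EFin \o (fun x : R => (1 + x ^+ 2)^-1)).
Proof.
apply/integrableP; split.
  apply/measurable_EFinP; apply: continuous_measurable_fun.
  exact: continuous_oneDsqrV.
rewrite (_ : (\int[mu]_x _ = pi%:E)%E) ?ltry// -integral_oneDsqr.
by apply: eq_integral => x _ /=; rewrite ger0_norm// invr_ge0 addr_ge0// sqr_ge0.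
Qed.

Lemma Rintegral_exhaust (D : set R) (A : nat -> set R) (f : R -> R) :
  measurable D -> mu.-integrable D (EFin \o f) ->
  (forall k, measurable (A k)) -> (forall k, A k `<=` D) ->
  (forall x, D x -> \forall k \near \oo, A k x) ->
  (\int[mu]_(x in A k) f x)%R @[k --> \oo] --> (\int[mu]_(x in D) f x)%R.
Proof.
move=> mD intf mA AD Ax.
have mf := Rintegrable_measurable intf.
have [|||||_] := @Rintegral_dominated _ _ _ mu D (fun k => f \_ (A k)) f (fun x => `|f x|).
- by [].
- move=> k; apply/(measurable_restrict f (mA k) mD).
  by apply: (measurable_funS mD) mf => x [].
- move=> x Dx; apply: cvg_near_cst; near=> k.
  by rewrite patchE mem_set//; near: k; exact: Ax.
- exact: integrable_norm.
- by move=> k x Dx; rewrite /= patchE; case: ifPn => // _; rewrite normr0.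
under eq_fun do rewrite -Rintegral_mkcondr setIidr//.
by [].
Unshelve. all: by end_near. Qed.

End ChangeOfVariables.

Section FTC.
Context {R : realType}.
Local Notation mu := (@lebesgue_measure R).

Lemma Rintegral_FTC (F f : R -> R) (a b : R) : a < b ->
  (forall x : R, is_derive x 1 F (f x)) -> continuous f ->
  (\int[mu]_(x in `[a, b]) f x = F b - F a)%R.
Proof.
move=> ab dF cf.
have cF : continuous F.
  by move=> x; apply: differentiable_continuous; apply/derivable1_diffP; exact: ex_derive.
rewrite /Rintegral (@continuous_FTC2 _ f F) //.
- exact: continuous_subspaceT.
- split; first by move=> x _; exact: ex_derive.
  + by apply: cvg_at_right_filter; exact: cF.
  + by apply: cvg_at_left_filter; exact: cF.
- by move=> x _; rewrite derive1E; exact: derive_val.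
Qed.

Lemma near_in_symitv (x : R) : \forall k \near \oo, x \in `[- k%:R, k%:R].
Proof.
near=> k; rewrite in_itv/= -ler_norml.
near: k; exact: nbhs_infty_ger.
Unshelve. all: by end_near. Qed.

Lemma Rintegral_FTC_T (F f : R -> R) (l1 l2 : R) :
  (forall x : R, is_derive x 1 F (f x)) -> continuous f ->
  mu.-integrable setT (EFin \o f) ->
  F k%:R @[k --> \oo] --> l1 -> F (- k%:R) @[k --> \oo] --> l2 ->
  (\int[mu]_x f x = l1 - l2)%R.
Proof.
move=> dF cf intf F1 F2.
have lim := @Rintegral_exhaust R setT (fun k => `[- k%:R, k%:R]%classic) f
  measurableT intf (fun k => measurable_itv _) (fun k => @subsetT _ _)
  (fun x _ => near_in_symitv x).
rewrite -(cvg_lim _ lim)//; apply: cvg_lim => //.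
apply: cvg_trans (cvgB F1 F2); apply: near_eq_cvg; near=> k.
rewrite (Rintegral_FTC _ dF)// -subr_gt0 opprK addr_gt0// ltr0n; near: k;
  exact: nbhs_infty_gt.
Unshelve. all: by end_near. Qed.

Lemma Rintegral_FTC_0y (F f : R -> R) (l : R) :
  (forall x : R, is_derive x 1 F (f x)) -> continuous f ->
  mu.-integrable `[0, +oo[ (EFin \o f) ->
  F k%:R @[k --> \oo] --> l ->
  (\int[mu]_(x in `[0, +oo[) f x = l - F 0)%R.
Proof.
move=> dF cf intf F1.
have lim := @Rintegral_exhaust R `[0, +oo[%classic (fun k => `[0, k%:R]%classic) f
  (measurable_itv _) intf (fun k => measurable_itv _).
rewrite -(cvg_lim _ (lim _ _))//; last 2 first.
- by move=> k x /=; rewrite !in_itv/= => /andP[->].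
- move=> x /=; rewrite in_itv/= andbT => x0; near=> k.
  rewrite /= in_itv/= x0/=; near: k; exact: nbhs_infty_ger.
apply: cvg_lim => //.
apply: cvg_trans (cvgB F1 (cvg_cst (F 0))); apply: near_eq_cvg; near=> k.
rewrite (Rintegral_FTC _ dF)// ltr0n; near: k; exact: nbhs_infty_gt.
Unshelve. all: by end_near. Qed.

(** The substitution of exp u for the variable, exhausting both sides by compact intervals. *)
Lemma ge0_integral_exp (G : R -> R) :
  (forall x, 0 < x -> {for x, continuous G}) -> (forall x, 0 <= G x) ->
  (\int[mu]_(x in `]0%R, +oo[) (G x)%:E =
   \int[mu]_x (G (expR x) * expR x)%:E)%E.
Proof.
move=> cG G0.
have dexp : (@expR R)^`()%classic = expR.
  by apply/funext => x; rewrite derive1E; exact: derive_val.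
pose A k := `[expR (- k%:R : R), expR (k%:R : R)]%classic.
pose B k := `[- k%:R : R, k%:R]%classic.
have mG : measurable_fun (`]0, +oo[%classic : set R) G.
  apply: open_continuous_measurable_fun; first exact: interval_open.
  by move=> x; rewrite inE/= in_itv/= andbT; exact: cG.
have mGe : measurable_fun setT (fun x => G (expR x) * expR x).
  apply: continuous_measurable_fun => x; apply: cvgM; last exact: continuous_expR.
  by apply: continuous_comp; [exact: continuous_expR|apply: cG; exact: expR_gt0].
have UA : \bigcup_k A k = (`]0, +oo[%classic : set R).
  apply/seteqP; split => x /=.
    by move=> [k _]; rewrite /A/= !in_itv/= andbT => /andP[+ _]; exact/lt_le_trans/expR_gt0.
  rewrite in_itv/= andbT => x0; have [k _ /(_ k (leqnn k))] := near_in_symitv (ln x).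
  rewrite /= in_itv/= => /andP[k1 k2]; exists k => //.
  by rewrite /A/= in_itv/= -(lnK x0) !ler_expR k1 k2.
have UB : \bigcup_k B k = setT.
  apply/seteqP; split => x //= _; have [k _ /(_ k (leqnn k))] := near_in_symitv x.
  by move=> /= xk; exists k.
have ndA : nondecreasing_seq A.
  move=> i j ij; rewrite subsetEset => x; rewrite /A /= !in_itv/= => /andP[h1 h2].
  apply/andP; split; first by apply: le_trans h1; rewrite ler_expR lerN2 ler_nat.
  by apply: (le_trans h2); rewrite ler_expR ler_nat.
have ndB : nondecreasing_seq B.
  move=> i j ij; rewrite subsetEset => x; rewrite /B /= !in_itv/= => /andP[h1 h2].
  apply/andP; split; first by apply: le_trans h1; rewrite lerN2 ler_nat.
  by apply: (le_trans h2); rewrite ler_nat.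
have lA : (\int[mu]_(x in A k) (G x)%:E)%E @[k --> \oo] -->
    (\int[mu]_(x in \bigcup_k A k) (G x)%:E)%E.
  apply: ge0_nondecreasing_set_cvg_integral => //.
  - by move=> i; exact: measurable_itv.
  - move=> i; apply/measurable_EFinP; apply: measurable_funS mG => // x.
    rewrite /A /= !in_itv/= andbT => /andP[+ _].
    by apply: lt_le_trans; exact: expR_gt0.
  - by move=> i x _; rewrite lee_fin.
have lB : (\int[mu]_(x in B k) (G (expR x) * expR x)%:E)%E @[k --> \oo] -->
    (\int[mu]_(x in \bigcup_k B k) (G (expR x) * expR x)%:E)%E.
  apply: ge0_nondecreasing_set_cvg_integral => //.
  - by move=> i; exact: measurable_itv.
  - by move=> i; apply/measurable_EFinP; exact: measurable_funTS.
  - by move=> i x _; rewrite lee_fin mulr_ge0// expR_ge0.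
rewrite -UA -UB -(cvg_lim _ lA)// -(cvg_lim _ lB)//.
congr (limn _); apply/funext => k; rewrite /A /B.
rewrite (@integration_by_substitution_increasing _ expR G) //.
- by apply: eq_integral => x _ /=; rewrite dexp.
- by rewrite -subr_ge0 opprK addr_ge0.
- by move=> x y _ _; rewrite ltr_expR.
- by rewrite dexp => x _; exact: continuous_expR.
- rewrite dexp; apply/cvg_ex; exists (expR (- k%:R)).
  by apply: cvg_at_right_filter; exact: continuous_expR.
- rewrite dexp; apply/cvg_ex; exists (expR k%:R).
  by apply: cvg_at_left_filter; exact: continuous_expR.
- split; first by move=> x _; exact: ex_derive.
  + by apply: cvg_at_right_filter; exact: continuous_expR.
  + by apply: cvg_at_left_filter; exact: continuous_expR.
- apply: continuous_in_subspaceT => x; rewrite inE/= in_itv/= => /andP[+ _] => h.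
  by apply: cG; apply: lt_le_trans h; exact: expR_gt0.
Qed.

Lemma Rintegral_exp (G : R -> R) :
  (forall x, 0 < x -> {for x, continuous G}) ->
  (\int[mu]_(x in `]0, +oo[) G x = \int[mu]_x (G (expR x) * expR x))%R.
Proof.
move=> cG; rewrite -[RHS]mul1r.
have max0 (x y : R) : 0 <= y -> Num.max (x * y) 0 = Num.max x 0 * y.
  by move=> y0; rewrite maxr_pMl// mul0r.
apply: Rintegral_from_ge0 => //; rewrite mul1e.
  rewrite ge0_integral_exp.
  - by apply: eq_integral => x _; rewrite max0// expR_ge0.
  - by move=> x x0; apply: continuous_max; [exact: cG|exact: cvg_cst].
  - by move=> x; rewrite le_max lexx orbT.
rewrite (ge0_integral_exp (G := fun x => Num.max (- G x) 0)).
- by apply: eq_integral => x _; rewrite -mulNr max0// expR_ge0.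
- by move=> x x0; apply: continuous_max; [apply: cvgN; exact: cG|exact: cvg_cst].
- by move=> x; rewrite le_max lexx orbT.
Qed.

End FTC.

Section Derivatives.
Context {R : realType}.
Implicit Types (f g : R -> R) (x a b : R).

Lemma der_comp f g x a b : is_derive (g x) 1 f a -> is_derive x 1 g b ->
  is_derive x 1 (fun y => f (g y)) (a * b).
Proof. exact: is_derive1_comp. Qed.

Lemma der_mul f g x a b : is_derive x 1 f a -> is_derive x 1 g b ->
  is_derive x 1 (fun y => f y * g y) (a * g x + f x * b).
Proof.
move=> fa gb; apply: is_derive_eq (is_deriveM fa gb) _.
by rewrite /GRing.scale/= addrC mulrC.
Qed.

Lemma der_add f g x a b : is_derive x 1 f a -> is_derive x 1 g b ->
  is_derive x 1 (fun y => f y + g y) (a + b).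
Proof. exact: is_deriveD. Qed.

Lemma der_scale c f x a : is_derive x 1 f a ->
  is_derive x 1 (fun y => c * f y) (c * a).
Proof. exact: is_deriveZ. Qed.

Lemma der_lin c x : is_derive x 1 (fun y : R => c * y) c.
Proof. by rewrite -[X in is_derive _ _ _ X]mulr1; apply: der_scale; exact: is_derive_id. Qed.

End Derivatives.

(** * Fourier inversion at the origin *)

Section PoissonKernel.
Context {R : realType}.
Local Notation mu := (@lebesgue_measure R).

Lemma Rintegral_even (h : R -> R) : mu.-integrable setT (EFin \o h) ->
  (forall x, h (- x) = h x) ->
  (\int[mu]_x h x = 2 * \int[mu]_(x in `[0, +oo[) h x)%R.
Proof.
move=> ih hN; have mh := Rintegrable_measurable ih.
have mp : measurable (`[0%R, +oo[%classic : set R) by exact: measurable_itv.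
have mn : measurable (`]-oo, 0%R[%classic : set R) by exact: measurable_itv.
have UT : [set: R] = `[0%R, +oo[%classic `|` `]-oo, 0%R[%classic.
  by apply/seteqP; split => // x _ /=; rewrite !in_itv/= andbT; case: leP; [left|right].
rewrite [LHS](_ : _ = \int[mu]_(x in `[0%R, +oo[ `|` `]-oo, 0%R[) h x)%R; last by rewrite -UT.
rewrite Rintegral_setU//; last 2 first.
- by rewrite -UT.
- rewrite disj_set2E; apply/eqP; rewrite -subset0 => x []/= /[!in_itv]/=.
  by rewrite andbT leNgt => /negP.
rewrite mulr_natl mulr2n; congr (_ + _).
rewrite Rintegral_mkcond -Rintegral_opp; last first.
  by apply/(measurable_restrictT h mn); exact: measurable_funTS.
rewrite -(Rintegral_itv_obnd_cbnd (r := 0)); last exact: integrableS ih.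
rewrite [RHS]Rintegral_mkcond; apply: eq_Rintegral => x _.
by rewrite !patchE hN !mem_setE !in_itv/= andbT oppr_lt0.
Qed.

(** The Fourier transform of exp (- e |y|), from its explicit antiderivative. *)
Lemma Rintegral_expNabs_cos (e t : R) : 0 < e ->
  (\int[mu]_y (expR (- (e * `|y|)) * cos (t * y)) = 2 * (e / (e ^+ 2 + t ^+ 2)))%R.
Proof.
move=> e0; pose f (y : R) := expR (- e * y) * cos (t * y).
have q0 : e ^+ 2 + t ^+ 2 != 0 by rewrite gt_eqF// ltr_wpDr ?sqr_ge0// exprn_gt0.
pose F (y : R) := (e ^+ 2 + t ^+ 2)^-1 * (expR (- e * y) * (t * sin (t * y) + - e * cos (t * y))).
have cf : continuous f.
  move=> y; apply: cvgM.
    by apply: continuous_comp; [exact: mulrl_continuous|exact: continuous_expR].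
  by apply: continuous_comp; [exact: mulrl_continuous|exact: continuous_cos].
have dF (y : R) : is_derive y 1 F (f y).
  have dexp := der_comp (is_derive_expR (- e * y)) (der_lin (- e) y).
  have dsin := der_scale t (der_comp (is_derive_sin (t * y)) (der_lin t y)).
  have dcos := der_scale (- e) (der_comp (is_derive_cos (t * y)) (der_lin t y)).
  apply: is_derive_eq (der_scale _ (der_mul dexp (der_add dsin dcos))) _.
  by rewrite /f; field.
have ih : mu.-integrable setT (EFin \o (fun y => expR (- (e * `|y|)) * cos (t * y))).
  apply: (integrable_le measurableT _ (integrable_expNabs e0)).
    apply: measurable_funM.
      apply: measurableT_comp => //; apply: measurableT_comp => //.
      by apply: measurable_funM => //; exact: measurableT_comp.
    apply: continuous_measurable_fun => y.
    by apply: continuous_comp; [exact: mulrl_continuous|exact: continuous_cos].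
  by move=> y _; rewrite normrM ger0_norm ?expR_ge0// ler_piMr ?expR_ge0// ler_norml cos_geN1 cos_le1.
rewrite Rintegral_even//; last by move=> x; rewrite normrN mulrN cosN.
congr (_ * _).
have fE : {in `[0%R, +oo[%classic, (fun y => expR (- (e * `|y|)) * cos (t * y)) =1 f}.
  by move=> y; rewrite inE/= in_itv/= andbT => y0; rewrite /f ger0_norm// mulNr.
transitivity (\int[mu]_(x in `[0%R, +oo[) f x)%R; first exact: eq_Rintegral.
rewrite (@Rintegral_FTC_0y _ F f 0)//.
- by rewrite /F !mulr0 sin0 cos0 expR0; field.
- have := @integrableS _ _ _ mu setT _ _ measurableT (measurable_itv `[0%R, +oo[) (@subsetT _ _) ih.
  by apply: eq_integrable => // y /fE /= ->.
have -> : 0 = (e ^+ 2 + t ^+ 2)^-1 * 0 :> R by rewrite mulr0.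
apply: cvgM; first exact: cvg_cst.
apply/norm_cvg0P.
apply: (@squeeze_cvgr _ _ _ _ (cst 0) (fun k : nat => (`|t| + e) * expR (- (e * k%:R)))).
- near=> k; rewrite normr_ge0/= normrM ger0_norm ?expR_ge0// mulNr mulrC ler_wpM2r ?expR_ge0//.
  rewrite (le_trans (ler_normD _ _))// !normrM normrN (gtr0_norm e0) lerD//.
    by rewrite ler_piMr// ler_norml sin_geN1 sin_le1.
  by rewrite ler_piMr ?(ltW e0)// ler_norml cos_geN1 cos_le1.
- exact: cvg_cst.
- have -> : 0 = (`|t| + e) * 0 :> R by rewrite mulr0.
  apply: cvgM; first exact: cvg_cst.
  apply: (cvg_comp (fun k : nat => e * k%:R : R) (fun x => expR (- x))); last exact: cvgr_expR.
  by apply: (cvg_comp (fun k : nat => k%:R : R) ( *%R e)); [exact: cvgr_idn|exact: gt0_cvgMry].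
Unshelve. all: by end_near. Qed.

End PoissonKernel.

Section FourierInversion.
Context {R : realType}.
Local Notation mu := (@lebesgue_measure R).

(** Fourier inversion at the origin by Abel summation: damping the transform by
    exp (- e |y|) replaces g (0) by the Poisson average of g at scale e, which
    tends to g (0) because g is continuous and bounded. *)
Lemma fourier_inversion_at0 (g : R -> R) (C : R) :
  continuous g -> (forall x, `|g x| <= C) ->
  mu.-integrable setT (EFin \o g) ->
  mu.-integrable setT (EFin \o (fun y => \int[mu]_x (g x * cos (x * y)))%R) ->
  (\int[mu]_y (\int[mu]_x (g x * cos (x * y)))%R = 2 * pi * g 0)%R.
Proof.
move=> cg gC ig iA; set A := fun y => (\int[mu]_x (g x * cos (x * y)))%R.
have mg : measurable_fun setT g := Rintegrable_measurable ig.
have [e [e0 ecv]] : exists e : nat -> R,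
    (forall k, 0 < e k) /\ e k @[k --> \oo] --> (0 : R).
  by exists harmonic; split; [move=> k; rewrite /harmonic/= invr_gt0 ltr0n|exact: cvg_harmonic].
have mE (h : R) : measurable_fun setT (fun y : R => expR (- (h * `|y|))).
  apply: measurableT_comp => //; apply: measurableT_comp => //.
  by apply: measurable_funM => //; exact: measurableT_comp.
have E1 k (y : R) : expR (- (e k * `|y|)) <= 1.
  by rewrite -expR0 ler_expR oppr_le0 mulr_ge0// ltW.
have lim1 : (\int[mu]_y (A y * expR (- (e k * `|y|))))%R @[k --> \oo] -->
    (\int[mu]_y A y)%R.
  have [||||_] := @Rintegral_dominated _ _ _ mu setT
    (fun k y => A y * expR (- (e k * `|y|))) A (fun y => `|A y|) measurableT.
  - by move=> k; apply: measurable_funM; [exact: Rintegrable_measurable iA|exact: mE (e k)].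
  - move=> y _; rewrite -[X in _ --> X]mulr1; apply: cvgM; first exact: cvg_cst.
    rewrite -[X in _ --> X]expR0; apply: continuous_cvg; first exact: continuous_expR.
    rewrite -oppr0; apply: cvgN; rewrite -(mul0r `|y|).
    by apply: cvgM => //; exact: cvg_cst.
  - exact: integrable_norm.
  - move=> k y _; rewrite normrM (ger0_norm (expR_ge0 _)).
    by rewrite ler_piMr.
  by [].
have ccos (x : R) : continuous (fun y : R => cos (x * y)).
  by move=> y; apply: continuous_comp; [exact: mulrl_continuous|exact: continuous_cos].
have cos1 (x : R) : `|cos x| <= 1 by rewrite ler_norml cos_geN1 cos_le1.
have mcos (x : R) : measurable_fun setT (fun y : R => cos (y * x)).
  by under eq_fun do rewrite mulrC; exact: continuous_measurable_fun.
have swap (h : R) : 0 < h -> (\int[mu]_y (A y * expR (- (h * `|y|))) =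
    \int[mu]_x (g (h * x) * (2 / (1 + x ^+ 2))))%R.
  move=> h0; pose f (z : R * R) := g z.2 * cos (z.2 * z.1) * expR (- (h * `|z.1|)).
  have mf : measurable_fun setT f.
    apply: measurable_funM; last exact: (measurableT_comp (mE h)).
    apply: measurable_funM; first exact: (measurableT_comp mg).
    apply: measurableT_comp; last exact: measurable_funM.
    apply: continuous_measurable_fun; exact: continuous_cos.
  have dom y x : `|f (y, x)| <= expR (- (h * `|y|)) * `|g x|.
    rewrite /f/= !normrM mulrC (ger0_norm (expR_ge0 _)) ler_wpM2l ?expR_ge0//.
    by rewrite ler_piMr.
  have [_ _ sw] := Rintegral_fubini mf (integrable_expNabs h0)
    (integrable_norm ig) dom.
  clear dom.
  transitivity (\int[mu]_y \int[mu]_x f (y, x))%R.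
    apply: eq_Rintegral => y _; rewrite /A -(RintegralZr _ measurableT).
      by [].
    apply: (integrable_le measurableT _ (integrable_norm ig)) => [|x _].
      exact: (measurable_funM mg (mcos y)).
    by rewrite normrM ler_piMr.
  rewrite sw.
  transitivity (\int[mu]_x (g x * (2 * (h / (h ^+ 2 + x ^+ 2)))))%R.
    apply: eq_Rintegral => x _.
    rewrite -(Rintegral_expNabs_cos x h0) -(RintegralZl _ measurableT).
      by apply: eq_Rintegral => y _; rewrite /f /= -mulrA [X in _ * X]mulrC.
    apply: (integrable_le measurableT _ (integrable_expNabs h0)) => [|y _].
      exact: (measurable_funM (mE h) (continuous_measurable_fun (ccos x))).
    by rewrite normrM (ger0_norm (expR_ge0 _)) ler_piMr ?expR_ge0.
  have q0 (x : R) : 0 < h ^+ 2 + x ^+ 2.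
    by apply: ltr_wpDr; [exact: sqr_ge0|exact: exprn_gt0 h0].
  have mh : measurable_fun setT (fun x => g x * (2 * (h / (h ^+ 2 + x ^+ 2)))).
    apply: (measurable_funM mg); apply: continuous_measurable_fun => x.
    apply: cvgM; first exact: cvg_cst.
    apply: cvgM; first exact: cvg_cst.
    apply: cvgV; first by rewrite gt_eqF.
    by apply: cvgD; [exact: cvg_cst|exact: exprn_continuous].
  have ih : mu.-integrable setT
      (EFin \o (fun x => g x * (2 * (h / (h ^+ 2 + x ^+ 2))))).
    have ig2 := RintegrableZr (2 / h) measurableT (integrable_norm ig).
    apply: (Lintegrable_le mh ig2) => x.
    rewrite normrM.
    apply: ler_wpM2l; first exact: normr_ge0.
    have h2 : 0 <= h / (h ^+ 2 + x ^+ 2) by exact: divr_ge0 (ltW h0) (ltW (q0 x)).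
    rewrite ger0_norm; last exact: mulr_ge0.
    apply: ler_wpM2l; first exact: ler0n.
    rewrite (ler_pdivrMr _ _ (q0 x)) (ler_pdivlMl _ _ h0).
    by rewrite -expr2 lerDl sqr_ge0.
  rewrite (Rintegral_affine 0 h0 mh).
  rewrite -(RintegralZl _ measurableT (integrable_affine 0 h0 ih)).
  apply: eq_Rintegral => x _; rewrite addr0; field.
  rewrite (lt0r_neq0 (q0 (h * x))) andbT; apply: lt0r_neq0.
  by apply: ltr_wpDr; [exact: sqr_ge0|exact: ltr01].
have lim1' := cvg_lim (@Rhausdorff R) lim1; rewrite -[LHS]/(\int[mu]_y A y)%R -lim1'.
apply: cvg_lim; first exact: Rhausdorff.
have -> : (fun k => \int[mu]_y (A y * expR (- (e k * `|y|))))%R =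
    (fun k => \int[mu]_x (g (e k * x) * (2 / (1 + x ^+ 2))))%R.
  by apply/funext => k; rewrite swap.
have [||||_] := @Rintegral_dominated _ _ _ mu setT
  (fun k x => g (e k * x) * (2 / (1 + x ^+ 2))) (fun x => g 0 * (2 / (1 + x ^+ 2)))
  (fun x => C * (2 * (1 + x ^+ 2)^-1)) measurableT.
- move=> k; apply: measurable_funM.
    by apply: measurableT_comp => //; exact: measurable_funM.
  apply: measurable_funM => //; apply: continuous_measurable_fun.
  exact: continuous_oneDsqrV.
- move=> x _; apply: cvgM; last exact: cvg_cst.
  apply: continuous_cvg; first exact: cg.
  by rewrite -(mul0r x); apply: cvgM => //; exact: cvg_cst.
- by do 2 apply: RintegrableZl => //; exact: integrable_oneDsqr.
- move=> k x _; rewrite normrM ler_pM// ger0_norm// divr_ge0//.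
  by rewrite addr_ge0// sqr_ge0.
suff -> : (\int[mu]_x (g 0 * (2 / (1 + x ^+ 2))))%R = 2 * pi * g 0 by [].
rewrite (RintegralZl _ measurableT (RintegrableZl _ measurableT integrable_oneDsqr)).
rewrite (RintegralZl _ measurableT integrable_oneDsqr).
by rewrite /Rintegral integral_oneDsqr /= mulrC.
Qed.

Lemma Rintegral_sin_transform (g : R -> R) :
  mu.-integrable setT (EFin \o (fun y => \int[mu]_x (g x * sin (x * y)))%R) ->
  mu.-integrable setT (EFin \o g) ->
  (\int[mu]_y (\int[mu]_x (g x * sin (x * y)))%R = 0)%R.
Proof.
move=> iB ig; pose B y := (\int[mu]_x (g x * sin (x * y)))%R.
suff : (\int[mu]_y B y = - \int[mu]_y B y)%R.
  by move=> /eqP; rewrite -addr_eq0 -mulr2n mulrn_eq0 => /eqP.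
rewrite -{1}(Rintegral_opp (f := B)); last exact: Rintegrable_measurable iB.
rewrite -[RHS]mulN1r -(RintegralZl _ measurableT iB); apply: eq_Rintegral => y _.
rewrite /B -(RintegralZl _ measurableT).
  by apply: eq_Rintegral => x _; rewrite mulrN sinN; ring.
apply: (Lintegrable_le _ (integrable_norm ig)) => [|x].
  apply: measurable_funM; first exact: Rintegrable_measurable ig.
  apply: continuous_measurable_fun => x.
  by apply: continuous_comp; [exact: mulrr_continuous|exact: continuous_sin].
by rewrite normrM ler_piMr// ler_norml sin_geN1 sin_le1.
Qed.

End FourierInversion.

(** * Complex-valued functions of a real variable *)

Notation normc := complex.ComplexField.Normc.normc.
Notation Re := complex.Re.
Notation Im := complex.Im.

Section ComplexFacts.
Context {R : realType}.
Implicit Types (z w : R[i]) (x y : R).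

Lemma complex_ext z w : Re z = Re w -> Im z = Im w -> z = w.
Proof. by case: z w => [a b] [c d]/= -> ->. Qed.

Lemma ReD z w : Re (z + w) = Re z + Re w. Proof. by case: z w => [a b] []. Qed.
Lemma ImD z w : Im (z + w) = Im z + Im w. Proof. by case: z w => [a b] []. Qed.
Lemma ReN z : Re (- z) = - Re z. Proof. by case: z. Qed.
Lemma ImN z : Im (- z) = - Im z. Proof. by case: z. Qed.
Lemma ReM z w : Re (z * w) = Re z * Re w - Im z * Im w.
Proof. by case: z w => [a b] []. Qed.
Lemma ImM z w : Im (z * w) = Re z * Im w + Im z * Re w.
Proof. by case: z w => [a b] []. Qed.
Lemma natrC (n : nat) : (n%:R : R[i]) = n%:R%:C.
Proof. by rewrite rmorph_nat. Qed.

Lemma normcE z : normc z = Num.sqrt (Re z ^+ 2 + Im z ^+ 2).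
Proof. by case: z. Qed.

Lemma normc_ge0 z : 0 <= normc z.
Proof. by rewrite normcE sqrtr_ge0. Qed.

Lemma normcM z w : normc (z * w) = normc z * normc w.
Proof. exact: complex.ComplexField.Normc.normcM. Qed.

Lemma normc_eq0 z : (normc z == 0) = (z == 0).
Proof.
apply/eqP/eqP => [/complex.ComplexField.Normc.eq0_normc//|->].
exact: complex.ComplexField.Normc.normc0.
Qed.

Lemma normcV z : normc z^-1 = (normc z)^-1.
Proof. exact: complex.ComplexField.Normc.normcV. Qed.

Lemma Re_le_normc z : `|Re z| <= normc z.
Proof. by rewrite normcE -sqrtr_sqr ler_wsqrtr// lerDl sqr_ge0. Qed.

Lemma Im_le_normc z : `|Im z| <= normc z.
Proof. by rewrite normcE -sqrtr_sqr ler_wsqrtr// lerDr sqr_ge0. Qed.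

Lemma normcR x : normc x%:C = `|x|.
Proof. by rewrite normcE/= expr0n/= addr0 sqrtr_sqr. Qed.

Lemma realC_neq0 x : x != 0 -> x%:C != 0.
Proof. by move=> x0; rewrite -normc_eq0 normcR normr_eq0. Qed.

Lemma normcD z w : normc (z + w) <= normc z + normc w.
Proof. exact: le_normcD. Qed.

Lemma normc_le_ReIm z : normc z <= `|Re z| + `|Im z|.
Proof.
rewrite {1}(_ : z = (Re z)%:C + (0 +i* Im z)); last first.
  by case: z => a b; apply: complex_ext => /=; ring.
apply: (le_trans (normcD _ _)); rewrite normcR lerD2l normcE /=.
by rewrite expr0n/= add0r sqrtr_sqr.
Qed.

Lemma cpowE x z : cpow x z =
  (expR (Re z * ln x) * cos (Im z * ln x)) +i* (expR (Re z * ln x) * sin (Im z * ln x)).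
Proof. by apply: complex_ext; rewrite /= ?mul0r ?subr0 ?addr0. Qed.

Lemma cpowD x z w : cpow x (z + w) = cpow x z * cpow x w.
Proof.
by apply: complex_ext; rewrite !cpowE/= !ReD !ImD !mulrDl expRD ?cosD ?sinD; ring.
Qed.

Lemma cpowMx x y z : 0 < x -> 0 < y -> cpow (x * y) z = cpow x z * cpow y z.
Proof.
move=> x0 y0; apply: complex_ext; rewrite !cpowE/= lnM ?posrE// !mulrDr expRD ?cosD ?sinD;
  ring.
Qed.

Lemma normc_cpow x z : normc (cpow x z) = expR (Re z * ln x).
Proof.
rewrite cpowE normcE/= !exprMn -mulrDr cos2Dsin2 mulr1 sqrtr_sqr.
by rewrite ger0_norm ?expR_ge0.
Qed.

Lemma cpowR x y : 0 < x -> cpow x y%:C = (x `^ y)%:C.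
Proof.
move=> x0; rewrite cpowE/= mul0r cos0 sin0 mulr1 mulr0 /powR gt_eqF//.
Qed.

Lemma cpow_neq0 x z : cpow x z != 0.
Proof. by rewrite -normc_eq0 normc_cpow gt_eqF// expR_gt0. Qed.

End ComplexFacts.

Section ComplexMeasurable.
Context {d : measure_display} {T : measurableType d} {R : realType}.
Implicit Types (f g : T -> R[i]).

Definition cmeasurable f : Prop :=
  measurable_fun setT (fun x => Re (f x)) /\
  measurable_fun setT (fun x => Im (f x)).

Lemma cmeasurable_cst (c : R[i]) : cmeasurable (fun=> c).
Proof. by split; exact: measurable_cst. Qed.

Lemma cmeasurable_real (h : T -> R) : measurable_fun setT h ->
  cmeasurable (fun x => (h x)%:C).
Proof. by move=> mh; split => //; exact: measurable_cst. Qed.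

Lemma cmeasurable_mk (h k : T -> R) : measurable_fun setT h ->
  measurable_fun setT k -> cmeasurable (fun x => h x +i* k x).
Proof. by []. Qed.

Lemma cmeasurableD f g : cmeasurable f -> cmeasurable g ->
  cmeasurable (fun x => f x + g x).
Proof.
move=> [f1 f2] [g1 g2]; split.
  by under eq_fun do rewrite ReD; exact: measurable_funD.
by under eq_fun do rewrite ImD; exact: measurable_funD.
Qed.

Lemma cmeasurableN f : cmeasurable f -> cmeasurable (fun x => - f x).
Proof.
move=> [f1 f2]; split.
  by under eq_fun do rewrite ReN; exact: measurableT_comp.
by under eq_fun do rewrite ImN; exact: measurableT_comp.
Qed.

Lemma cmeasurableM f g : cmeasurable f -> cmeasurable g ->
  cmeasurable (fun x => f x * g x).
Proof.
move=> [f1 f2] [g1 g2]; split.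
  under eq_fun do rewrite ReM; apply: measurable_funB; exact: measurable_funM.
under eq_fun do rewrite ImM; apply: measurable_funD; exact: measurable_funM.
Qed.

Lemma cmeasurable_cpow (h : T -> R) f : measurable_fun setT h -> cmeasurable f ->
  cmeasurable (fun x => cpow (h x) (f x)).
Proof.
move=> mh [f1 f2].
have ml : measurable_fun setT (fun x => ln (h x)).
  by apply: (measurableT_comp (@measurable_ln R)).
have mc : measurable_fun setT (@cos R).
  by apply: continuous_measurable_fun; exact: continuous_cos.
have ms : measurable_fun setT (@sin R).
  by apply: continuous_measurable_fun; exact: continuous_sin.
have me : measurable_fun setT (fun x => expR (Re (f x) * ln (h x))).
  by apply: measurableT_comp => //; exact: measurable_funM.
under eq_fun do rewrite cpowE.
apply: cmeasurable_mk; apply: (measurable_funM me).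
  by apply: (measurableT_comp mc); exact: measurable_funM.
by apply: (measurableT_comp ms); exact: measurable_funM.
Qed.

End ComplexMeasurable.

Notation cintegrable := (complex_integrable setT).
Notation cint := (complex_integral setT).

Section ComplexIntegral.
Context {R : realType}.
Local Notation mu := (@lebesgue_measure R).
Implicit Types (f g : R -> R[i]).

Lemma cintegrable_cmeasurable f : cintegrable f -> cmeasurable f.
Proof.
move=> [i1 i2]; split.
  exact: (Rintegrable_measurable i1).
exact: (Rintegrable_measurable i2).
Qed.

Lemma cintegrable_le f (G : R -> R) : cmeasurable f ->
  mu.-integrable setT (EFin \o G) -> (forall x, normc (f x) <= G x) ->
  cintegrable f.
Proof.
move=> [m1 m2] iG fG; split.
  by apply: (Lintegrable_le m1 iG) => x; exact: le_trans (Re_le_normc _) (fG x).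
by apply: (Lintegrable_le m2 iG) => x; exact: le_trans (Im_le_normc _) (fG x).
Qed.

Lemma cintegrable_normc f : cintegrable f ->
  mu.-integrable setT (EFin \o (fun x => normc (f x))).
Proof.
move=> fi; have [m1 m2] := cintegrable_cmeasurable fi; have [i1 i2] := fi.
apply: (Lintegrable_le _ (RintegrableD measurableT (integrable_norm i1) (integrable_norm i2))).
  have ms : measurable_fun setT (@Num.sqrt R).
    by apply: continuous_measurable_fun; exact: sqrt_continuous.
  under eq_fun do rewrite normcE.
  apply: (measurableT_comp ms).
  by apply: measurable_funD; exact: measurable_funX.
by move=> x; rewrite ger0_norm ?normc_ge0//; exact: normc_le_ReIm.
Qed.

Lemma cintD f g : cintegrable f -> cintegrable g ->
  cintegrable (fun x => f x + g x) /\
  cint (fun x => f x + g x) = cint f + cint g.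
Proof.
move=> [f1 f2] [g1 g2].
have E1 : (fun x => Re (f x + g x)) = (fun x => Re (f x) + Re (g x)).
  by apply/funext => x; rewrite ReD.
have E2 : (fun x => Im (f x + g x)) = (fun x => Im (f x) + Im (g x)).
  by apply/funext => x; rewrite ImD.
split.
  split; rewrite -[X in integrable _ _ X]/(EFin \o _).
    by rewrite E1; exact: RintegrableD.
  by rewrite E2; exact: RintegrableD.
rewrite /complex_integral E1 E2 (RintegralD measurableT f1 g1) (RintegralD measurableT f2 g2).
by [].
Qed.

Lemma cintZ (c : R[i]) f : cintegrable f ->
  cintegrable (fun x => c * f x) /\ cint (fun x => c * f x) = c * cint f.
Proof.
move=> [f1 f2].
have E1 : (fun x => Re (c * f x)) = (fun x => Re c * Re (f x) - Im c * Im (f x)).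
  by apply/funext => x; rewrite ReM.
have E2 : (fun x => Im (c * f x)) = (fun x => Re c * Im (f x) + Im c * Re (f x)).
  by apply/funext => x; rewrite ImM.
have Z1 (k : R) := RintegrableZl k measurableT f1.
have Z2 (k : R) := RintegrableZl k measurableT f2.
split.
  split; rewrite -[X in integrable _ _ X]/(EFin \o _).
    by rewrite E1; exact: RintegrableB.
  by rewrite E2; exact: RintegrableD.
rewrite /complex_integral E1 E2 (RintegralB measurableT (Z1 _) (Z2 _)).
rewrite (RintegralD measurableT (Z2 _) (Z1 _)).
rewrite !(RintegralZl _ measurableT f1) !(RintegralZl _ measurableT f2).
by apply: complex_ext; rewrite ?ReM ?ImM.
Qed.

Lemma eq_cint f g : (forall x, f x = g x) -> cint f = cint g.
Proof. by move=> /funext ->. Qed.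

Lemma cint_real (h : R -> R) : cint (fun x => (h x)%:C) = (\int[mu]_x h x)%R%:C.
Proof. by apply: complex_ext => //=; rewrite /Rintegral integral0. Qed.

Lemma cint_normc_le f (G : R -> R) : cmeasurable f ->
  mu.-integrable setT (EFin \o G) -> (forall x, normc (f x) <= G x) ->
  normc (cint f) <= 2 * (\int[mu]_x G x)%R.
Proof.
move=> mf iG fG; have [i1 i2] := cintegrable_le mf iG fG.
apply: (le_trans (normc_le_ReIm _)); rewrite mulr_natl mulr2n lerD//=.
  apply: (le_trans (le_normr_Rintegral measurableT i1)).
  apply: (le_Rintegral measurableT (integrable_norm i1) iG) => x _ /=.
  exact: le_trans (Re_le_normc _) (fG x).
apply: (le_trans (le_normr_Rintegral measurableT i2)).
apply: (le_Rintegral measurableT (integrable_norm i2) iG) => x _ /=.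
exact: le_trans (Im_le_normc _) (fG x).
Qed.

Lemma cint_shift (b : R) f : cmeasurable f -> cint (fun x => f (x + b)) = cint f.
Proof.
move=> [m1 m2]; rewrite /complex_integral.
by rewrite (Rintegral_shift b m1) (Rintegral_shift b m2).
Qed.

Lemma cint_fubini (f : R * R -> R[i]) (a b : R -> R) :
  cmeasurable f ->
  mu.-integrable setT (EFin \o a) -> mu.-integrable setT (EFin \o b) ->
  (forall x y, normc (f (x, y)) <= a x * b y) ->
  [/\ forall x, cintegrable (fun y => f (x, y)),
      cintegrable (fun x => cint (fun y => f (x, y))) &
      cint (fun x => cint (fun y => f (x, y))) =
      cint (fun y => cint (fun x => f (x, y)))].
Proof.
move=> [m1 m2] ia ib fab.
have d1 x y : `|Re (f (x, y))| <= a x * b y := le_trans (Re_le_normc _) (fab x y).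
have d2 x y : `|Im (f (x, y))| <= a x * b y := le_trans (Im_le_normc _) (fab x y).
have [i1 j1 s1] := Rintegral_fubini m1 ia ib d1.
have [i2 j2 s2] := Rintegral_fubini m2 ia ib d2.
split; [by move=> x; split; [exact: i1|exact: i2]|by split; [exact: j1|exact: j2]|].
by apply: complex_ext; [exact: s1|exact: s2].
Qed.

End ComplexIntegral.

(** * The Gamma function on the right half-plane *)

Section LogGamma.
Context {R : realType}.
Local Notation mu := (@lebesgue_measure R).
Implicit Types (s w : R[i]) (c x y u : R).

(** In the coordinate x = exp u, Euler's integral runs over the whole line and
    multiplicative changes of variable become translations. *)
Definition euler_log w (u : R) : R[i] := cpow (expR u) w * (expR (- expR u))%:C.

Lemma normc_euler_log w u : normc (euler_log w u) = expR (Re w * u - expR u).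
Proof.
by rewrite normcM normc_cpow normcR ger0_norm ?expR_ge0// expRK -expRD.
Qed.

Lemma euler_log_le c : 0 < c ->
  exists2 C : R, 0 < C & forall u : R, expR (c * u - expR u) <= C * expR (- (c * `|u|)).
Proof.
move=> c0; pose m := (Num.truncn (2 * c)).+1.
have m0 : 0 < m`!%:R :> R by rewrite ltr0n fact_gt0.
exists m`!%:R => // u; have [u0|u0] := leP 0 u; last first.
  rewrite ltr0_norm// mulrN opprK -[X in X <= _]mul1r ler_pM ?expR_ge0//.
    by rewrite ler1n fact_gt0.
  by rewrite ler_expR gerBl expR_ge0.
rewrite ger0_norm// (_ : c * u - expR u = 2 * c * u + (- (c * u) - expR u)); last by ring.
have h1 : expR (2 * c * u) <= m`!%:R * expR (expR u).
  have : expR (2 * c * u) <= expR (u * m%:R).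
    rewrite ler_expR mulrC ler_wpM2l// ltW//.
    by rewrite truncnS_gt.
  move=> /le_trans; apply; rewrite expRM_natr mulrC -ler_pdivrMr//.
  by apply: le_trans (expR_ge1Dxn (Num.truncn (2 * c)) (expR_ge0 u)); rewrite lerDr.
rewrite expRD; apply: (le_trans (ler_wpM2r (expR_ge0 _) h1)).
by rewrite -mulrA -expRD addrCA subrr addr0.
Qed.

Lemma integrable_euler_log_real c : 0 < c ->
  mu.-integrable setT (EFin \o (fun u => expR (c * u - expR u))).
Proof.
move=> c0; have [C C0 hC] := euler_log_le c0.
apply: (Lintegrable_le _ (RintegrableZl C measurableT (integrable_expNabs c0))) => [|u].
  apply: measurableT_comp => //.
  by apply: measurable_funB; [exact: measurable_funM|exact: measurable_expR].
by rewrite ger0_norm ?expR_ge0//; exact: hC.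
Qed.

Lemma cmeasurable_cpow_expR w : cmeasurable (fun u : R => cpow (expR u) w).
Proof.
by apply: (cmeasurable_cpow (h := @expR R)); [exact: measurable_expR|exact: cmeasurable_cst].
Qed.

Lemma cmeasurable_euler_log w : cmeasurable (euler_log w).
Proof.
apply: cmeasurableM; first exact: cmeasurable_cpow_expR.
apply: cmeasurable_real; apply: measurableT_comp => //.
by apply: measurableT_comp.
Qed.

Lemma cintegrable_euler_log w : 0 < Re w -> cintegrable (euler_log w).
Proof.
move=> w0; apply: (cintegrable_le (cmeasurable_euler_log w) (integrable_euler_log_real w0)).
by move=> u; rewrite normc_euler_log.
Qed.

Lemma cGamma_log w : 0 < Re w -> cGamma w = cint (euler_log w).
Proof.
move=> w0; rewrite /cGamma w0 big_ord0 divr1 addr0 /euler_integral.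
have E u : expR (Re (w - 1) * u) * expR u = expR (Re w * u).
  by rewrite -expRD ReD ReN/= mulrBl mul1r subrK.
have cexpln x : 0 < x -> {for x, continuous (fun x => expR (Re (w - 1) * ln x))}.
  move=> x0; apply: continuous_comp; last exact: continuous_expR.
  apply: continuous_comp; first exact: continuous_ln.
  exact: mulrl_continuous.
have cexpN x : {for x, continuous (fun x => expR (- x))}.
  by apply: continuous_comp; [exact: opp_continuous|exact: continuous_expR].
have clin x : 0 < x -> {for x, continuous (fun x => Im (w - 1) * ln x)}.
  move=> x0; apply: continuous_comp; first exact: continuous_ln.
  exact: mulrl_continuous.
apply: complex_ext.
  transitivity (\int[mu]_(x in `]0%R, +oo[)
     (expR (Re (w - 1) * ln x) * cos (Im (w - 1) * ln x) * expR (- x)))%R.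
    by apply: eq_Rintegral => x _; rewrite cpowE ReM /= mulr0 subr0.
  rewrite Rintegral_exp.
    apply: eq_Rintegral => u _; rewrite /euler_log cpowE ReM /= mulr0 subr0 !expRK.
    by rewrite ImD ImN /= subr0 -E; ring.
  move=> x x0; apply: cvgM; last exact: cexpN.
  apply: cvgM; first exact: cexpln.
  by apply: continuous_comp; [exact: clin|exact: continuous_cos].
transitivity (\int[mu]_(x in `]0%R, +oo[)
   (expR (Re (w - 1) * ln x) * sin (Im (w - 1) * ln x) * expR (- x)))%R.
  by apply: eq_Rintegral => x _; rewrite cpowE ImM /= mulr0 add0r.
rewrite Rintegral_exp.
  apply: eq_Rintegral => u _; rewrite /euler_log cpowE ImM /= mulr0 add0r !expRK.
  by rewrite ImD ImN /= subr0 -E; ring.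
move=> x x0; apply: cvgM; last exact: cexpN.
apply: cvgM; first exact: cexpln.
by apply: continuous_comp; [exact: clin|exact: continuous_sin].
Qed.

Lemma cGamma_real c : 0 < c -> cGamma c%:C = (rGamma c)%:C.
Proof.
move=> c0; rewrite /rGamma cGamma_log//.
apply: complex_ext => //; transitivity (\int[mu]_(u in setT) (0 : R))%R.
  apply: eq_Rintegral => u _; rewrite /euler_log cpowE ImM /=.
  by rewrite mul0r sin0 !mulr0 mul0r addr0.
by rewrite /Rintegral integral0.
Qed.

Lemma rGammaE c : 0 < c -> rGamma c = (\int[mu]_u expR (c * u - expR u))%R.
Proof.
move=> c0; rewrite /rGamma cGamma_log//; apply: eq_Rintegral => u _.
by rewrite /euler_log cpowE ReM /= mul0r cos0 mulr1 mulr0 subr0 expRK -expRD.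
Qed.

Lemma cvg_expNM c : 0 < c -> expR (- (c * k%:R)) @[k --> \oo] --> (0 : R).
Proof.
move=> c0; apply: (cvg_comp (fun k : nat => c * k%:R : R) (fun x => expR (- x))); last exact: cvgr_expR.
by apply: (cvg_comp (fun k : nat => k%:R : R) ( *%R c)); [exact: cvgr_idn|exact: gt0_cvgMry].
Qed.

End LogGamma.

Section GammaRecurrence.
Context {R : realType}.
Local Notation mu := (@lebesgue_measure R).
Implicit Types (s w : R[i]) (c x y u : R).

Let E c u : R := expR (c * u + -1 * expR u).

Lemma cvgr_expR_pinfty : @expR R x @[x --> +oo] --> +oo.
Proof.
apply/cvgryPge => A; near=> x.
apply: le_trans (expR_ge1Dx x); rewrite -lerBlDl; near: x.
by apply: nbhs_pinfty_ge; exact: num_real.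
Unshelve. all: by end_near. Qed.

Let EE c u : E c u = expR (c * u - expR u). Proof. by rewrite /E mulN1r. Qed.

Let ES c u : E (c + 1) u = E c u * expR u.
Proof. by rewrite !EE -expRD mulrDl mul1r; congr expR; ring. Qed.

Let derE c u : is_derive u 1 (E c) (E c u * (c - expR u)).
Proof.
apply: is_derive_eq (der_comp (f := expR) (g := fun u => c * u + -1 * expR u)
  (is_derive_expR (c * u + -1 * expR u))
  (der_add (der_lin c u) (der_scale (-1) (is_derive_expR u)))) _.
by rewrite EE !mulN1r.
Qed.

Let contE c : continuous (E c).
Proof.
move=> u; apply: continuous_comp; last exact: continuous_expR.
apply: cvgD; first exact: mulrl_continuous.
by apply: cvgM; [exact: cvg_cst|exact: continuous_expR].
Qed.

Let E_trig_cvg0 c (h : R -> R) (v : nat -> R) : 0 < c ->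
  (forall x, `|h x| <= 1) -> (forall k, `|v k| = k%:R) ->
  E c (v k) * h (v k) @[k --> \oo] --> (0 : R).
Proof.
move=> c0 h1 vk; have [C C0 hC] := euler_log_le c0.
apply/norm_cvg0P; apply: (@squeeze_cvgr _ _ _ _ (cst 0) (fun k => C * expR (- (c * k%:R)))).
- near=> k; rewrite normr_ge0/= normrM EE ger0_norm ?expR_ge0//.
  rewrite -vk (le_trans _ (hC (v k)))// ler_piMr ?expR_ge0//; exact: h1.
- exact: cvg_cst.
- rewrite -[X in _ --> X](mulr0 C); apply: cvgM; first exact: cvg_cst.
  exact: cvg_expNM.
Unshelve. all: by end_near. Qed.

(** The derivative of exp (c u - exp u) h u integrates to 0; for h the cosine and
    the sine of Im w * u this is the functional equation at w. *)
Let E_trig_FTC c (h h' : R -> R) : 0 < c ->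
  (forall x, `|h x| <= 1) -> (forall x, is_derive x 1 h (h' x)) ->
  continuous h -> continuous h' ->
  mu.-integrable setT (EFin \o (fun u => E c u * (c - expR u) * h u + E c u * h' u)) ->
  (\int[mu]_u (E c u * (c - expR u) * h u + E c u * h' u) = 0)%R.
Proof.
move=> c0 h1 dh ch ch' ih.
rewrite -[RHS](subrr 0); apply: (@Rintegral_FTC_T R (fun u => E c u * h u) _ 0 0) => //.
- by move=> u; exact: (der_mul (derE c u) (dh u)).
- move=> u; apply: cvgD; apply: cvgM.
  + apply: cvgM; first exact: contE.
    by apply: cvgB; [exact: cvg_cst|exact: continuous_expR].
  + exact: ch.
  + exact: contE.
  + exact: ch'.
- by apply: (E_trig_cvg0 c0 h1) => k; rewrite ger0_norm.
- by apply: (E_trig_cvg0 (v := fun k => - k%:R) c0 h1) => k; rewrite normrN ger0_norm.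
Qed.

Let eulE w u : euler_log w u =
  (E (Re w) u * cos (Im w * u)) +i* (E (Re w) u * sin (Im w * u)).
Proof.
rewrite EE /euler_log cpowE expRK expRD; apply: complex_ext.
  by rewrite ReM /= mulr0 subr0; ring.
by rewrite ImM /= mulr0 add0r; ring.
Qed.

Lemma cGammaS w : 0 < Re w -> cGamma (w + 1) = w * cGamma w.
Proof.
move=> w0; have w10 : 0 < Re (w + 1) by rewrite ReD/= addr_gt0.
rewrite !cGamma_log//.
have ccos : continuous (fun u : R => cos (Im w * u)).
  by move=> u; apply: continuous_comp; [exact: mulrl_continuous|exact: continuous_cos].
have csin : continuous (fun u : R => sin (Im w * u)).
  by move=> u; apply: continuous_comp; [exact: mulrl_continuous|exact: continuous_sin].
have cos1 x : `|cos (Im w * x)| <= 1 by rewrite ler_norml cos_geN1 cos_le1.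
have sin1 x : `|sin (Im w * x)| <= 1 by rewrite ler_norml sin_geN1 sin_le1.
have ccM (k : R) (h : R -> R) : continuous h -> continuous (fun u => k * h u).
  by move=> ch u; apply: cvgM; [exact: cvg_cst|exact: ch].
have dcos x := der_comp (f := cos) (g := fun u => Im w * u) (is_derive_cos (Im w * x)) (der_lin (Im w) x).
have dsin x := der_comp (f := sin) (g := fun u => Im w * u) (is_derive_sin (Im w * x)) (der_lin (Im w) x).
have [i1' i2'] := cintegrable_euler_log w0; have [j1' j2'] := cintegrable_euler_log w10.
have i1 : mu.-integrable setT (EFin \o (fun u => Re (euler_log w u))) := i1'.
have i2 : mu.-integrable setT (EFin \o (fun u => Im (euler_log w u))) := i2'.
have j1 : mu.-integrable setT (EFin \o (fun u => Re (euler_log (w + 1) u))) := j1'.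
have j2 : mu.-integrable setT (EFin \o (fun u => Im (euler_log (w + 1) u))) := j2'.
set a := Re w in w0 dcos dsin *; set b := Im w in ccos csin cos1 sin1 dcos dsin *.
have fRe u : E a u * (a - expR u) * cos (b * u) + E a u * (- sin (b * u) * b) =
    a * Re (euler_log w u) - b * Im (euler_log w u) - Re (euler_log (w + 1) u).
  by rewrite !eulE /= ReD ImD addr0 ES -/a -/b; ring.
have fIm u : E a u * (a - expR u) * sin (b * u) + E a u * (cos (b * u) * b) =
    a * Im (euler_log w u) + b * Re (euler_log w u) - Im (euler_log (w + 1) u).
  by rewrite !eulE /= ReD ImD addr0 ES -/a -/b; ring.
have k1 := RintegrableB measurableT (RintegrableZl a measurableT i1) (RintegrableZl b measurableT i2).
have k2 := RintegrableD measurableT (RintegrableZl a measurableT i2) (RintegrableZl b measurableT i1).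
have F1 := @E_trig_FTC a (fun u => cos (b * u)) (fun u => - sin (b * u) * b) w0 cos1 dcos ccos.
have F2 := @E_trig_FTC a (fun u => sin (b * u)) (fun u => cos (b * u) * b) w0 sin1 dsin csin.
move: F1 F2; rewrite (funext fRe) (funext fIm) => F1 F2.
have {}F1 := F1 _ (RintegrableB measurableT k1 j1); have {}F2 := F2 _ (RintegrableB measurableT k2 j2).
rewrite (RintegralB measurableT k1 j1) (RintegralB measurableT (RintegrableZl a measurableT i1) (RintegrableZl b measurableT i2))
  (RintegralZl _ measurableT i1) (RintegralZl _ measurableT i2) in F1.
rewrite (RintegralB measurableT k2 j2) (RintegralD measurableT (RintegrableZl a measurableT i2) (RintegrableZl b measurableT i1))
  (RintegralZl _ measurableT i1) (RintegralZl _ measurableT i2) in F2.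
apply: complex_ext.
  rewrite ReM -/a -/b; apply/esym/eqP; rewrite -subr_eq0; apply/eqP; apply: F1.
  move=> u; apply: cvgM; last exact: cvg_cst.
  by apply: cvgN; exact: csin.
rewrite ImM -/a -/b; apply/esym/eqP; rewrite -subr_eq0; apply/eqP; apply: F2.
by move=> u; apply: cvgM; [exact: ccos|exact: cvg_cst].
Qed.

Lemma rGammaS x : 0 < x -> rGamma (x + 1) = x * rGamma x.
Proof.
move=> x0; have := @cGammaS x%:C x0.
rewrite (_ : x%:C + 1 = (x + 1)%:C); last by rewrite rmorphD.
rewrite !cGamma_real//; last exact: addr_gt0.
by rewrite -rmorphM => /complexI.
Qed.

Let derF (u : R) : is_derive u 1 (fun u : R => - expR (- expR u)) (expR (1 * u - expR u)).
Proof.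
have -> : (fun u : R => - expR (- expR u)) = (fun u : R => -1 * expR (-1 * expR u)).
  by apply/funext => v; rewrite !mulN1r.
apply: is_derive_eq (der_scale (-1)
  (der_comp (f := expR) (g := fun u => -1 * expR u) (is_derive_expR (-1 * expR u)) (der_scale (-1) (is_derive_expR u)))) _.
by rewrite !mulN1r mul1r expRD; ring.
Qed.

Let contF : continuous (fun u : R => - expR (- expR u)).
Proof.
move=> u; apply: cvgN; apply: continuous_comp; last exact: continuous_expR.
by apply: cvgN; exact: continuous_expR.
Qed.

Let contf c : continuous (fun u : R => expR (c * u - expR u)).
Proof. by under eq_fun do rewrite -EE; exact: contE. Qed.

Lemma rGamma1 : rGamma (1 : R) = 1.
Proof.
rewrite rGammaE// -[RHS]add0r -[X in 0 + X]opprK.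
apply: (@Rintegral_FTC_T R (fun u : R => - expR (- expR u)) _ 0 (-1)).
- exact: derF.
- exact: contf.
- exact: integrable_euler_log_real.
- rewrite -oppr0; apply: cvgN.
  apply: (cvg_comp (fun k : nat => expR (k%:R : R)) (fun x => expR (- x))); last exact: cvgr_expR.
  apply: (cvg_comp (fun k : nat => (k%:R : R)) expR); first exact: cvgr_idn.
  exact: cvgr_expR_pinfty.
- apply: cvgN; rewrite -[X in _ --> X]expR0 -oppr0.
  apply: continuous_cvg; first exact: continuous_expR.
  apply: cvgN; have := cvg_expNM (@ltr01 R).
  by under eq_fun do rewrite mul1r.
Qed.

Lemma rGamma_nat (n : nat) : rGamma (n%:R + 1 : R) = n`!%:R.
Proof.
elim: n => [|n IH]; first by rewrite add0r rGamma1.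
by rewrite -(natr1 n) rGammaS ?ltr_wpDl// IH natr1 factS natrM.
Qed.

(** Keep only the part x > X of Euler's integral, where x^B >= X^B. *)
Lemma rGamma_lower (B X : R) : 0 <= B -> 0 < X ->
  X `^ B * expR (- X) <= rGamma (B + 1).
Proof.
move=> B0 X0; have B10 : 0 < B + 1 by rewrite ltr_wpDl.
have ib := integrable_euler_log_real B10.
rewrite rGammaE// -lee_fin /Rintegral fineK; last exact: (integrable_fin_num measurableT ib).
apply: (@le_trans _ _ (\int[mu]_(u in `[ln X, +oo[) (expR ((B + 1) * u - expR u))%:E)%E); last first.
  by apply: ge0_subset_integral => //; exact: (measurable_int _ ib).
have cl : (expR (- X))%:E = (\int[mu]_(u in `[ln X, +oo[) (expR (1 * u - expR u))%:E)%E.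
  have -> : (expR (- X))%:E = (0%:E - (- expR (- expR (ln X)))%:E)%E.
    by rewrite lnK ?posrE// -EFinB sub0r opprK.
  apply/esym; apply: (@ge0_continuous_FTC2y R _ (fun u => - expR (- expR u)) (ln X) 0).
  - by move=> u _; exact: expR_ge0.
  - by apply: continuous_subspaceT; exact: contf.
  - rewrite -oppr0; apply: cvgN.
    apply: (cvg_comp expR (fun x => expR (- x))); last exact: cvgr_expR.
    exact: cvgr_expR_pinfty.
  - by move=> u _; exact: (@ex_derive _ _ _ _ _ _ _ (derF u)).
  - by apply: cvg_at_right_filter; exact: contF.
  - by move=> u _; rewrite derive1E; exact: (@derive_val _ _ _ _ _ _ _ (derF u)).
have mf c : measurable_fun (`[ln X, +oo[%classic : set R)
    (fun u => (expR (c * u - expR u))%:E).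
  have mc : measurable_fun setT (fun u => expR (c * u - expR u)).
    by apply: continuous_measurable_fun; exact: contf.
  by apply/measurable_EFinP; exact: measurable_funTS.
have mI : measurable (`[ln X, +oo[%classic : set R) by exact: measurable_itv.
have h0 c (u : R) : (0 <= (expR (c * u - expR u))%:E)%E by rewrite lee_fin expR_ge0.
have hX : (0 <= (X `^ B)%:E)%E by rewrite lee_fin powR_ge0.
rewrite EFinM cl -ge0_integralZl; first last.
- exact: hX.
- by move=> u _; exact: h0.
- exact: mf.
- exact: mI.
apply: ge0_le_integral; first exact: mI.
- by move=> u _; apply: mule_ge0; [exact: hX|exact: h0].
- by apply: emeasurable_funM; [exact: measurable_cst|exact: mf].
- exact: mf.
move=> u.
rewrite /= in_itv/= andbT => uX; rewrite lee_fin /powR gt_eqF// -expRD ler_expR.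
rewrite (_ : (B + 1) * u - expR u = B * u + (1 * u - expR u)); last by ring.
by rewrite lerD2r ler_wpM2l.
Qed.

End GammaRecurrence.

Section GammaBeta.
Context {R : realType}.
Local Notation mu := (@lebesgue_measure R).
Implicit Types (s w : R[i]) (c x y u : R).

Lemma cintegrable_shift (b : R) (f : R -> R[i]) : cintegrable f ->
  cintegrable (fun x => f (x + b)).
Proof.
move=> [f1 f2]; split.
  exact: (@integrable_shift R b (fun x => Re (f x)) f1).
exact: (@integrable_shift R b (fun x => Im (f x)) f2).
Qed.

Lemma cpow0 x : cpow x (0 : R[i]) = 1.
Proof. by rewrite cpowE !mul0r expR0 cos0 sin0 mulr0 mulr1. Qed.

Lemma cpowVN x w : cpow x (- w) = (cpow x w)^-1.
Proof.
apply: (mulfI (cpow_neq0 x w)); rewrite -cpowD subrr cpow0 divff//.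
exact: cpow_neq0.
Qed.

Lemma cGamma_scale w (a : R) : 0 < Re w -> 0 < a ->
  cintegrable (fun u => cpow (expR u) w * (expR (- (a * expR u)))%:C) /\
  cint (fun u => cpow (expR u) w * (expR (- (a * expR u)))%:C) =
  cpow a (- w) * cGamma w.
Proof.
move=> w0 a0.
have E u : cpow (expR u) w * (expR (- (a * expR u)))%:C =
    cpow a (- w) * euler_log w (u + ln a).
  rewrite /euler_log expRD lnK ?posrE// cpowMx ?expR_gt0// cpowVN.
  by rewrite [expR u * a]mulrC; field; exact: cpow_neq0.
rewrite (funext E); have ie := cintegrable_shift (ln a) (cintegrable_euler_log w0).
have [iz ->] := cintZ (cpow a (- w)) ie; split; first exact: iz.
by rewrite (cint_shift (ln a) (cmeasurable_euler_log w)) -cGamma_log.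
Qed.

(** The integrand of the Beta integral B(s, w), in its form with
    v^(s-1) (1 + v)^(-s-w) dv over v > 0, in the coordinate v = exp u. *)
Definition beta_kernel s w (u : R) : R[i] :=
  cpow (expR u) s * cpow (1 + expR u) (- (s + w)).

Lemma normc_beta_kernel s w u :
  normc (beta_kernel s w u) = expR (Re s * u - (Re s + Re w) * ln (1 + expR u)).
Proof. by rewrite normcM !normc_cpow expRK ReN ReD mulNr expRD. Qed.

Lemma beta_kernel_le s w u : 0 < Re s -> 0 < Re w ->
  normc (beta_kernel s w u) <= expR (- (Num.min (Re s) (Re w) * `|u|)).
Proof.
move=> s0 w0; rewrite normc_beta_kernel ler_expR.
have [u0|u0] := leP 0 u.
  rewrite ger0_norm//; have lu : u <= ln (1 + expR u).
    by rewrite -[X in X <= _]expRK ler_ln ?posrE ?addr_gt0 ?expR_gt0// lerDr.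
  apply: (@le_trans _ _ (Re s * u - (Re s + Re w) * u)).
    by rewrite lerD2l lerN2 ler_wpM2l// addr_ge0// ltW.
  rewrite mulrDl opprD addrA subrr add0r lerN2 ler_wpM2r// ge_min lexx orbT//.
rewrite ltr0_norm// mulrN opprK.
apply: (@le_trans _ _ (Re s * u)).
  rewrite gerBl mulr_ge0// ?addr_ge0 ?ltW//.
  by rewrite ln_gt0// ltrDl expR_gt0.
by apply: ler_wnM2r; [exact: ltW|rewrite ge_min lexx].
Qed.

Lemma cmeasurable_beta_kernel s w : cmeasurable (beta_kernel s w).
Proof.
apply: cmeasurableM; first exact: cmeasurable_cpow_expR.
apply: (cmeasurable_cpow (h := fun u => 1 + expR u)); last exact: cmeasurable_cst.
by apply: measurable_funD; [exact: measurable_cst|exact: measurable_expR].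
Qed.

Lemma cintegrable_beta_kernel s w : 0 < Re s -> 0 < Re w ->
  cintegrable (beta_kernel s w).
Proof.
move=> s0 w0; have m0 : 0 < Num.min (Re s) (Re w) by rewrite lt_min s0.
apply: (cintegrable_le (cmeasurable_beta_kernel s w) (integrable_expNabs m0)) => u.
exact: beta_kernel_le.
Qed.

(** Euler's Beta integral, by Fubini after the inner variable is translated by the
    outer one. *)
Lemma cGamma_beta s w : 0 < Re s -> 0 < Re w ->
  cGamma s * cGamma w = cGamma (s + w) * cint (beta_kernel s w).
Proof.
move=> s0 w0; have sw0 : 0 < Re (s + w) by rewrite ReD addr_gt0.
pose F (z : R * R) := euler_log w z.1 * euler_log s (z.2 + z.1).
have FE u v : F (u, v) = cpow (expR v) s *
    (cpow (expR u) (s + w) * (expR (- ((1 + expR v) * expR u)))%:C).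
  rewrite /F /euler_log /= expRD cpowMx ?expR_gt0// cpowD.
  rewrite (_ : - ((1 + expR v) * expR u) = - expR u + - (expR v * expR u)); last by ring.
  by rewrite expRD rmorphM /=; ring.
have mF : cmeasurable F.
  have comp (f : R -> R[i]) (h : R * R -> R) : cmeasurable f ->
      measurable_fun setT h -> cmeasurable (fun z => f (h z)).
    by move=> [m1 m2] mh; split; [exact: (measurableT_comp m1 mh)|exact: (measurableT_comp m2 mh)].
  apply: cmeasurableM; apply: comp; try exact: cmeasurable_euler_log.
    exact: measurable_fst.
  by apply: measurable_funD; [exact: measurable_snd|exact: measurable_fst].
pose e := Num.min (Re s) (Re w / 2).
have e0 : 0 < e by rewrite lt_min s0 divr_gt0.
have es : e <= Re s by rewrite ge_min lexx.
have ew : 0 < Re w - e.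
  by rewrite subr_gt0 (@le_lt_trans _ _ (Re w / 2))// ?ge_min ?lexx ?orbT// ltr_pdivrMr// ltr_pMr// ltr1n.
have [C C0 hC] := euler_log_le s0; have [D D0 hD] := euler_log_le w0.
pose a (u : R) := (C * D) * expR (- ((Re w - e) * `|u|)).
pose b (v : R) := expR (- (e * `|v|)).
have dom u v : normc (F (u, v)) <= a u * b v.
  rewrite /F normcM !normc_euler_log /=.
  apply: (le_trans (ler_pM (expR_ge0 _) (expR_ge0 _) (hD u) (hC (v + u)))).
  rewrite /a /b (_ : D * _ * _ = C * D * (expR (- (Re w * `|u|)) * expR (- (Re s * `|v + u|)))); last by ring.
  rewrite -[X in _ <= X]mulrA; apply: ler_wpM2l; first by rewrite mulr_ge0// ltW.
  rewrite -!expRD ler_expR.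
  have h1 : e * `|v + u| <= Re s * `|v + u| by rewrite ler_wpM2r.
  have h2 : e * `|v| <= e * `|v + u| + e * `|u|.
    rewrite -mulrDr; apply: ler_wpM2l; first exact: ltW.
    by have := ler_normB (v + u) u; rewrite addrK.
  by rewrite mulrBl; lra.
have [_ _ sw] := cint_fubini mF
  (RintegrableZl (C * D) measurableT (integrable_expNabs ew)) (integrable_expNabs e0) dom.
clear dom hC hD.
transitivity (cint (fun u => cint (fun v => F (u, v)))).
  transitivity (cint (fun u => cGamma s * euler_log w u)).
    by have [_ ->] := cintZ (cGamma s) (cintegrable_euler_log w0); rewrite -(cGamma_log w0).
  apply: eq_cint => u; rewrite /F /=.
  have [_ ->] := cintZ (euler_log w u) (cintegrable_shift u (cintegrable_euler_log s0)).
  by rewrite (cint_shift u (cmeasurable_euler_log s)) -(cGamma_log s0); exact: mulrC.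
rewrite sw.
have [_ <-] := cintZ (cGamma (s + w)) (cintegrable_beta_kernel s0 w0).
apply: eq_cint => v.
transitivity (cint (fun u => cpow (expR v) s *
    (cpow (expR u) (s + w) * (expR (- ((1 + expR v) * expR u)))%:C))).
  by apply: eq_cint => u; exact: FE.
have v0 : 0 < 1 + expR v := addr_gt0 ltr01 (expR_gt0 v).
have [isc vsc] := cGamma_scale sw0 v0.
have [_ ->] := cintZ (cpow (expR v) s) isc.
by rewrite vsc /beta_kernel; ring.
Qed.

End GammaBeta.

Section GammaNonzero.
Context {R : realType}.
Local Notation mu := (@lebesgue_measure R).
Implicit Types (s w : R[i]) (c x y u : R).

Lemma rGamma_gt0 x : 0 < x -> 0 < rGamma x.
Proof.
move=> x0; have := rGammaS x0 => e.
have : 0 < rGamma (x + 1).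
  apply: lt_le_trans (rGamma_lower (ltW x0) ltr01).
  by rewrite mulr_gt0 ?expR_gt0// powR_gt0.
by rewrite e pmulr_rgt0.
Qed.

Lemma abs_sin_le x : `|sin x| <= `|x|.
Proof.
have pos (y : R) : 0 <= y -> `|sin y| <= `|y|.
  move=> y0; have [|c _] := @MVT_segment _ (@sin R) cos 0 y y0 (fun z _ => is_derive_sin z).
    by apply: continuous_subspaceT; exact: continuous_sin.
  by rewrite sin0 !subr0 => ->; rewrite normrM ler_piMl// cos_max.
have [x0|x0] := leP 0 x; first exact: pos.
by rewrite -normrN -sinN -[`|x|]normrN pos// oppr_ge0 ltW.
Qed.

Lemma cos_ge x : 1 - x ^+ 2 / 2 <= cos x.
Proof.
have -> : cos x = 1 - 2 * sin (x / 2) ^+ 2.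
  have e : x = x / 2 *+ 2 by rewrite -mulr_natr divfK.
  by rewrite {1}e cos_mulr2n cos2sin2; ring.
rewrite lerD2l lerN2.
have : sin (x / 2) ^+ 2 <= (x / 2) ^+ 2.
  by rewrite -[X in X <= _]real_normK ?num_real// -[X in _ <= X]real_normK ?num_real// lerXn2r ?nnegrE// abs_sin_le.
by rewrite expr_div_n; lra.
Qed.

Lemma sqr_le_cosh u : u ^+ 2 <= 4 * (expR u + expR (- u) - 2).
Proof.
have pos (v : R) : 0 <= v -> v ^+ 2 <= 4 * (expR v + expR (- v) - 2).
  move=> v0; have -> : expR v + expR (- v) - 2 = (expR (v / 2) - expR (- (v / 2))) ^+ 2.
    have e1 : expR v = expR (v / 2) ^+ 2 by rewrite -expRM_natr divfK.
    have e2 : expR (- v) = expR (- (v / 2)) ^+ 2 by rewrite -expRM_natr mulNr divfK.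
    have e3 : expR (v / 2) * expR (- (v / 2)) = 1 by rewrite -expRD subrr expR0.
    by rewrite e1 e2 sqrrB e3; ring.
  have h : v / 2 <= expR (v / 2) - expR (- (v / 2)).
    have := expR_ge1Dx (v / 2).
    have : expR (- (v / 2)) <= 1 by rewrite -expR0 ler_expR oppr_le0 divr_ge0.
    lra.
  have v2 : 0 <= v / 2 by rewrite divr_ge0.
  have : (v / 2) ^+ 2 <= (expR (v / 2) - expR (- (v / 2))) ^+ 2.
    by rewrite lerXn2r ?nnegrE ?(le_trans v2 h).
  by rewrite expr_div_n; lra.
have [u0|u0] := leP 0 u; first exact: pos.
by rewrite -sqrrN; have := pos (- u); rewrite opprK [expR (- u) + _]addrC; apply; rewrite oppr_ge0 ltW.
Qed.

(** Under the weight exp (x u - exp u) the variable u concentrates at L = ln x with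
    variance of order 1 / x, so the phase exp (i y u) barely turns.  Precisely,
    cos v >= 1 - v^2 / 2 and v^2 <= 4 (exp v + exp (- v) - 2) at v = u - L bound the
    real part of exp (- i y L) Gamma (x + i y) from below by a combination of
    Gamma (x - 1), Gamma x and Gamma (x + 1), equal to
    Gamma (x - 1) (x - 1 - 2 y^2). *)
Lemma cGamma_neq0_large x y : 1 < x -> 2 * y ^+ 2 < x - 1 ->
  cGamma (x +i* y) != 0.
Proof.
move=> x1 yx; have x0 : 0 < x := lt_trans ltr01 x1.
have xm0 : 0 < x - 1 by rewrite subr_gt0.
apply/eqP => G0.
pose L := ln x; pose ph := cos (y * L) +i* (- sin (y * L)).
have w0 : 0 < Re (x +i* y) by [].
have [ic vc] := cintZ ph (cintegrable_euler_log w0).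
have z : (\int[mu]_u Re (ph * euler_log (x +i* y) u))%R = 0.
  by have := congr1 (@Re R) vc; rewrite -(cGamma_log w0) G0 mulr0 /=.
have ReE u : Re (ph * euler_log (x +i* y) u) = expR (x * u - expR u) * cos (y * (u - L)).
  rewrite ReM /euler_log cpowE ReM ImM /= expRK expRD mulr0 mulr0 subr0 add0r mulrBr cosB; ring.
pose q (u : R) := (1 + 4 * y ^+ 2) * expR (x * u - expR u) -
   (2 * y ^+ 2 / x * expR ((x + 1) * u - expR u) + 2 * y ^+ 2 * x * expR ((x - 1) * u - expR u)).
have qle u : q u <= Re (ph * euler_log (x +i* y) u).
  have -> : q u = expR (x * u - expR u) * (1 - 2 * y ^+ 2 * (expR (u - L) + expR (- (u - L)) - 2)).
    have e1 : expR ((x + 1) * u - expR u) = expR (x * u - expR u) * expR u.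
      by rewrite -expRD; congr expR; ring.
    have e2 : expR ((x - 1) * u - expR u) = expR (x * u - expR u) / expR u.
      by rewrite -expRN -expRD; congr expR; ring.
    have e3 : expR (u - L) = expR u / x by rewrite expRD expRN /L lnK.
    have e4 : expR (- (u - L)) = x / expR u by rewrite opprB expRD expRN /L lnK.
    by rewrite /q e1 e2 e3 e4; field; rewrite !gt_eqF ?expR_gt0.
  rewrite ReE; apply: ler_wpM2l; first exact: expR_ge0.
  apply: le_trans (cos_ge _); rewrite lerD2l lerN2 exprMn.
  by have := ler_wpM2l (sqr_ge0 y) (sqr_le_cosh (u - L)); lra.
have i0 := integrable_euler_log_real x0.
have i1 := integrable_euler_log_real (addr_gt0 x0 ltr01).
have im := integrable_euler_log_real xm0.
have k0 := RintegrableZl (1 + 4 * y ^+ 2) measurableT i0.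
have k1 := RintegrableZl (2 * y ^+ 2 / x) measurableT i1.
have km := RintegrableZl (2 * y ^+ 2 * x) measurableT im.
have iq := RintegrableB measurableT k0 (RintegrableD measurableT k1 km).
have iR : mu.-integrable setT (EFin \o (fun u => Re (ph * euler_log (x +i* y) u))) := ic.1.
have : (\int[mu]_u q u <= 0)%R.
  by rewrite -z; apply: (le_Rintegral measurableT iq iR) => u _; exact: qle.
rewrite (RintegralB measurableT k0 (RintegrableD measurableT k1 km)) (RintegralD measurableT k1 km).
rewrite (RintegralZl _ measurableT i0) (RintegralZl _ measurableT i1) (RintegralZl _ measurableT im).
rewrite -(rGammaE x0) -(rGammaE (addr_gt0 x0 ltr01)) -(rGammaE xm0) (rGammaS x0).
have := rGammaS xm0; rewrite subrK => ->.
have g0 := rGamma_gt0 xm0; set g := rGamma (x - 1) in g0 *.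
have -> : (1 + 4 * y ^+ 2) * ((x - 1) * g) - (2 * y ^+ 2 / x * (x * ((x - 1) * g)) + 2 * y ^+ 2 * x * g) =
    g * ((x - 1) - 2 * y ^+ 2).
  by field; rewrite gt_eqF.
by rewrite pmulr_rle0// leNgt subr_gt0 yx.
Qed.

Lemma cGammaD_nat w (k : nat) : 0 < Re w ->
  cGamma (w + k%:R) = \prod_(j < k) (w + j%:R) * cGamma w.
Proof.
move=> w0; elim: k => [|k IH]; first by rewrite addr0 big_ord0 mul1r.
rewrite -natr1 addrA cGammaS; last by rewrite ReD natrC/= ltr_wpDr.
by rewrite IH big_ord_recr /= mulrCA mulrA.
Qed.

(** A zero would propagate to every w + k by the functional equation. *)
Lemma cGamma_neq0 w : 0 < Re w -> cGamma w != 0.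
Proof.
move=> w0; apply/eqP => G0.
pose k := (Num.truncn (2 * Im w ^+ 2 + 1)).+1.
have hk : 2 * Im w ^+ 2 + 1 < k%:R by exact: truncnS_gt.
have i2 : 0 <= 2 * Im w ^+ 2 by rewrite mulr_ge0// sqr_ge0.
have e : w + k%:R = (Re w + k%:R) +i* Im w.
  by apply: complex_ext; rewrite ?ReD ?ImD natrC//= addr0.
have := @cGamma_neq0_large (Re w + k%:R) (Im w).
rewrite -e cGammaD_nat// G0 mulr0 eqxx => h.
by have : false by apply: h; lra.
Qed.

End GammaNonzero.

(** * The negative binomial series *)

Section NegativeBinomial.
Context {R : realType}.
Local Notation mu := (@lebesgue_measure R).
Implicit Types (c x y u a : R).

Lemma rGamma_scale c a : 0 < c -> 0 < a ->
  mu.-integrable setT (EFin \o (fun u => expR (c * u - a * expR u))) /\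
  (\int[mu]_u expR (c * u - a * expR u) = expR (- (c * ln a)) * rGamma c)%R.
Proof.
move=> c0 a0.
have E : (fun u => expR (c * u - a * expR u)) =
    (fun u => expR (- (c * ln a)) * expR (c * (u + ln a) - expR (u + ln a))).
  apply/funext => u; rewrite -expRD [expR (u + _)]expRD lnK ?posrE//; congr expR; ring.
have ic := integrable_euler_log_real c0.
have is_ := @integrable_shift R (ln a) (fun u => expR (c * u - expR u)) ic.
rewrite E; split; first exact: (RintegrableZl _ measurableT is_).
rewrite (RintegralZl _ measurableT is_).
rewrite (@Rintegral_shift R (ln a) (fun u => expR (c * u - expR u))).
  by rewrite -rGammaE.
exact: Rintegrable_measurable ic.
Qed.

Lemma sum_exp_coeff_le x K : 0 <= x ->
  \sum_(0 <= k < K) (x ^+ k / k`!%:R) <= expR x.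
Proof.
move=> x0; apply: (nondecreasing_cvgn_le (u_ := series (exp_coeff x))).
  apply/nondecreasing_seqP => n; rewrite /series/= big_nat_recr//= lerDl.
  by rewrite /exp_coeff/= divr_ge0// exprn_ge0.
exact: is_cvg_series_exp_coeff.
Qed.

(** N! / (1 - x)^(N+1) is Euler's integral of v^N exp (- (1 - x) v) over v > 0, in
    which exp (x v) is expanded. *)
Lemma negative_binomial_series (N : nat) x : `|x| < 1 ->
  series (fun k => (N + k)`!%:R / k`!%:R * x ^+ k) @ \oo -->
  N`!%:R / (1 - x) ^+ N.+1.
Proof.
move=> x1.
have N0 : 0 < N%:R + 1 :> R by rewrite ltr_wpDl.
have ax0 : 0 < 1 - `|x| by rewrite subr_gt0.
have bx0 : 0 < 1 - x by rewrite subr_gt0 (le_lt_trans (ler_norm x)).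
pose f k (u : R) := x ^+ k / k`!%:R * expR ((N%:R + 1 + k%:R) * u - expR u).
pose g (u : R) := expR ((N%:R + 1) * u - (1 - `|x|) * expR u).
have fE k u : f k u = expR ((N%:R + 1) * u - expR u) * ((x * expR u) ^+ k / k`!%:R).
  rewrite /f exprMn -expRM_natl mulrDl [_ + k%:R * u]addrC -addrA expRD; ring.
have N0k (k : nat) : 0 < N%:R + 1 + k%:R :> R by rewrite ltr_wpDr.
have mf k : measurable_fun setT (f k).
  exact: (Rintegrable_measurable (RintegrableZl _ measurableT (integrable_euler_log_real (N0k k)))).
have [ig _] := rGamma_scale N0 ax0.
have fg K u : \sum_(0 <= k < K) `|f k u| <= g u.
  have -> : \sum_(0 <= k < K) `|f k u| =
      expR ((N%:R + 1) * u - expR u) * \sum_(0 <= k < K) ((`|x| * expR u) ^+ k / k`!%:R).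
    rewrite mulr_sumr; apply: eq_bigr => k _; rewrite fE normrM ger0_norm ?expR_ge0//.
    by rewrite normrM normfV normrX normrM (ger0_norm (expR_ge0 u)) normr_nat.
  have xe0 : 0 <= `|x| * expR u by rewrite mulr_ge0// expR_ge0.
  apply: (le_trans (ler_wpM2l (expR_ge0 _) (sum_exp_coeff_le K xe0))).
  by rewrite -expRD /g ler_expR le_eqVlt; apply/orP; left; apply/eqP; ring.
have [_ _ _ +] := @Rintegral_series _ _ R mu setT f g measurableT mf ig (fun K u _ => fg K u).
have -> : (fun k => \int[mu]_u f k u)%R = (fun k => (N + k)`!%:R / k`!%:R * x ^+ k).
  apply/funext => k; rewrite (RintegralZl _ measurableT (integrable_euler_log_real (N0k k))).
  rewrite -rGammaE// (_ : N%:R + 1 + k%:R = (N + k)%:R + 1); last by rewrite natrD; ring.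
  by rewrite rGamma_nat; ring.
have -> : (\int[mu]_u limn (series (f^~ u)))%R =
    (\int[mu]_u expR ((N%:R + 1) * u - (1 - x) * expR u))%R.
  apply: eq_Rintegral => u _; apply: cvg_lim => //.
  have -> : series (f^~ u) = (fun K => expR ((N%:R + 1) * u - expR u) * series (exp_coeff (x * expR u)) K).
    apply/funext => K; rewrite /series/= mulr_sumr; apply: eq_bigr => k _.
    by rewrite fE /exp_coeff.
  have -> : (N%:R + 1) * u - (1 - x) * expR u = ((N%:R + 1) * u - expR u) + x * expR u by ring.
  rewrite [X in _ --> X]expRD; have ce : series (exp_coeff (x * expR u)) @ \oo --> expR (x * expR u).
    exact: is_cvg_series_exp_coeff.
  by apply: cvgM ce; exact: cvg_cst.
have [_ ->] := rGamma_scale N0 bx0.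
rewrite rGamma_nat (_ : expR (- ((N%:R + 1) * ln (1 - x))) = ((1 - x) ^+ N.+1)^-1).
  by rewrite mulrC.
by rewrite expRN natr1 expRM_natl lnK.
Qed.

Lemma negative_binomial_sum_le (N K : nat) x : 0 <= x -> x < 1 ->
  \sum_(0 <= k < K) ((N + k)`!%:R / k`!%:R * x ^+ k) <= N`!%:R / (1 - x) ^+ N.+1.
Proof.
move=> x0 x1; have x1' : `|x| < 1 by rewrite ger0_norm.
have nb := @negative_binomial_series N x x1'.
rewrite -(cvg_lim (@Rhausdorff R) nb).
apply: (nondecreasing_cvgn_le (u_ := series (fun k => (N + k)`!%:R / k`!%:R * x ^+ k))).
  apply/nondecreasing_seqP => i; rewrite /series/= big_nat_recr//= lerDl.
  by rewrite mulr_ge0 ?exprn_ge0// divr_ge0.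
exact: cvgP nb.
Qed.

End NegativeBinomial.

(** * Mellin inversion of powers of 1 + x *)

Section MellinBase.
Context {R : realType}.
Local Notation mu := (@lebesgue_measure R).
Implicit Types (s w : R[i]) (c x y u : R).

(** The weight exp (- |y|), divided out at the end, makes f integrable on the
    plane, so that Fubini's theorem supplies the measurability. *)
Lemma measurable_Rintegral_param (f : R * R -> R) (b : R -> R) :
  measurable_fun setT f -> mu.-integrable setT (EFin \o b) ->
  (forall y u, `|f (y, u)| <= b u) ->
  measurable_fun setT (fun y => \int[mu]_u f (y, u))%R.
Proof.
move=> mf ib fb.
have me : measurable_fun setT (fun z : R * R => expR (- `|z.1|)).
  apply: measurableT_comp => //; apply: measurableT_comp => //.
  by apply: measurableT_comp => //; exact: measurable_fst.
pose F (z : R * R) := expR (- `|z.1|) * f z.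
have ie : mu.-integrable setT (EFin \o (fun y : R => expR (- `|y|))).
  apply: eq_integrable (integrable_expNabs (@ltr01 R)) => // y _.
  by rewrite /= mul1r.
have [iF jF _] := Rintegral_fubini (f := F) (measurable_funM me mf) ie ib
  (fun y u => ltac:(rewrite /F /= normrM (ger0_norm (expR_ge0 _));
     apply: ler_wpM2l; [exact: expR_ge0|exact: fb])).
have mfy y : measurable_fun setT (fun u => f (y, u)).
  by apply: (measurableT_comp mf); exact: measurable_pair1.
have ify y : mu.-integrable setT (EFin \o (fun u => f (y, u))).
  by apply: (Lintegrable_le (mfy y) ib) => u; exact: fb.
have E : (fun y => \int[mu]_u f (y, u))%R =
    (fun y => expR `|y| * \int[mu]_u F (y, u))%R.
  apply/funext => y; rewrite /F /= (RintegralZl _ measurableT (ify y)) mulrA -expRD.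
  by rewrite addrC addNr expR0 mul1r.
rewrite E; apply: measurable_funM.
  by apply: measurableT_comp => //; exact: measurableT_comp.
exact: (Rintegrable_measurable jF).
Qed.

Lemma cmeasurable_cint_param (f : R * R -> R[i]) (b : R -> R) :
  cmeasurable f -> mu.-integrable setT (EFin \o b) ->
  (forall y u, normc (f (y, u)) <= b u) ->
  cmeasurable (fun y => cint (fun u => f (y, u))).
Proof.
move=> [m1 m2] ib fb; split.
  apply: (measurable_Rintegral_param m1 ib) => y u.
  exact: le_trans (Re_le_normc _) (fb y u).
apply: (measurable_Rintegral_param m2 ib) => y u.
exact: le_trans (Im_le_normc _) (fb y u).
Qed.

(** The Mellin transform of N! (1 + x)^(-N-1), at the point c + i y. *)
Definition gamma_pair (N : nat) c y : R[i] :=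
  cGamma (c +i* y) * cGamma (N%:R + 1 - (c +i* y)).

Lemma gamma_pairE (N : nat) c y : 0 < c -> c < N%:R + 1 ->
  gamma_pair N c y =
  N`!%:R%:C * cint (beta_kernel (c +i* y) (N%:R + 1 - (c +i* y))).
Proof.
move=> c0 cN; rewrite /gamma_pair cGamma_beta//; last first.
  by rewrite ReD ReN ReD natrC/= subr_gt0.
rewrite addrC subrK; congr (_ * _).
rewrite (_ : N%:R + 1 = (N%:R + 1 : R)%:C); last by rewrite natrC rmorphD.
by rewrite cGamma_real ?ltr_wpDl// rGamma_nat.
Qed.

Lemma beta_kernel_lineE (N : nat) c y u :
  beta_kernel (c +i* y) (N%:R + 1 - (c +i* y)) u =
  (expR (c * u - (N%:R + 1) * ln (1 + expR u)) * cos (u * y)) +i*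
  (expR (c * u - (N%:R + 1) * ln (1 + expR u)) * sin (u * y)).
Proof.
rewrite /beta_kernel (_ : c +i* y + _ = N%:R + 1); last by rewrite addrC subrK.
rewrite (_ : - (N%:R + 1) = (- (N%:R + 1 : R))%:C); last first.
  by rewrite natrC rmorphN rmorphD.
rewrite !cpowE expRK /= mul0r cos0 sin0 mulr1 mulr0 expRD mulNr (mulrC u y).
by apply: complex_ext; rewrite ?ReM ?ImM /=; ring.
Qed.

Lemma cmeasurable_gamma_pair (N : nat) c : 0 < c -> c < N%:R + 1 ->
  cmeasurable (gamma_pair N c).
Proof.
move=> c0 cN; rewrite (funext (fun y => gamma_pairE y c0 cN)).
apply: cmeasurableM; first exact: cmeasurable_cst.
have d0 : 0 < N%:R + 1 - c by rewrite subr_gt0.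
have m0 : 0 < Num.min c (N%:R + 1 - c) by rewrite lt_min c0.
apply: (cmeasurable_cint_param (f := fun z =>
  beta_kernel (c +i* z.1) (N%:R + 1 - (c +i* z.1)) z.2) _ (integrable_expNabs m0)).
- have mg : measurable_fun setT (fun z : R * R =>
      expR (c * z.2 - (N%:R + 1) * ln (1 + expR z.2))).
    have mh : measurable_fun setT (fun u : R => expR (c * u - (N%:R + 1) * ln (1 + expR u))).
      apply: (measurableT_comp (@measurable_expR R)); apply: measurable_funB.
        exact: measurable_funM.
      apply: measurable_funM; first exact: measurable_cst.
      apply: (measurableT_comp (@measurable_ln R)).
      by apply: measurable_funD; [exact: measurable_cst|exact: measurable_expR].
    by apply: (measurableT_comp mh); exact: measurable_snd.
  have mp : measurable_fun setT (fun z : R * R => z.2 * z.1) by exact: measurable_funM.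
  have mc : measurable_fun setT (@cos R).
    by apply: continuous_measurable_fun; exact: continuous_cos.
  have ms : measurable_fun setT (@sin R).
    by apply: continuous_measurable_fun; exact: continuous_sin.
  rewrite (funext (fun z : R * R => beta_kernel_lineE N c z.1 z.2)).
  apply: cmeasurable_mk; apply: (measurable_funM mg).
    exact: (measurableT_comp mc mp).
  exact: (measurableT_comp ms mp).
- move=> y u; have w0 : 0 < Re (N%:R + 1 - (c +i* y)).
    by rewrite ReD ReN ReD natrC/= subr_gt0.
  have := @beta_kernel_le R (c +i* y) _ u c0 w0.
  by rewrite ReD ReN ReD natrC.
Qed.

(** Gamma (s + 2) Gamma (N + 1 - s) is bounded along the line by a Beta integral,
    and it is s (s + 1) times the pair. *)
Lemma gamma_pair_decay (N : nat) c : 0 < c -> c < N%:R + 1 ->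
  exists2 C : R, 0 <= C & forall y, normc (gamma_pair N c y) <= C * (1 + y ^+ 2)^-1.
Proof.
move=> c0 cN; have d0 : 0 < N%:R + 1 - c by rewrite subr_gt0.
have c20 : 0 < c + 2 by rewrite addr_gt0.
have m0 : 0 < Num.min (c + 2) (N%:R + 1 - c) by rewrite lt_min c20.
pose I := (2 * \int[mu]_u expR (- (Num.min (c + 2) (N%:R + 1 - c) * `|u|)))%R.
pose K := (N + 2)`!%:R * I.
have I0 : 0 <= I by rewrite mulr_ge0// Rintegral_ge0// => u _; exact: expR_ge0.
have K0 : 0 <= K by rewrite mulr_ge0.
pose e := Num.min 1 (c ^+ 2).
have e0 : 0 < e by rewrite lt_min ltr01 exprn_gt0.
exists (K / e); first by rewrite divr_ge0// ltW.
move=> y; pose s := c +i* y; pose w := N%:R + 1 - s.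
have w0 : 0 < Re w by rewrite ReD ReN ReD natrC/= subr_gt0.
have s0 : 0 < Re s by [].
have s1 : 0 < Re (s + 1) by rewrite ReD/= addr_gt0.
have s2 : 0 < Re (s + 1 + 1) by rewrite ReD/= addr_gt0.
have bnd : normc (cGamma (s + 1 + 1) * cGamma w) <= K.
  rewrite cGamma_beta// (_ : s + 1 + 1 + w = ((N + 2)%:R + 1 : R)%:C); last first.
    by rewrite /w natrC; apply: complex_ext; rewrite !(ReD, ImD, ReN, ImN)/= ?natrD; ring.
  rewrite cGamma_real ?ltr_wpDl// rGamma_nat normcM normcR normr_nat ler_wpM2l//.
  apply: (cint_normc_le (cmeasurable_beta_kernel _ _) (integrable_expNabs m0)) => u.
  have eRs : Re (s + 1 + 1) = c + 2 by rewrite !ReD /= -addrA.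
  have eRw : Re w = N%:R + 1 - c by rewrite /w ReD ReN ReD natrC.
  by have := beta_kernel_le u s2 w0; rewrite eRs eRw.
have nz : (1 + y ^+ 2) * e <= normc s * normc (s + 1).
  have h1 : normc s ^+ 2 = c ^+ 2 + y ^+ 2.
    by rewrite normcE sqr_sqrtr// addr_ge0// sqr_ge0.
  have h2 : normc s <= normc (s + 1).
    rewrite !normcE ler_wsqrtr// ReD ImD /= addr0 lerD2r.
    by rewrite lerXn2r ?nnegrE ?(ltW c0) ?addr_ge0 ?(ltW c0)// lerDl.
  apply: (@le_trans _ _ (normc s ^+ 2)); last by rewrite expr2 ler_wpM2l// normc_ge0.
  rewrite h1 mulrDl mul1r lerD// ?ge_min ?lexx ?orbT//.
  by rewrite ler_piMr ?sqr_ge0// ge_min lexx.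
have p0 : 0 < 1 + y ^+ 2 by rewrite ltr_pwDl// sqr_ge0.
have e2 : cGamma (s + 1 + 1) * cGamma w = (s + 1) * s * (cGamma s * cGamma w).
  by rewrite !cGammaS//; ring.
move: bnd; rewrite e2 normcM normcM => bnd.
rewrite /gamma_pair -/s -/w ler_pdivlMr// ler_pdivlMr//.
apply: le_trans bnd; rewrite -mulrA mulrC; apply: ler_wpM2r; first exact: normc_ge0.
by rewrite [normc (s + 1) * _]mulrC.
Qed.

End MellinBase.

Section MellinInversion.
Context {R : realType}.
Local Notation mu := (@lebesgue_measure R).
Implicit Types (s w : R[i]) (c x y u : R).

Lemma cmeasurable_line c : cmeasurable (fun y : R => c +i* y).
Proof. by apply: cmeasurable_mk; [exact: measurable_cst|exact: measurable_id]. Qed.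

Lemma cmeasurable_cpow_line c x : cmeasurable (fun y : R => cpow x (- (c +i* y))).
Proof.
apply: (cmeasurable_cpow (h := fun=> x)); first exact: measurable_cst.
by apply: cmeasurableN; exact: cmeasurable_line.
Qed.

Lemma gamma_pair_inversion (N : nat) c x : 0 < c -> c < N%:R + 1 -> 0 < x ->
  cintegrable (fun y => gamma_pair N c y * cpow x (- (c +i* y))) /\
  cint (fun y => gamma_pair N c y * cpow x (- (c +i* y))) =
  (2 * pi * (N`!%:R / (1 + x) ^+ N.+1))%:C.
Proof.
move=> c0 cN x0; set f := fun y => _.
have d0 : 0 < N%:R + 1 - c by rewrite subr_gt0.
have m0 : 0 < Num.min c (N%:R + 1 - c) by rewrite lt_min c0.
have fi : cintegrable f.
  have [C C0 hC] := gamma_pair_decay c0 cN.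
  have iG := RintegrableZr (expR (- c * ln x)) measurableT
    (RintegrableZl C measurableT (@integrable_oneDsqr R)).
  apply: (cintegrable_le _ iG) => [|y].
    by apply: cmeasurableM; [exact: cmeasurable_gamma_pair|exact: cmeasurable_cpow_line].
  rewrite normcM normc_cpow ReN /=.
  by apply: ler_wpM2r; [exact: expR_ge0|exact: hC].
split => //.
pose L := ln x.
pose B (u : R) := expR (c * u - (N%:R + 1) * ln (1 + expR u)).
pose k := N`!%:R * expR (- (c * L)).
pose g (u : R) := k * B (u + L).
have cB : continuous B.
  move=> u; apply: continuous_comp; last exact: continuous_expR.
  apply: cvgB; first exact: mulrl_continuous.
  apply: cvgM; first exact: cvg_cst.
  apply: (continuous_comp (f := fun u => 1 + expR u)).
    by apply: cvgD; [exact: cvg_cst|exact: continuous_expR].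
  by apply: continuous_ln; rewrite addr_gt0// expR_gt0.
have Ble u : `|B u| <= expR (- (Num.min c (N%:R + 1 - c) * `|u|)).
  have w0 : 0 < Re (N%:R + 1 - (c +i* 0)) by rewrite ReD ReN ReD natrC.
  have := @beta_kernel_le R (c +i* 0) _ u c0 w0.
  rewrite beta_kernel_lineE mulr0 cos0 sin0 mulr0 mulr1 normcR.
  by rewrite ReD ReN ReD natrC.
have iB : mu.-integrable setT (EFin \o B).
  exact: (Lintegrable_le (continuous_measurable_fun cB) (integrable_expNabs m0) Ble).
have ig : mu.-integrable setT (EFin \o g).
  exact: (RintegrableZl k measurableT (integrable_shift L iB)).
have cg : continuous g.
  move=> u; apply: cvgM; first exact: cvg_cst.
  apply: (continuous_comp (f := fun u => u + L)); last exact: cB.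
  by apply: cvgD; [exact: cvg_id|exact: cvg_cst].
have k0 : 0 <= k by rewrite mulr_ge0// expR_ge0.
have gk u : `|g u| <= k.
  rewrite normrM (ger0_norm k0) ler_piMr//; apply: (le_trans (Ble _)).
  by rewrite -[X in _ <= X]expR0 ler_expR oppr_le0; apply: mulr_ge0; [exact: (ltW m0)|exact: normr_ge0].
have fE y : f y = (\int[mu]_u (g u * cos (u * y)))%R +i* (\int[mu]_u (g u * sin (u * y)))%R.
  have w0 : 0 < Re (N%:R + 1 - (c +i* y)) by rewrite ReD ReN ReD natrC.
  rewrite /f (gamma_pairE y c0 cN) mulrAC.
  have ib := cintegrable_shift L (cintegrable_beta_kernel (s := c +i* y) c0 w0).
  rewrite -(cint_shift L (cmeasurable_beta_kernel _ _)).
  have [_ <-] := cintZ (N`!%:R%:C * cpow x (- (c +i* y))) ib.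
  apply: (@eq_cint R _ (fun u => (g u * cos (u * y)) +i* (g u * sin (u * y)))) => u.
  rewrite beta_kernel_lineE -/(B _) cpowE ReN ImN /= -/L.
  have e : u * y = (u + L) * y - y * L by ring.
  rewrite e cosB sinB /g /k !mulNr cosN sinN.
  by apply: complex_ext; rewrite !(ReM, ImM) /=; ring.
have i1 : mu.-integrable setT (EFin \o (fun y => \int[mu]_u (g u * cos (u * y)))%R).
  by case: fi => + _; apply: eq_integrable => // y _; rewrite fE.
have i2 : mu.-integrable setT (EFin \o (fun y => \int[mu]_u (g u * sin (u * y)))%R).
  by case: fi => _; apply: eq_integrable => // y _; rewrite fE.
rewrite (eq_cint fE); apply: complex_ext.
  transitivity (2 * pi * g 0); first exact: (fourier_inversion_at0 cg gk ig i1).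
  congr (_ * _); rewrite /g /k /B add0r expRD mulrA -[_ * expR (c * L)]mulrA -expRD.
  rewrite [- _ + _]addrC subrr expR0 mulr1 /L lnK ?posrE//; congr (_ * _).
  by rewrite expRN natr1 expRM_natl lnK// posrE addr_gt0.
exact: (Rintegral_sin_transform i2 ig).
Qed.

End MellinInversion.

(** * Mellin-Barnes integrals with polynomial weights *)

Section MellinPolynomial.
Context {R : realType}.
Implicit Types (s w : R[i]) (c x y u : R) (l : seq (R * R)).

Definition linear_prod l s : R[i] := \prod_(q <- l) (q.1%:C + q.2%:C * s).
Definition linear_prodr l x : R := \prod_(q <- l) (q.1 + q.2 * x).
Definition rising (j : nat) s : R[i] := \prod_(i < j) (s + i%:R).
Definition risingr (j : nat) x : R := \prod_(i < j) (x + i%:R).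

Lemma risingr_neg_small j k : (k < j)%N -> risingr j (- k%:R) = 0.
Proof. by move=> kj; rewrite /risingr (bigD1 (Ordinal kj))//= addNr mul0r. Qed.

Lemma risingr_neg j i :
  risingr j (- (i + j)%:R) = (-1) ^+ j * ((i + j)`!%:R / i`!%:R).
Proof.
elim: j i => [|j IH] i.
  by rewrite /risingr big_ord0 addn0 expr0 mul1r divff// pnatr_eq0 -lt0n fact_gt0.
rewrite /risingr big_ord_recr /= -[\prod_(_ < _) _]/(risingr j _) addnS -addSn IH.
rewrite factS natrM exprS natrD -natr1.
have i0 : i.+1%:R != 0 :> R by rewrite pnatr_eq0.
have f0 : i`!%:R != 0 :> R by rewrite pnatr_eq0 -lt0n fact_gt0.
rewrite -natr1 in i0 *; field; first by rewrite i0 f0.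
Qed.

Lemma cvg_series_shift (a : nat -> R) (j : nat) (v : R) :
  (forall k, (k < j)%N -> a k = 0) ->
  series (fun i => a (i + j)%N) @ \oo --> v -> series a @ \oo --> v.
Proof.
move=> a0 cv; rewrite -(cvg_shiftn j); move: cv.
suff -> : series (fun i => a (i + j)%N) = (fun K => series a (K + j)%N) by [].
apply/funext => K; rewrite /series/= (@big_cat_nat _ _ _ j 0 (K + j))//=; last exact: leq_addl.
have -> : \sum_(0 <= i < j) a i = 0.
  by rewrite big_nat; apply: big1 => i /andP[_]; exact: a0.
by rewrite add0r; have := @big_addn R 0 +%R 0%N (K + j)%N j xpredT a; rewrite add0n addnK => ->.
Qed.

(** Closing the contour on the poles of Gamma (s) at 0, -1, -2, ... would give
    this residue series.  Without residues: (s)_j Gamma (s) = Gamma (s + j) reduces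
    a rising factorial to the inversion formula on a shifted line, and rising
    factorials span all polynomials. *)
Lemma mellin_polynomial l (j n : nat) c x :
  0 < c -> c < n%:R + 1 -> 0 < x -> x < 1 ->
  let F y := rising j (c +i* y) * linear_prod l (c +i* y) *
             (gamma_pair n c y * cpow x (- (c +i* y))) in
  let a k := (-1) ^+ k * ((n + k)`!%:R / k`!%:R) *
             (risingr j (- k%:R) * linear_prodr l (- k%:R)) * x ^+ k in
  cintegrable F /\
  exists2 v, series a @ \oo --> v & cint F = (2 * pi * v)%:C.
Proof.
move=> c0 cn x0 x1; elim: l j => [|[p q] l IH] j F a.
  have cj0 : 0 < c + j%:R by rewrite ltr_wpDr.
  have cjn : c + j%:R < (n + j)%:R + 1 by rewrite natrD addrAC ltrD2r.
  have [iG vG] := gamma_pair_inversion cj0 cjn x0.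
  have [iF vF] := cintZ (x ^+ j)%:C iG.
  have FE y : F y = (x ^+ j)%:C *
      (gamma_pair (n + j) (c + j%:R) y * cpow x (- ((c + j%:R) +i* y))).
    have sE : (c + j%:R) +i* y = (c +i* y) + j%:R.
      by apply: complex_ext; rewrite ?ReD ?ImD natrC//= addr0.
    rewrite /F /gamma_pair sE cGammaD_nat// /linear_prod big_nil mulr1.
    have -> : (n + j)%:R + 1 - (c +i* y + j%:R) = n%:R + 1 - (c +i* y).
      by rewrite natrD; ring.
    have e : cpow x (- (j%:R : R[i])) = (x ^+ j)%:C^-1.
      by rewrite cpowVN natrC cpowR// powR_mulrn// ltW.
    have xj0 : (x ^+ j)%:C != 0.
      by rewrite realC_neq0// expf_neq0// gt_eqF.
    by rewrite opprD cpowD e -/(rising j _); field.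
  rewrite (funext FE) vF vG; split; first exact: iF.
  exists (x ^+ j * ((n + j)`!%:R / (1 + x) ^+ (n + j).+1)); last first.
    by rewrite -rmorphM; congr (_%:C); ring.
  apply: (cvg_series_shift (j := j)) => [k kj|].
    by rewrite /a risingr_neg_small// !(mul0r, mulr0).
  have xN : `|- x| < 1 by rewrite normrN gtr0_norm.
  have nb := @negative_binomial_series R (n + j) (- x) xN; rewrite opprK in nb.
  have -> : series (fun i => a (i + j)%N) = (fun K => x ^+ j *
      series (fun k => (n + j + k)`!%:R / k`!%:R * (- x) ^+ k) K).
    apply/funext => K; rewrite /series/= mulr_sumr; apply: eq_bigr => i _.
    rewrite /a risingr_neg /linear_prodr big_nil mulr1 -(addnA n j i).
    have f0 m : m`!%:R != 0 :> R by rewrite pnatr_eq0 -lt0n fact_gt0.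
    have sg : (-1) ^+ (i + j) * (-1) ^+ j = (-1) ^+ i :> R.
      by rewrite exprD -mulrA -expr2 sqrr_sign mulr1.
    rewrite (exprNn x) -sg (addnC j i) (_ : x ^+ (i + j) = x ^+ i * x ^+ j) ?exprD//.
    by field; rewrite !f0.
  by apply: cvgM nb; exact: cvg_cst.
have [i1 [v1 s1 e1]] := IH j.+1; have [i0 [v0 s0 e0]] := IH j.
have [k1 h1] := cintZ q%:C i1; have [k0 h0] := cintZ (p - q * j%:R)%:C i0.
have [k2 h2] := cintD k1 k0.
have FE y : F y = q%:C * (rising j.+1 (c +i* y) * linear_prod l (c +i* y) *
    (gamma_pair n c y * cpow x (- (c +i* y)))) + (p - q * j%:R)%:C *
    (rising j (c +i* y) * linear_prod l (c +i* y) *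
    (gamma_pair n c y * cpow x (- (c +i* y)))).
  rewrite /F /linear_prod big_cons /= /rising big_ord_recr /=.
  by rewrite natrC rmorphB rmorphM /=; ring.
rewrite (funext FE); split; first exact: k2.
exists (q * v1 + (p - q * j%:R) * v0); last first.
  by rewrite h2 h1 h0 e1 e0 -!rmorphM -rmorphD; congr (_%:C); ring.
pose b j0 k := (-1) ^+ k * ((n + k)`!%:R / k`!%:R) *
   (risingr j0 (- k%:R) * linear_prodr l (- k%:R)) * x ^+ k.
have -> : series a = (fun K => q * series (b j.+1) K + (p - q * j%:R) * series (b j) K).
  apply/funext => K; rewrite /series/= !mulr_sumr -big_split /=; apply: eq_bigr => k _.
  rewrite /a /b /linear_prodr big_cons /= /risingr big_ord_recr /=; ring.
by apply: cvgD; apply: cvgM; [exact: cvg_cst|exact: s1|exact: cvg_cst|exact: s0].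
Qed.

End MellinPolynomial.

(** * The Mellin-Barnes integral of the H-function *)

Section RealBeta.
Context {R : realType}.
Local Notation mu := (@lebesgue_measure R).
Implicit Types (c x y u m : R) (l : seq (R * R)).

Lemma rGamma_beta (m e : R) : 0 < m -> 0 < e ->
  mu.-integrable setT (EFin \o (fun u => expR (m * u - (m + e) * ln (1 + expR u)))) /\
  rGamma m * rGamma e =
  rGamma (m + e) * (\int[mu]_u expR (m * u - (m + e) * ln (1 + expR u)))%R.
Proof.
move=> m0 e0.
have kE u : beta_kernel m%:C e%:C u = (expR (m * u - (m + e) * ln (1 + expR u)))%:C.
  rewrite /beta_kernel -rmorphD -rmorphN !cpowE /= !mul0r cos0 sin0 !mulr1 !mulr0 expRK.
  by rewrite mulNr expRD; apply: complex_ext; rewrite ?ReM ?ImM /=; ring.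
have := @cintegrable_beta_kernel R m%:C e%:C m0 e0; have := @cGamma_beta R m%:C e%:C m0 e0.
rewrite (funext kE) cint_real -rmorphD !cGamma_real ?addr_gt0// -!rmorphM.
by move=> /complexI vE [i1 _]; split.
Qed.

Lemma linear_prod_map (M : nat) (a b : R) (s : R[i]) :
  linear_prod [seq (a + j%:R, b) | j <- iota 0 M] s =
  \prod_(j < M) (a%:C + b%:C * s + j%:R).
Proof.
rewrite /linear_prod big_map -{1}[M]subn0 -/(index_iota 0 M) big_mkord.
by apply: eq_bigr => j _ /=; rewrite natrC rmorphD /=; ring.
Qed.

Lemma linear_prodr_map (M : nat) (a b : R) x :
  linear_prodr [seq (a + j%:R, b) | j <- iota 0 M] x =
  \prod_(j < M) (a + b * x + j%:R).
Proof.
rewrite /linear_prodr big_map -{1}[M]subn0 -/(index_iota 0 M) big_mkord.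
by apply: eq_bigr => j _ /=; ring.
Qed.

Lemma rGammaD_nat x (k : nat) : 0 < x ->
  rGamma (x + k%:R) = \prod_(j < k) (x + j%:R) * rGamma x.
Proof.
move=> x0; elim: k => [|k IH]; first by rewrite addr0 big_ord0 mul1r.
rewrite -natr1 addrA rGammaS; last by rewrite ltr_wpDr.
by rewrite IH big_ord_recr /= mulrCA mulrA.
Qed.

End RealBeta.

Section GammaQuotientSeries.
Context {R : realType}.
Local Notation mu := (@lebesgue_measure R).
(* With b = n beta + 1 - beta s and m = M + 1 - r > 0, the quotient
   Gamma (b - 1 + r) / Gamma (b) is (b)_M Gamma (b - 1 + r) / Gamma (b + M), and
   b + M = (b - 1 + r) + m makes the second factor a Beta integral over
   Gamma (m). *)
Variables (n M : nat) (beta r z : R).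
Hypotheses (beta0 : 0 < beta) (beta1 : beta <= 1) (r0 : 0 < r) (rM : r < M.+1%:R).
Hypotheses (z0 : 0 < z) (z1 : z < 1).

Let m : R := M.+1%:R - r.
Let m0 : 0 < m. Proof. by rewrite subr_gt0. Qed.

(** The polynomial (b)_M = b (b + 1) ... (b + M - 1) in s. *)
Let l : seq (R * R) := [seq (n%:R * beta + 1 + j%:R, - beta) | j <- iota 0 M].

Let a (k : nat) : R :=
  (-1) ^+ k * ((n + k)`!%:R / k`!%:R) * linear_prodr l (- k%:R).

Let lE (k : nat) : linear_prodr l (- k%:R) =
  \prod_(j < M) (n%:R * beta + 1 + beta * k%:R + j%:R).
Proof. by rewrite /l linear_prodr_map; apply: eq_bigr => j _; ring. Qed.

Let a_le k : `|a k| <= (n + M + k)`!%:R / k`!%:R.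
Proof.
have nk0 : (n + k)`!%:R != 0 :> R by rewrite pnatr_eq0 -lt0n fact_gt0.
rewrite /a normrM normrM normrX normrN1 expr1n mul1r ger0_norm ?divr_ge0//.
have -> : (n + M + k)`!%:R / k`!%:R = (n + k)`!%:R / k`!%:R * ((n + M + k)`!%:R / (n + k)`!%:R) :> R.
  by field; rewrite nk0 pnatr_eq0 -lt0n fact_gt0.
apply: ler_wpM2l; first by rewrite divr_ge0.
have -> : (n + M + k)`!%:R / (n + k)`!%:R = \prod_(j < M) ((n + k)%:R + 1 + j%:R) :> R.
  rewrite -addnAC -!rGamma_nat natrD addrAC rGammaD_nat ?ltr_wpDl// mulfK//.
  by rewrite gt_eqF// rGamma_gt0// ltr_wpDl.
rewrite lE normr_prod; apply: ler_prod => j _; rewrite normr_ge0/=.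
rewrite ger0_norm; last by rewrite !addr_ge0// mulr_ge0// ltW.
rewrite lerD2r natrD -addrA [1 + _]addrC addrA lerD2r lerD//.
  by rewrite ler_piMr.
by rewrite ler_piMl.
Qed.

(** Summing the residue series against the Beta weight: each power of
    z (1 + exp u)^(-beta) integrates to a quotient of Gamma values. *)
Lemma gamma_quotient_series :
  let wgt u := expR (m * u - (n%:R * beta + 1 + M%:R) * ln (1 + expR u)) in
  let X u := z * expR (- (beta * ln (1 + expR u))) in
  [/\ forall u, 0 < X u < 1,
      forall u, cvgn (series (fun k => a k * X u ^+ k)),
      mu.-integrable setT
        (EFin \o (fun u => wgt u * limn (series (fun k => a k * X u ^+ k)))) &
      series (fun k => (-1) ^+ k * ((n + k)`!%:R / k`!%:R) *
         (rGamma (n%:R * beta + beta * k%:R + r) /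
          rGamma (n%:R * beta + beta * k%:R + 1)) * z ^+ k) @ \oo -->
      (rGamma m)^-1 * (\int[mu]_u (wgt u * limn (series (fun k => a k * X u ^+ k))))%R].
Proof.
move=> wgt X.
have lnp (u : R) : 0 < ln (1 + expR u) by rewrite ln_gt0// ltrDl expR_gt0.
have X01 u : 0 < X u < 1.
  rewrite mulr_gt0 ?expR_gt0//= (le_lt_trans _ z1)// ler_piMr ?(ltW z0)//.
  by rewrite -[X in _ <= X]expR0 ler_expR oppr_le0 mulr_ge0// ltW.
have Xz u : X u <= z.
  rewrite ler_piMr ?(ltW z0)// -[X in _ <= X]expR0 ler_expR oppr_le0.
  by rewrite mulr_ge0// ltW.
have bk0 (k : nat) : 0 <= n%:R * beta + beta * k%:R.
  by rewrite addr_ge0// mulr_ge0// ltW.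
have bkr (k : nat) : 0 < n%:R * beta + beta * k%:R + r by rewrite ltr_wpDl.
have bk1 (k : nat) : 0 < n%:R * beta + beta * k%:R + 1 by rewrite ltr_wpDl.
pose f k u := wgt u * (a k * X u ^+ k).
have fE k u : f k u = (a k * z ^+ k) *
    expR (m * u - (m + (n%:R * beta + beta * k%:R + r)) * ln (1 + expR u)).
  have -> : expR (m * u - (m + (n%:R * beta + beta * k%:R + r)) * ln (1 + expR u)) =
      wgt u * expR (- (beta * ln (1 + expR u))) ^+ k.
    by rewrite -expRM_natl -expRD; congr expR; rewrite /m -natr1; ring.
  by rewrite /f /X exprMn; ring.
pose S := (n + M)`!%:R / (1 - z) ^+ (n + M).+1 : R.
have partial_le K := negative_binomial_sum_le (n + M) K (ltW z0) z1.
have ik k := (rGamma_beta m0 (bkr k)).1.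
have mf k : measurable_fun setT (f k).
  rewrite (funext (fE k)).
  exact: (Rintegrable_measurable (RintegrableZl (a k * z ^+ k) measurableT (ik k))).
have wE : wgt = (fun u => expR (m * u - (m + (n%:R * beta + beta * 0%:R + r)) * ln (1 + expR u))).
  by apply/funext => u; rewrite /wgt; congr expR; rewrite /m -natr1; ring.
have iw : mu.-integrable setT (EFin \o wgt) by rewrite wE; exact: (ik 0%N).
have fg K u : \sum_(0 <= k < K) `|f k u| <= wgt u * S.
  apply: (@le_trans _ _ (wgt u * \sum_(0 <= k < K) ((n + M + k)`!%:R / k`!%:R * z ^+ k))).
    rewrite mulr_sumr; apply: ler_sum => k _.
    rewrite /f normrM ger0_norm ?expR_ge0// ler_wpM2l ?expR_ge0// normrM.
    have /andP[X0 _] := X01 u.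
    apply: ler_pM; [exact: normr_ge0|exact: normr_ge0|exact: a_le|].
    by rewrite normrX gtr0_norm// lerXn2r ?nnegrE ?(ltW X0) ?(ltW z0).
  by apply: ler_wpM2l; [exact: expR_ge0|exact: partial_le].
have [cf _ il sf] := @Rintegral_series _ _ R mu setT f (fun u => wgt u * S) measurableT mf
  (RintegrableZr S measurableT iw) (fun K u _ => fg K u).
have seriesE u : series (f^~ u) = (fun K => wgt u * series (fun k => a k * X u ^+ k) K).
  by apply/funext => K; rewrite /series/= mulr_sumr.
have w0 u : wgt u != 0 by rewrite gt_eqF// expR_gt0.
have cs u : cvgn (series (fun k => a k * X u ^+ k)).
  have -> : series (fun k => a k * X u ^+ k) = (fun K => (wgt u)^-1 * series (f^~ u) K).
    by apply/funext => K; rewrite seriesE mulKf.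
  by apply: is_cvgM; [exact: is_cvg_cst|exact: cf].
have limE u : limn (series (f^~ u)) = wgt u * limn (series (fun k => a k * X u ^+ k)).
  rewrite seriesE; apply: cvg_lim; first exact: Rhausdorff.
  by apply: cvgM; [exact: cvg_cst|exact: cs].
split; [exact: X01|exact: cs|by rewrite -(funext limE)|].
rewrite -(funext limE).
have gm0 : rGamma m != 0 by rewrite gt_eqF// rGamma_gt0.
have -> : series (fun k => (-1) ^+ k * ((n + k)`!%:R / k`!%:R) *
         (rGamma (n%:R * beta + beta * k%:R + r) /
          rGamma (n%:R * beta + beta * k%:R + 1)) * z ^+ k) =
    (fun K => (rGamma m)^-1 * series (fun k => \int[mu]_u f k u)%R K).
  apply/funext => K; rewrite /series/= mulr_sumr; apply: eq_bigr => k _.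
  have -> : (\int[mu]_u f k u)%R = a k * z ^+ k *
      (\int[mu]_u expR (m * u - (m + (n%:R * beta + beta * k%:R + r)) * ln (1 + expR u)))%R.
    rewrite -(RintegralZl _ measurableT (ik k)).
    by apply: eq_Rintegral => u _; exact: fE.
  have [_ bE] := rGamma_beta m0 (bkr k).
  have e1 : m + (n%:R * beta + beta * k%:R + r) = n%:R * beta + beta * k%:R + 1 + M%:R.
    by rewrite /m -natr1; ring.
  have gb0 : rGamma (n%:R * beta + beta * k%:R + 1) != 0 by rewrite gt_eqF// rGamma_gt0.
  set I := (\int[mu]_u _)%R in bE *.
  have lp : linear_prodr l (- k%:R) != 0.
    rewrite lE; apply/prodf_neq0 => j _.
    by rewrite gt_eqF// ltr_wpDr// addrAC ltr_wpDl.
  have IE : I = rGamma m * rGamma (n%:R * beta + beta * k%:R + r) /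
      (linear_prodr l (- k%:R) * rGamma (n%:R * beta + beta * k%:R + 1)).
    have : rGamma (n%:R * beta + beta * k%:R + 1 + M%:R) =
        linear_prodr l (- k%:R) * rGamma (n%:R * beta + beta * k%:R + 1).
      rewrite rGammaD_nat// lE; congr (_ * _); apply: eq_bigr => j _; ring.
    rewrite e1 in bE => <-; rewrite bE mulrC mulKf// gt_eqF// rGamma_gt0// ltr_wpDr//.
  have kf0 : k`!%:R != 0 :> R by rewrite pnatr_eq0 -lt0n fact_gt0.
  rewrite IE /a; move: (linear_prodr _ _) (rGamma m) (rGamma _) (rGamma _) lp gm0 gb0.
  by move=> A B C D A0 B0 D0; field; rewrite A0 B0 D0 kf0.
by apply: cvgM; [exact: cvg_cst|exact: sf].
Qed.

Variable c : R.
Hypotheses (c0 : 0 < c) (cn : c < n%:R + 1) (cr : c < n%:R + r / beta).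

Let b (y : R) : R[i] := (n%:R * beta + 1)%:C - beta%:C * (c +i* y).
Let br (y : R) : R[i] := (n%:R * beta + r)%:C - beta%:C * (c +i* y).

Let Re_b y : Re (b y) = n%:R * beta + 1 - beta * c.
Proof. by rewrite /b ReD ReN ReM /= mul0r subr0. Qed.

Let Re_br y : Re (br y) = n%:R * beta + r - beta * c.
Proof. by rewrite /br ReD ReN ReM /= mul0r subr0. Qed.

Let b_gt0 y : 0 < Re (b y).
Proof.
rewrite Re_b subr_gt0; have : beta * c < beta * (n%:R + 1) by rewrite ltr_pM2l.
by move=> /lt_le_trans; apply; rewrite mulrDr mulr1 mulrC lerD2l.
Qed.

Let br_gt0 y : 0 < Re (br y).
Proof.
rewrite Re_br subr_gt0; have : beta * c < beta * (n%:R + r / beta) by rewrite ltr_pM2l.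
by rewrite mulrDr [beta * (r / beta)]mulrC divfK ?gt_eqF// (mulrC beta n%:R).
Qed.

Let quotientE y : cGamma (br y) / cGamma (b y) =
  (rGamma m)%:C^-1 * linear_prod l (c +i* y) * cint (beta_kernel m%:C (br y)).
Proof.
have e1 : m%:C + br y = b y + M%:R.
  rewrite /br /b natrC addrA -rmorphD [RHS]addrAC -rmorphD.
  by congr (_%:C - _); rewrite /m -natr1; ring.
have := @cGamma_beta R m%:C (br y) m0 (br_gt0 y).
rewrite cGamma_real// e1 (cGammaD_nat M (b_gt0 y)).
have -> : \prod_(j < M) (b y + j%:R) = linear_prod l (c +i* y).
  rewrite /l linear_prod_map; apply: eq_bigr => j _; congr (_ + _).
  by rewrite /b rmorphN mulNr.
have g0 := cGamma_neq0 (b_gt0 y).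
have gm0 : (rGamma m)%:C != 0 := realC_neq0 (lt0r_neq0 (rGamma_gt0 m0)).
move=> e; apply: (mulfI gm0); rewrite [LHS]mulrA e; field.
by rewrite g0 gm0.
Qed.

(** Inserting the Beta integral for the quotient and exchanging the two integrals
    leaves, for each u, a polynomially weighted Mellin-Barnes integral at
    z (1 + exp u)^(-beta) < 1, whose residue series is then integrated in u. *)
Lemma mellin_barnes_gamma_quotient :
  let f y := gamma_pair n c y * (cGamma (br y) / cGamma (b y)) * cpow z (- (c +i* y)) in
  exists W : R,
  [/\ series (fun k => (-1) ^+ k * ((n + k)`!%:R / k`!%:R) *
         (rGamma (n%:R * beta + beta * k%:R + r) /
          rGamma (n%:R * beta + beta * k%:R + 1)) * z ^+ k) @ \oo --> W,
      cintegrable f & cint f = (2 * pi * W)%:C].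
Proof.
move=> f; have [X01 cs iv sW] := gamma_quotient_series.
pose wgt (u : R) := expR (m * u - (n%:R * beta + 1 + M%:R) * ln (1 + expR u)).
pose X (u : R) := z * expR (- (beta * ln (1 + expR u))).
pose v u := limn (series (fun k => a k * X u ^+ k)).
rewrite -/X -/wgt in X01 cs iv sW *.
exists ((rGamma m)^-1 * (\int[mu]_u (wgt u * v u)))%R.
pose p y := linear_prod l (c +i* y) * (gamma_pair n c y * cpow z (- (c +i* y))).
pose F (t : R * R) := p t.1 * beta_kernel m%:C (br t.1) t.2.
have rising0 s : rising 0 s = 1 :> R[i] by rewrite /rising big_ord0.
have ip : cintegrable p.
  have [+ _] := mellin_polynomial l 0 c0 cn z0 z1.
  by under eq_fun do rewrite rising0 mul1r.
pose dr := n%:R * beta + r - beta * c.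
have dr0 : 0 < dr by rewrite /dr -(Re_br 0).
have [iB _] := rGamma_beta m0 dr0.
have dom y u : normc (F (y, u)) <=
    normc (p y) * expR (m * u - (m + dr) * ln (1 + expR u)).
  by rewrite /F /= normcM normc_beta_kernel Re_br.
have mline : cmeasurable (fun t : R * R => c +i* t.1).
  by apply: cmeasurable_mk; [exact: measurable_cst|exact: measurable_fst].
have mF : cmeasurable F.
  apply: cmeasurableM.
    have [p1 p2] := cintegrable_cmeasurable ip.
    by split; [apply: (measurableT_comp p1)|apply: (measurableT_comp p2)]; exact: measurable_fst.
  apply: cmeasurableM.
    apply: (cmeasurable_cpow (h := fun t : R * R => expR t.2)); last exact: cmeasurable_cst.
    by apply: (measurableT_comp (@measurable_expR R)); exact: measurable_snd.
  apply: (cmeasurable_cpow (h := fun t : R * R => 1 + expR t.2)).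
    apply: measurable_funD; first exact: measurable_cst.
    by apply: (measurableT_comp (@measurable_expR R)); exact: measurable_snd.
  apply: cmeasurableN; apply: cmeasurableD; first exact: cmeasurable_cst.
  apply: cmeasurableD; first exact: cmeasurable_cst.
  by apply: cmeasurableN; apply: cmeasurableM; [exact: cmeasurable_cst|exact: mline].
have [_ iy sw] := cint_fubini mF (cintegrable_normc ip) iB dom.
clear dom.
have gm0 : (rGamma m)%:C != 0 := realC_neq0 (lt0r_neq0 (rGamma_gt0 m0)).
have fE y : f y = (rGamma m)%:C^-1 * cint (fun u => F (y, u)).
  have [_ e] := cintZ (p y) (cintegrable_beta_kernel (s := m%:C) m0 (br_gt0 y)).
  by rewrite /F /= e /f quotientE /p; ring.
have [k1 k2] := cintZ (rGamma m)%:C^-1 iy.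
rewrite (funext fE) k2 sw; split; [exact: sW|exact: k1|].
have Fu u : cint (fun y => F (y, u)) = (2 * pi * (wgt u * v u))%:C.
  have FE y : F (y, u) = (wgt u)%:C * (rising 0 (c +i* y) * linear_prod l (c +i* y) *
      (gamma_pair n c y * cpow (X u) (- (c +i* y)))).
    rewrite rising0 mul1r /F /p /= /beta_kernel.
    suff e : cpow z (- (c +i* y)) * (cpow (expR u) m%:C * cpow (1 + expR u) (- (m%:C + br y))) =
        (wgt u)%:C * cpow (X u) (- (c +i* y)).
      rewrite -mulrA -[X in _ * X]mulrA e; ring.
    have eb : - (m%:C + br y) = (- (n%:R * beta + 1 + M%:R))%:C + beta%:C * (c +i* y).
      rewrite /br addrA -rmorphD opprB addrC -rmorphN; congr (_%:C + _).
      by rewrite /m -natr1; ring.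
    rewrite eb cpowD /X (cpowMx _ z0 (expR_gt0 _)) !cpowE !expRK.
    rewrite !(ReM, ImM, ReN, ImN) /= !mul0r !subr0 !addr0 cos0 sin0 !mulr1 !mulr0.
    have -> : - c * - (beta * ln (1 + expR u)) = beta * c * ln (1 + expR u) by ring.
    have -> : - y * - (beta * ln (1 + expR u)) = beta * y * ln (1 + expR u) by ring.
    rewrite /wgt expRD -mulNr.
    by apply: complex_ext; rewrite !(ReM, ImM) /=; ring.
  have /andP[X0 X1] := X01 u.
  have [iu [w sw' ew]] := mellin_polynomial l 0 c0 cn X0 X1.
  have vE : v u = w.
    apply: cvg_lim; first exact: Rhausdorff.
    by move: sw'; under eq_fun do rewrite /risingr big_ord0 mul1r.
  rewrite (funext FE); have [_ ->] := cintZ (wgt u)%:C iu.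
  by rewrite ew -rmorphM -vE; congr (_%:C); ring.
rewrite (funext Fu) cint_real (RintegralZl _ measurableT iv) -fmorphV -rmorphM.
by congr (_%:C); ring.
Qed.

End GammaQuotientSeries.

(** * Mixing the fractional Poisson law over the gamma density *)

Section WrightTerm.
Context {R : realType}.

Lemma wright_termE (n : nat) (beta r z : R) (k : nat) :
  wright_term [:: (n%:R + 1, 1); (n%:R * beta + r, beta)]
    [:: (n%:R * beta + 1, beta)] (- z) k =
  (-1) ^+ k * ((n + k)`!%:R / k`!%:R) *
    (rGamma (n%:R * beta + beta * k%:R + r) /
     rGamma (n%:R * beta + beta * k%:R + 1)) * z ^+ k.
Proof.
rewrite /wright_term !big_cons !big_nil /= !mulr1 mul1r (exprNn z).
rewrite (_ : n%:R + 1 + k%:R = (n + k)%:R + 1); last by rewrite natrD addrAC.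
rewrite rGamma_nat (addrAC _ r) (addrAC _ 1); ring.
Qed.

End WrightTerm.

Section GammaMixture.
Context {R : realType}.
Local Notation mu := (@lebesgue_measure R).
Implicit Types (c a x y : R).

Lemma gamma_integral c a : 0 < c -> 0 < a ->
  mu.-integrable `]0, +oo[ (EFin \o (fun y => expR ((c - 1) * ln y - a * y))) /\
  (\int[mu]_(y in `]0, +oo[) expR ((c - 1) * ln y - a * y) =
   expR (- (c * ln a)) * rGamma c)%R.
Proof.
move=> c0 a0; have [iG vG] := rGamma_scale c0 a0.
have cont x : 0 < x -> {for x, continuous (fun y => expR ((c - 1) * ln y - a * y))}.
  move=> x0; apply: continuous_comp; last exact: continuous_expR.
  apply: cvgB; last exact: mulrl_continuous.
  by apply: continuous_comp; [exact: continuous_ln|exact: mulrl_continuous].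
have E u : expR ((c - 1) * ln (expR u) - a * expR u) * expR u = expR (c * u - a * expR u).
  by rewrite -expRD expRK; congr expR; ring.
split; last first.
  by rewrite Rintegral_exp// -vG; apply: eq_Rintegral => u _; exact: E.
apply/integrableP; split.
  apply/measurable_EFinP; apply: open_continuous_measurable_fun; first exact: interval_open.
  by move=> x; rewrite inE/= in_itv/= andbT; exact: cont.
have -> : (\int[mu]_(y in `]0%R, +oo[) `|(EFin \o (fun y => expR ((c - 1) * ln y - a * y))) y| =
    \int[mu]_(y in `]0%R, +oo[) (expR ((c - 1) * ln y - a * y))%:E)%E.
  by apply: eq_integral => y _; rewrite /= ger0_norm// expR_ge0.
rewrite ge0_integral_exp//.
rewrite [X in (X < _)%E](_ : _ = \int[mu]_u (expR (c * u - a * expR u))%:E)%E.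
  exact: (integrable_lty measurableT iG).
by apply: eq_integral => u _; rewrite -E.
Qed.

(** Any theta with lambda < theta^beta and theta < alpha makes
    1 / Gamma (B + 1) <= exp (theta y) (theta y)^(-B) summable against the gamma
    density; this is where lambda < alpha^beta enters. *)
Lemma exists_theta (beta alpha lambda : R) : 0 < beta -> 0 < alpha -> 0 < lambda ->
  lambda < alpha `^ beta -> exists2 theta : R, 0 < theta < alpha & lambda < theta `^ beta.
Proof.
move=> b0 a0 l0 la; pose h := (lambda + alpha `^ beta) / 2.
have lh : lambda < h by rewrite /h; lra.
have ha : h < alpha `^ beta by rewrite /h; lra.
have h0 : 0 < h := lt_trans l0 lh.
have hb : (h `^ beta^-1) `^ beta = h by rewrite -powRrM mulVf ?gt_eqF// powRr1// ltW.
exists (h `^ beta^-1); last by rewrite hb.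
rewrite powR_gt0//= ltNge; apply/negP => ah.
have := ge0_ler_powR (ltW b0); move=> /(_ alpha (h `^ beta^-1)).
rewrite !nnegrE (ltW a0) powR_ge0 hb => /(_ isT isT ah).
by rewrite leNgt ha.
Qed.

Variables (n : nat) (beta alpha lambda r : R).
Hypotheses (beta0 : 0 < beta) (alpha0 : 0 < alpha) (r0 : 0 < r).
Hypotheses (lambda0 : 0 < lambda) (lambda_lt : lambda < alpha `^ beta).

Let z : R := lambda / alpha `^ beta.
Let K : R := (rGamma r * n`!%:R)^-1 * z ^+ n.
Let B (k : nat) : R := beta * (k + n)%:R.

Let B0 k : 0 <= B k. Proof. by rewrite mulr_ge0// ltW. Qed.
Let Br0 k : 0 < B k + r. Proof. by rewrite ltr_wpDl. Qed.
Let B10 k : 0 < B k + 1. Proof. by rewrite ltr_wpDl. Qed.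

Let fact0 m : m`!%:R != 0 :> R. Proof. by rewrite pnatr_eq0 -lt0n fact_gt0. Qed.

(** w is the gamma density, q k the k-th term of the fractional Poisson series,
    f k their product with the factor of the series, and C k the constant in f k
    once the powers of y are collected. *)
Let w (y : R) : R := alpha `^ r / rGamma r * expR ((r - 1) * ln y - alpha * y).
Let q (k : nat) (y : R) : R :=
  (n + k)`!%:R / k`!%:R * ((- (lambda * y `^ beta)) ^+ k / rGamma (B k + 1)).
Let f (k : nat) (y : R) : R := w y * ((lambda * y `^ beta) ^+ n / n`!%:R * q k y).
Let C (k : nat) : R := alpha `^ r / rGamma r * (lambda ^+ (n + k) / n`!%:R) *
  ((-1) ^+ k * ((n + k)`!%:R / k`!%:R) / rGamma (B k + 1)).

Let powR_expr (y : R) (j : nat) : 0 < y -> (y `^ beta) ^+ j = expR (beta * j%:R * ln y).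
Proof.
move=> y0; rewrite -powR_mulrn ?powR_ge0// -powRrM /powR gt_eqF//.
Qed.

Let fE k y : 0 < y -> f k y = C k * expR ((B k + r - 1) * ln y - alpha * y).
Proof.
move=> y0; rewrite /f /q /w /C /B.
have -> : expR ((beta * (k + n)%:R + r - 1) * ln y - alpha * y) =
    expR ((r - 1) * ln y - alpha * y) * ((y `^ beta) ^+ n * (y `^ beta) ^+ k).
  by rewrite !powR_expr// -!expRD natrD; congr expR; ring.
rewrite (exprNn (lambda * _)) !exprMn exprD; ring.
Qed.

Let z01 : 0 < z < 1.
Proof. by rewrite divr_gt0 ?powR_gt0//= ltr_pdivrMr ?powR_gt0// mul1r. Qed.

Let dominated : exists2 g : R -> R,
  mu.-integrable `]0, +oo[ (EFin \o g) &
  forall J y, 0 < y -> \sum_(0 <= k < J) `|f k y| <= g y.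
Proof.
have [theta /andP[t0 ta] lt] := exists_theta beta0 alpha0 lambda0 lambda_lt.
pose x := lambda / theta `^ beta.
have tb0 : 0 < theta `^ beta by rewrite powR_gt0.
have x0 : 0 < x by rewrite divr_gt0.
have x1 : x < 1 by rewrite ltr_pdivrMr// mul1r.
pose S := n`!%:R / (1 - x) ^+ n.+1.
have partial_le J := negative_binomial_sum_le n J (ltW x0) x1.
pose A := alpha `^ r / rGamma r * (x ^+ n / n`!%:R * S).
have A0 : 0 <= alpha `^ r / rGamma r * (x ^+ n / n`!%:R).
  by rewrite mulr_ge0// divr_ge0 ?powR_ge0 ?exprn_ge0 ?(ltW x0)// ltW// rGamma_gt0.
have at0 : 0 < alpha - theta by rewrite subr_gt0.
have [iG _] := gamma_integral r0 at0.
exists (fun y => A * expR ((r - 1) * ln y - (alpha - theta) * y)).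
  by apply: RintegrableZl => //; exact: measurable_itv.
move=> J y y0.
have term k : `|f k y| <= alpha `^ r / rGamma r * (x ^+ n / n`!%:R) *
    expR ((r - 1) * ln y - (alpha - theta) * y) * ((n + k)`!%:R / k`!%:R * x ^+ k).
  have ty0 : 0 < theta * y by rewrite mulr_gt0.
  have low := rGamma_lower (B0 k) ty0.
  have lowp : 0 < (theta * y) `^ B k * expR (- (theta * y)).
    by rewrite mulr_gt0 ?powR_gt0// expR_gt0.
  have inv : (rGamma (B k + 1))^-1 <= ((theta * y) `^ B k * expR (- (theta * y)))^-1.
    by rewrite lef_pV2 ?posrE// rGamma_gt0.
  have -> : `|f k y| = alpha `^ r / rGamma r * expR ((r - 1) * ln y - alpha * y) *
      (lambda ^+ (n + k) * ((y `^ beta) ^+ n * (y `^ beta) ^+ k) / n`!%:R) *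
      ((n + k)`!%:R / k`!%:R) * (rGamma (B k + 1))^-1.
    rewrite /f /q /w !normrM !normfV !normr_nat !normrX normrN.
    rewrite !normrM (ger0_norm (expR_ge0 _)) (ger0_norm (powR_ge0 _ _)) (ger0_norm (powR_ge0 _ _)).
    rewrite (gtr0_norm (rGamma_gt0 r0)) (gtr0_norm (rGamma_gt0 (B10 k))) (gtr0_norm lambda0).
    rewrite !exprMn exprD; ring.
  have e1 : lambda ^+ (n + k) * ((y `^ beta) ^+ n * (y `^ beta) ^+ k) =
      x ^+ n * x ^+ k * (theta * y) `^ B k.
    have -> : (theta * y) `^ B k = (theta `^ beta) ^+ n * (theta `^ beta) ^+ k *
        ((y `^ beta) ^+ n * (y `^ beta) ^+ k).
      rewrite /B powRrM powR_mulrn ?powR_ge0// powRM ?(ltW t0) ?(ltW y0)//.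
      by rewrite addnC exprMn !exprD.
    rewrite /x !expr_div_n exprD; field.
    by rewrite !expf_neq0// gt_eqF.
  have e2 : expR ((r - 1) * ln y - (alpha - theta) * y) =
      expR ((r - 1) * ln y - alpha * y) * expR (theta * y).
    by rewrite -expRD; congr expR; ring.
  rewrite e1 e2.
  have P0 : 0 <= alpha `^ r / rGamma r * expR ((r - 1) * ln y - alpha * y) *
      (x ^+ n * x ^+ k * (theta * y) `^ B k / n`!%:R) * ((n + k)`!%:R / k`!%:R).
    rewrite !mulr_ge0 ?invr_ge0 ?powR_ge0 ?expR_ge0 ?exprn_ge0 ?(ltW x0) ?ler0n//.
    by rewrite ltW// rGamma_gt0.
  apply: (le_trans (ler_wpM2l P0 inv)).
  have ne : (theta * y) `^ B k != 0 by rewrite gt_eqF// powR_gt0.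
  rewrite expRN le_eqVlt; apply/orP; left; apply/eqP; field.
  by rewrite ne !fact0 gt_eqF ?rGamma_gt0// gt_eqF// expR_gt0.
apply: (le_trans (ler_sum _ (fun k _ => term k))).
rewrite -mulr_sumr /A.
have -> : alpha `^ r / rGamma r * (x ^+ n / n`!%:R * S) *
    expR ((r - 1) * ln y - (alpha - theta) * y) =
    alpha `^ r / rGamma r * (x ^+ n / n`!%:R) *
    expR ((r - 1) * ln y - (alpha - theta) * y) * S by ring.
by apply: ler_wpM2l; [rewrite mulr_ge0// expR_ge0|exact: partial_le].
Qed.

(** Term by term, Euler's integral gives Gamma (beta (n + k) + r) / alpha^(beta (n + k) + r),
    which turns lambda into lambda / alpha^beta. *)
Lemma gamma_mixture_series :
  mu.-integrable `]0, +oo[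
    (EFin \o (fun y => gamma_pdf alpha r y * fpp_pmf beta lambda y n)) /\
  series (fun k => (-1) ^+ k * ((n + k)`!%:R / k`!%:R) *
    (rGamma (n%:R * beta + beta * k%:R + r) /
     rGamma (n%:R * beta + beta * k%:R + 1)) * z ^+ k) @ \oo -->
  K^-1 * (\int[mu]_(y in `]0, +oo[) (gamma_pdf alpha r y * fpp_pmf beta lambda y n))%R.
Proof.
have [g ig fg] := dominated.
have mD : measurable (`]0, +oo[%classic : set R) by exact: measurable_itv.
have ik k := (gamma_integral (Br0 k) alpha0).1.
have DE (y : R) : (`]0, +oo[%classic : set R) y -> 0 < y by rewrite /= in_itv/= andbT.
have ifk k : mu.-integrable `]0, +oo[ (EFin \o f k).
  have := RintegrableZl (m := mu) (D := `]0%R, +oo[%classic) (C k) mD (ik k); apply: eq_integrable => // y.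
  by rewrite inE => /DE y0; rewrite /= fE.
have mf k : measurable_fun (`]0, +oo[%classic : set R) (f k).
  exact: (Rintegrable_measurable (ifk k)).
have [cf _ il sf] := @Rintegral_series _ _ R mu `]0%R, +oo[%classic f g mD mf ig (fun J y Dy => fg J y (DE y Dy)).
have limE (y : R) : (`]0, +oo[%classic : set R) y ->
    limn (series (f^~ y)) = gamma_pdf alpha r y * fpp_pmf beta lambda y n.
  move=> Dy; have y0 := DE y Dy.
  have wE : w y = gamma_pdf alpha r y.
    have e : y `^ (r - 1) = expR ((r - 1) * ln y) by rewrite /powR gt_eqF.
    by rewrite /w /gamma_pdf y0 e -[RHS]mulrA -expRD.
  pose c := w y * ((lambda * y `^ beta) ^+ n / n`!%:R).
  have c0 : c != 0.
    rewrite !mulf_neq0 ?invr_eq0 ?fact0 ?expf_neq0 ?mulf_neq0// ?gt_eqF ?powR_gt0 ?expR_gt0 ?rGamma_gt0//.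
  have sE : series (f^~ y) = (fun J => c * series (q^~ y) J).
    by apply/funext => J; rewrite /series/= mulr_sumr; apply: eq_bigr => k _; rewrite /f /c mulrA.
  have cq : cvgn (series (q^~ y)).
    have -> : series (q^~ y) = (fun J => c^-1 * series (f^~ y) J).
      by apply/funext => J; rewrite sE mulKf.
    by apply: is_cvgM; [exact: is_cvg_cst|exact: cf].
  rewrite /fpp_pmf mulrA -wE -/c sE; apply: cvg_lim; first exact: Rhausdorff.
  by apply: cvgM; [exact: cvg_cst|exact: cq].
split.
  move: il; apply: eq_integrable => // y; rewrite inE => Dy.
  by rewrite /= limE.
have <- : (\int[mu]_(y in `]0, +oo[) limn (series (f^~ y)))%R =
    (\int[mu]_(y in `]0, +oo[) (gamma_pdf alpha r y * fpp_pmf beta lambda y n))%R.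
  by apply: eq_Rintegral => y; rewrite inE => Dy; exact: limE.
have K0 : K != 0.
  have /andP[zz _] := z01.
  by rewrite mulf_neq0// ?invr_eq0 ?mulf_neq0 ?fact0 ?expf_neq0// gt_eqF ?rGamma_gt0.
have -> : series (fun k => (-1) ^+ k * ((n + k)`!%:R / k`!%:R) *
    (rGamma (n%:R * beta + beta * k%:R + r) /
     rGamma (n%:R * beta + beta * k%:R + 1)) * z ^+ k) =
    (fun J => K^-1 * series (fun k => \int[mu]_(y in `]0, +oo[) f k y)%R J).
  apply/funext => J; rewrite /series/= mulr_sumr; apply: eq_bigr => k _.
  have -> : (\int[mu]_(y in `]0, +oo[) f k y)%R =
      C k * (expR (- ((B k + r) * ln alpha)) * rGamma (B k + r)).
    rewrite -(gamma_integral (Br0 k) alpha0).2 -(RintegralZl (mu := mu) (D := `]0%R, +oo[%classic) _ mD (ik k)).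
    by apply: eq_Rintegral => y; rewrite inE => /DE y0; exact: fE.
  have Be : n%:R * beta + beta * k%:R = B k by rewrite /B natrD; ring.
  have ae : expR (- ((B k + r) * ln alpha)) =
      (alpha `^ r)^-1 * ((alpha `^ beta) ^+ n)^-1 * ((alpha `^ beta) ^+ k)^-1.
    rewrite -!powR_mulrn ?powR_ge0// -!powRrM /powR gt_eqF// -!expRN -!expRD.
    by congr expR; rewrite /B natrD; ring.
  rewrite Be ae /C /K /z !expr_div_n exprD.
  have g1 : rGamma r != 0 by rewrite gt_eqF// rGamma_gt0.
  have g2 : rGamma (B k + 1) != 0 by rewrite gt_eqF// rGamma_gt0.
  have a1 : alpha `^ r != 0 by rewrite gt_eqF// powR_gt0.
  have a2 : (alpha `^ beta) ^+ n != 0 by rewrite expf_neq0// gt_eqF// powR_gt0.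
  have a3 : (alpha `^ beta) ^+ k != 0 by rewrite expf_neq0// gt_eqF// powR_gt0.
  have l1 : lambda ^+ n != 0 by rewrite expf_neq0// gt_eqF.
  move: (fact0 n) (fact0 k) g1 g2 a1 a2 a3 l1.
  move: (rGamma r) (rGamma (B k + 1)) (rGamma (B k + r)) (alpha `^ r)
    ((alpha `^ beta) ^+ n) ((alpha `^ beta) ^+ k) (lambda ^+ n) (lambda ^+ k)
    (n`!%:R : R) (k`!%:R : R) ((-1) ^+ k : R) => v1 v2 v3 v4 v5 v6 v7 v8 v9 v10 v11.
  move=> h1 h2 h3 h4 h5 h6 h7 h8; field.
  by rewrite h1 h2 h3 h4 h5 h6 h7 h8.
by apply: cvgM; [exact: cvg_cst|exact: sf].
Qed.

End GammaMixture.

(** * The law of the time-changed process *)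

Section LimitSets.
Context {R : realType} {d : measure_display} {T : measurableType d}.
Variable P : probability T R.

Lemma measurable_eventually (A_ : nat -> set T) (A : set T) :
  (forall k, measurable (A_ k)) ->
  (forall w, \forall k \near \oo, A_ k w <-> A w) -> measurable A.
Proof.
move=> mA lim; have -> : A = \bigcup_K \bigcap_k A_ (K + k)%N.
  apply/seteqP; split => w /=.
    move=> Aw; have [K _ hK] := lim w; exists K => // k _.
    by apply/(hK (K + k)%N) => //=; exact: leq_addr.
  move=> [K _ hK]; have [J _ hJ] := lim w.
  by apply/(hJ (K + J)%N); [exact: leq_addl|exact: hK].
by apply: bigcup_measurable => K _; exact: bigcapT_measurable.
Qed.

Lemma cvg_probability_eventually (A_ : nat -> set T) (A : set T) :
  (forall k, measurable (A_ k)) ->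
  (forall w, \forall k \near \oo, A_ k w <-> A w) ->
  fine (P (A_ k)) @[k --> \oo] --> fine (P A).
Proof.
move=> mA lim; have mA' := measurable_eventually mA lim.
have E (B : set T) : measurable B -> fine (P B) = (\int[P]_w \1_B w)%R.
  by move=> mB; rewrite /Rintegral integral_indic// setIT.
rewrite E//; under eq_fun do rewrite E//.
have [||||_] := @Rintegral_dominated _ _ _ P setT (fun k => \1_(A_ k)) (\1_A) (cst 1) measurableT.
- by move=> k; exact: measurable_indic.
- move=> w _; apply: cvg_near_cst; near=> k.
  have AE : A_ k w <-> A w by near: k; exact: lim.
  have e : (w \in A_ k) = (w \in A) by apply/idP/idP => /set_mem/AE/mem_set.
  by rewrite /= !indicE e.
- by apply/finite_measure_integrable_cst.
- by move=> k w _ /=; rewrite indicE; case: (_ \in _); rewrite ?normr1 ?normr0.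
by [].
Unshelve. all: by end_near. Qed.

End LimitSets.

Section Discretization.
Context {R : realType}.
Local Notation mu := (@lebesgue_measure R).

Lemma measurable_truncn : measurable_fun setT (@Num.truncn R).
Proof.
move=> _ Y _; rewrite setTI.
have -> : (@Num.truncn R) @^-1` Y = \bigcup_(j in Y) [set x | Num.truncn x = j].
  apply/seteqP; split => x /=; first by move=> Yx; exists (Num.truncn x).
  by move=> [j Yj ->].
apply: bigcup_measurable => j _.
have le_meas i : measurable [set x : R | (Num.truncn x <= i)%N].
  have -> : [set x : R | (Num.truncn x <= i)%N] = `]-oo, i.+1%:R[%classic.
    by apply/seteqP; split => x /=; rewrite in_itv/= truncn_le_nat.
  exact: measurable_itv.
case: j => [|j].
  have -> : [set x : R | Num.truncn x = 0%N] = [set x : R | (Num.truncn x <= 0)%N].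
    by apply/seteqP; split => x /=; rewrite leqn0 => /eqP.
  exact: le_meas.
have -> : [set x : R | Num.truncn x = j.+1] =
    [set x : R | (Num.truncn x <= j.+1)%N] `\` [set x : R | (Num.truncn x <= j)%N].
  apply/seteqP; split => x /=; first by move=> ->; rewrite ltnn.
  by move=> [h1 /negP]; rewrite -ltnNge => h2; apply/eqP; rewrite eqn_leq h1.
exact: measurableD.
Qed.

(** The point mesh k (cell k y) is the right end of the cell of width 1 / (k + 1)
    that contains y: it lies strictly to the right of y, as right-continuity
    requires. *)
Definition cell (k : nat) (y : R) : nat := Num.truncn (k.+1%:R * y).
Definition mesh (k j : nat) : R := j.+1%:R / k.+1%:R.

Lemma mesh_gt0 k j : 0 < mesh k j. Proof. by rewrite divr_gt0. Qed.

Lemma measurable_cell k : measurable_fun setT (cell k).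
Proof. by apply: (measurableT_comp measurable_truncn); exact: measurable_funM. Qed.

Lemma mesh_cell k y : 0 <= y -> y < mesh k (cell k y) <= y + k.+1%:R^-1.
Proof.
move=> y0; have k0 : 0 < k.+1%:R :> R by rewrite ltr0n.
rewrite /mesh ltr_pdivlMr// mulrC truncnS_gt/= ler_pdivrMr// mulrDl mulVf ?gt_eqF//.
have := @truncn_itv R (k.+1%:R * y); rewrite mulr_ge0// => /(_ isT)/andP[h _].
by rewrite -natr1 lerD2r mulrC.
Qed.

Lemma near_mesh (y : R) (Q : R -> Prop) : 0 <= y ->
  (\forall u \near y^'+, Q u) -> \forall k \near \oo, Q (mesh k (cell k y)).
Proof.
move=> y0 [e /= e0 he]; near=> k.
have /andP[h1 h2] := mesh_cell k y0.
apply: he => //=; rewrite distrC ger0_norm ?subr_ge0 ?(ltW h1)//.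
rewrite ltrBlDl (le_lt_trans h2)// ltrD2l.
near: k; exact: (near_infty_natSinv_lt (PosNum e0)).
Unshelve. all: by end_near. Qed.

Lemma measurable_gamma_pdf (a r : R) : measurable_fun setT (gamma_pdf a r).
Proof.
apply: measurable_fun_ifT.
- exact: measurable_fun_ltr.
- apply: measurable_funM; last first.
    apply: (measurableT_comp (@measurable_expR R)); apply: measurable_funN.
    exact: measurable_funM.
  by apply: measurable_funM; [exact: measurable_cst|exact: measurable_powR].
- exact: measurable_cst.
Qed.

End Discretization.

Section TimeChange.
Context {R : realType} {d : measure_display} {T : measurableType d}.
Variable P : probability T R.
Local Notation mu := (@lebesgue_measure R).

Variables (N : R -> T -> nat) (X : T -> R) (g : R -> R).
Hypothesis mN : forall s : R, 0 <= s -> measurable_fun setT (N s).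
Hypothesis cN : forall w (s : R), 0 <= s -> \forall u \near s^'+, N u w = N s w.
Hypothesis mX : measurable_fun setT X.
Hypothesis X0 : forall w, 0 <= X w.
Hypothesis mg : measurable_fun setT g.
Hypothesis g0 : forall y, 0 <= g y.
Hypothesis gneg : forall y : R, y <= 0 -> g y = 0.
Hypothesis lawX : forall B, measurable B ->
  P (X @^-1` B) = (\int[mu]_(y in B) (g y)%:E)%E.
Hypothesis indep : forall (s : R) n B, 0 <= s -> measurable B ->
  P (N s @^-1` [set n] `&` X @^-1` B) = (P (N s @^-1` [set n]) * P (X @^-1` B))%E.

Variable n : nat.
Let q s := fine (P (N s @^-1` [set n])).
Let A (k : nat) := [set w | N (mesh k (cell k (X w))) w = n].

Let mNn s : 0 <= s -> measurable (N s @^-1` [set n]).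
Proof. by move=> s0; rewrite -[X in measurable X]setTI; exact: mN. Qed.

Let mcell k j : measurable (@cell R k @^-1` [set j]).
Proof. by rewrite -[X in measurable X]setTI; exact: measurable_cell. Qed.

Let mXB B : measurable B -> measurable (X @^-1` B).
Proof. by move=> mB; rewrite -[X in measurable X]setTI; exact: mX. Qed.

Let AE k : A k = \bigcup_j (N (mesh k j) @^-1` [set n] `&` X @^-1` (@cell R k @^-1` [set j])).
Proof.
apply/seteqP; split => w /=; first by move=> Aw; exists (cell k (X w)).
by move=> [j _ [/= e1 e2]]; rewrite /A /= e2.
Qed.

Let mpiece k j : measurable (N (mesh k j) @^-1` [set n] `&` X @^-1` (@cell R k @^-1` [set j])).
Proof. by apply: measurableI; [apply: mNn; exact: ltW (mesh_gt0 _ _)|exact: mXB]. Qed.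

Let mA k : measurable (A k).
Proof. by rewrite AE; apply: bigcupT_measurable => j; exact: mpiece. Qed.

Let limA w : \forall k \near \oo, A k w <-> N (X w) w = n.
Proof.
have := near_mesh (X0 w) (cN w (X0 w)).
by apply: filterS => k e; rewrite /A /= e.
Qed.

Let qE s : 0 <= s -> P (N s @^-1` [set n]) = (q s)%:E.
Proof. by move=> s0; rewrite /q fineK// fin_num_measure//; exact: mNn. Qed.

Let q01 s : 0 <= s -> 0 <= q s <= 1.
Proof.
move=> s0; rewrite -!lee_fin -qE// measure_ge0/=.
by apply: probability_le1; exact: mNn.
Qed.

Let mqg k : measurable_fun setT (fun y => q (mesh k (cell k y)) * g y).
Proof.
apply: measurable_funM => //.
apply: (@measurable_comp _ _ _ _ _ _ setT (fun j => q (mesh k j))) => //.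
exact: measurable_cell.
Qed.

Let PA k : P (A k) = (\int[mu]_y (q (mesh k (cell k y)) * g y)%:E)%E.
Proof.
rewrite AE measure_semi_bigcup//; last 2 first.
- move=> i j _ _ [w [[_ /= e1] [_ /= e2]]]; by rewrite -e1 -e2.
- exact: bigcupT_measurable.
have -> : [set: R] = \bigcup_j (@cell R k @^-1` [set j]).
  by apply/seteqP; split => y // _; exists (cell k y).
rewrite ge0_integral_bigcup//; last 4 first.
- by move=> j; exact: mcell.
- apply: (measurable_funS measurableT) => //; apply/measurable_EFinP; exact: mqg.
- move=> y _; rewrite lee_fin mulr_ge0//.
  by have /andP[] := q01 (ltW (mesh_gt0 k (cell k y))).
- by move=> i j _ _ [w [/= e1 e2]]; rewrite -e1 -e2.
apply: eq_eseriesr => j _.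
have m0 := ltW (mesh_gt0 (R := R) k j); have /andP[q0 _] := q01 m0.
transitivity (P (N (mesh k j) @^-1` [set n]) * P (X @^-1` (@cell R k @^-1` [set j])))%E.
  exact: (indep n m0 (mcell k j)).
rewrite qE// lawX// -ge0_integralZl//; last 3 first.
- exact: mcell.
- by apply: (measurable_funS measurableT) => //; apply/measurable_EFinP; exact: mg.
- by move=> y _; rewrite lee_fin.
by apply: eq_integral => y; rewrite inE /= => ->.
Qed.

(** For the time X frozen at the right end of its mesh cell, independence applies
    cell by cell.  Right-continuity of the paths brings the frozen events back to
    the event at time X. *)
Lemma measurable_time_change : measurable [set w | N (X w) w = n].
Proof. exact: (measurable_eventually mA limA). Qed.

(** Both sides of the formula for the frozen time converge: the probabilities
    because the events are eventually equal at each point, the integrals because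
    the density dominates. *)
Lemma time_change_law :
  fine (P [set w | N (X w) w = n]) =
  (\int[mu]_(y in `]0, +oo[) (g y * fine (P [set w | N y w = n])))%R.
Proof.
have ig : mu.-integrable setT (EFin \o g).
  apply/integrableP; split; first exact/measurable_EFinP.
  have -> : (\int[mu]_y `|(EFin \o g) y| = \int[mu]_y (g y)%:E)%E.
    by apply: eq_integral => y _; rewrite /= ger0_norm.
  by rewrite -lawX// ltey_eq fin_num_measure// preimage_setT.
have lim y : q (mesh k (cell k y)) * g y @[k --> \oo] --> q y * g y.
  have [y0|y0] := leP y 0.
    by rewrite gneg// mulr0; under eq_fun do rewrite mulr0; exact: cvg_cst.
  apply: cvgM; last exact: cvg_cst.
  apply: cvg_probability_eventually => [k|w]; first exact: mNn (ltW (mesh_gt0 _ _)).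
  have := near_mesh (ltW y0) (cN w (ltW y0)).
  by apply: filterS => k /= ->.
have dom k y : `|q (mesh k (cell k y)) * g y| <= g y.
  have /andP[q0 q1] := q01 (ltW (mesh_gt0 k (cell k y))).
  by rewrite ger0_norm ?mulr_ge0// ler_piMl.
have [_ cI] := Rintegral_dominated (m := mu) measurableT mqg (fun y _ => lim y) ig
  (fun k y _ => dom k y).
have cP := cvg_probability_eventually (P := P) mA limA.
have PI : (fun k => fine (P (A k))) = (fun k => \int[mu]_y (q (mesh k (cell k y)) * g y))%R.
  by apply/funext => k; rewrite PA.
rewrite PI in cP; rewrite -(cvg_lim (@Rhausdorff R) cP) (cvg_lim (@Rhausdorff R) cI).
rewrite [RHS]Rintegral_mkcond; apply: eq_Rintegral => y _.
rewrite /patch; case: ifPn => [_|]; first by rewrite mulrC.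
rewrite notin_setE/= in_itv/= andbT => /negP; rewrite -leNgt => y0.
by rewrite gneg// mulr0.
Qed.

End TimeChange.

(** * The Wright function as an H-function *)

Section WrightFoxH.
Context {R : realType}.
Variables (n : nat) (beta r z : R).
Hypotheses (beta0 : 0 < beta) (beta1 : beta <= 1) (r0 : 0 < r).
Hypotheses (z0 : 0 < z) (z1 : z < 1).

Let num : seq (R * R) := [:: (n%:R + 1, 1); (n%:R * beta + r, beta)].
Let den : seq (R * R) := [:: (n%:R * beta + 1, beta)].
Let top : seq (R * R) := [:: (- n%:R, 1); (1 - n%:R * beta - r, beta)].
Let bot : seq (R * R) := [:: (0, 1); (- (n%:R * beta), beta)].

(* Only the poles nearest to the line, at k = 0, constrain it. *)
Let separatingE c : separating 1 2 top bot c <->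
  [/\ 0 < c, c < n%:R + 1 & c < n%:R + r / beta].
Proof.
have e : (1 - (1 - n%:R * beta - r) + 0%:R) / beta = n%:R + r / beta.
  by field; rewrite gt_eqF.
split=> [[h1 h2]|[c0 cn cr]].
  have := h1 (0, 1); rewrite /= inE eqxx => /(_ isT 0%N) /=.
  rewrite !addr0 oppr0 mul0r => c0.
  have := h2 (- n%:R, 1); rewrite /= inE eqxx => /(_ isT 0%N) /=.
  rewrite addr0 divr1 opprK addrC => cn.
  have := h2 (1 - n%:R * beta - r, beta); rewrite /= !inE eqxx orbT => /(_ isT 0%N) /=.
  by rewrite e => cr.
split=> q /=.
  rewrite inE => /eqP -> k /=.
  by rewrite add0r divr1 (le_lt_trans _ c0)// oppr_le0.
rewrite !inE => /orP[/eqP ->|/eqP ->] k /=.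
  by rewrite divr1 opprK (lt_le_trans cn)// addrC lerDl.
rewrite (lt_le_trans cr)// -e ler_pM2r ?invr_gt0// lerD2l.
by rewrite ler_nat.
Qed.

Let foxH_integrandE c y : foxH_integrand 1 2 top bot z (c +i* y) =
  gamma_pair n c y *
  (cGamma ((n%:R * beta + r)%:C - beta%:C * (c +i* y)) /
   cGamma ((n%:R * beta + 1)%:C - beta%:C * (c +i* y))) * cpow z (- (c +i* y)).
Proof.
rewrite /foxH_integrand /= !big_cons !big_nil /= /gamma_pair natrC.
rewrite !(rmorphB, rmorphN, rmorphD, rmorph1, rmorph0).
set s := c +i* y.
have -> : 0 + 1 * s = s by ring.
have -> : 1 - - n%:R%:C - 1 * s = n%:R%:C + 1 - s by ring.
have -> : 1 - (1 - (n%:R * beta)%:C - r%:C) - beta%:C * s = (n%:R * beta)%:C + r%:C - beta%:C * s by ring.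
have -> : 1 - - (n%:R * beta)%:C - beta%:C * s = (n%:R * beta)%:C + 1 - beta%:C * s by ring.
by rewrite !mulr1 mul1r !mulrA.
Qed.

Lemma wright_is_foxH :
  cvgn (series (wright_term num den (- z))) /\
  is_foxH 1 2 top bot z (wright num den (- z))%:C.
Proof.
have key c : separating 1 2 top bot c ->
    let f y := foxH_integrand 1 2 top bot z (c +i* y) * (0 +i* 1) in
    [/\ cvgn (series (wright_term num den (- z))), cintegrable f &
        (wright num den (- z))%:C = (2 * pi%:C * (0 +i* 1))^-1 * cint f].
  move=> /separatingE[c0 cn cr] f.
  have [W [sW iW eW]] := mellin_barnes_gamma_quotient beta0 beta1 r0 (truncnS_gt r) z0 z1 c0 cn cr.
  have wE : wright_term num den (- z) = fun k => (-1) ^+ k * ((n + k)`!%:R / k`!%:R) *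
      (rGamma (n%:R * beta + beta * k%:R + r) /
       rGamma (n%:R * beta + beta * k%:R + 1)) * z ^+ k.
    by apply/funext => k; exact: wright_termE.
  rewrite -wE in sW; split; first exact: cvgP sW.
    rewrite /f; under eq_fun do rewrite foxH_integrandE mulrC.
    exact: (cintZ (0 +i* 1) iW).1.
  rewrite /wright (cvg_lim (@Rhausdorff R) sW) /f.
  under eq_fun do rewrite foxH_integrandE mulrC.
  rewrite (cintZ (0 +i* 1) iW).2 eW.
  have i0 : (0 +i* 1 : R[i]) != 0 by rewrite eq_complex /= oner_eq0 andbF.
  have p0 : pi%:C != 0 :> R[i] by rewrite realC_neq0// gt_eqF// pi_gt0.
  have -> : (2 * pi * W)%:C = 2 * pi%:C * W%:C :> R[i] by rewrite !rmorphM rmorph_nat.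
  move: (0 +i* 1) i0 (pi%:C) p0 (W%:C) => i i0 q q0 w; field.
  by rewrite i0 q0.
pose c := Num.min (n%:R + 1) (n%:R + r / beta) / 2.
have m0 : 0 < Num.min (n%:R + 1) (n%:R + r / beta).
  by rewrite lt_min !ltr_wpDl// divr_gt0.
have sc : separating 1 2 top bot c.
  apply/separatingE.
  have ltm : c < Num.min (n%:R + 1) (n%:R + r / beta).
    by rewrite /c ltr_pdivrMr// ltr_pMr// ltr1n.
  by move: (ltm); rewrite lt_min => /andP[]; split => //; rewrite divr_gt0.
have [cw _ _] := key c sc; split => //; split.
- by [].
- move=> q; rewrite /= !inE => /or4P[] /eqP -> //=.
- by exists c.
- by move=> c' /key[].
Qed.

End WrightFoxH.

Unset Implicit Arguments.
Set Strict Implicit.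
Set Printing Implicit Defensive.

Theorem theorem4p1 (R : realType) (d : measure_display) (T : measurableType d)
    (P : probability T R) (beta alpha p lambda : R)
    (N : R -> {RV P >-> nat}) (G : R -> {RV P >-> R})
    (hbeta0 : 0 < beta) (hbeta1 : beta <= 1)
    (halpha : 0 < alpha) (hp : 0 < p)
    (hlambda0 : 0 < lambda) (hlambda : lambda < alpha `^ beta)
    (hG : gamma_process alpha p G)
    (hN : fractional_poisson_process beta lambda N)
    (hNG : independent_processes P N G)
    (t : R) (ht : 0 < t) :
  measurable_fun setT (fnbp N G t) /\
  forall n : nat,
    let z := lambda / alpha `^ beta in
    let delta := P [set w | fnbp N G t w = n] in
    let K := (rGamma (p * t) * n`!%:R)^-1 * z ^+ n in
    let num := [:: (n%:R + 1, 1); (n%:R * beta + p * t, beta)] in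
    let den := [:: (n%:R * beta + 1, beta)] in
    [/\ cvgn (series (wright_term num den (- z))),
        delta = (K * wright num den (- z))%:E &
        exists2 h : R[i],
          is_foxH 1 2
            [:: (- n%:R, 1); (1 - n%:R * beta - p * t, beta)]
            [:: (0, 1); (- (n%:R * beta), beta)] z h &
          (fine delta)%:C = K%:C * h].
Proof.
have [Gpath _ _ Glaw] := hG; have [Npath Nlaw] := hN.
have r0 : 0 < p * t by rewrite mulr_gt0.
have ab0 : 0 < alpha `^ beta by rewrite powR_gt0.
have G0 w : 0 <= G t w.
  by have [e mono _] := Gpath w; rewrite -e; apply: mono => //; exact: ltW.
have mG : measurable_fun setT (G t) by exact: measurable_funPT.
have mN s : 0 <= s -> measurable_fun setT (N s) by move=> _; exact: measurable_funPT.
have cN w s : 0 <= s -> \forall u \near s^'+, N u w = N s w.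
  by have [_ _] := Npath w; apply.
have pdf0 y : 0 <= gamma_pdf alpha (p * t) y.
  rewrite /gamma_pdf; case: ifPn => // _.
  by rewrite !mulr_ge0 ?powR_ge0 ?expR_ge0 ?invr_ge0// ltW// rGamma_gt0.
have pdfneg y : y <= 0 -> gamma_pdf alpha (p * t) y = 0.
  by move=> y0; rewrite /gamma_pdf ltNge y0.
have indep s n B : 0 <= s -> measurable B ->
    P (N s @^-1` [set n] `&` G t @^-1` B) =
    (P (N s @^-1` [set n]) * P (G t @^-1` B))%E.
  move=> s0 mB; apply: hNG; apply: sub_sigma_algebra.
    by exists s => //; exists [set n].
  by exists t; [exact: ltW|exists B].
have lawG B : measurable B -> P (G t @^-1` B) =
    (\int[lebesgue_measure]_(y in B) (gamma_pdf alpha (p * t) y)%:E)%E.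
  exact: Glaw.
have mg := measurable_gamma_pdf alpha (p * t).
have mfnbp n : measurable [set w | fnbp N G t w = n].
  exact: (measurable_time_change mN cN mG G0).
split=> [_ Y _|n].
  rewrite setTI (_ : _ @^-1` Y = \bigcup_(n in Y) [set w | fnbp N G t w = n]).
    by apply: bigcup_measurable => n _; exact: mfnbp.
  by apply/seteqP; split => w /=; [move=> Yw; exists (fnbp N G t w)|move=> [n Yn ->]].
move=> z delta K num den.
have z0 : 0 < z by rewrite divr_gt0.
have z1 : z < 1 by rewrite ltr_pdivrMr// mul1r.
have [cw foxw] := wright_is_foxH n hbeta0 hbeta1 r0 z0 z1.
have K0 : K != 0.
  by rewrite gt_eqF// mulr_gt0 ?exprn_gt0// invr_gt0 mulr_gt0 ?rGamma_gt0// ltr0n fact_gt0.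
have [_ mix] := gamma_mixture_series n hbeta0 halpha r0 hlambda0 hlambda.
have dE : fine delta = K * wright num den (- z).
  rewrite /delta (time_change_law mN cN mG G0 mg pdf0 pdfneg lawG indep).
  have -> : wright num den (- z) = K^-1 * (\int[lebesgue_measure]_(y in `]0%R, +oo[)
      (gamma_pdf alpha (p * t) y * fpp_pmf beta lambda y n))%R.
    rewrite /wright (funext (wright_termE n beta (p * t) z)).
    exact: (cvg_lim (@Rhausdorff R) mix).
  rewrite mulVKf//; apply: eq_Rintegral => y; rewrite inE/= in_itv/= andbT => y0.
  by rewrite Nlaw// ltW.
have deltaE : delta = (K * wright num den (- z))%:E.
  by rewrite -dE fineK// fin_num_measure//; exact: mfnbp.
split => //; exists (wright num den (- z))%:C; first exact: foxw.
by rewrite dE rmorphM.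
Qed.
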